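(* Let $d\in\mathbb{N}$, fix an integer $0\le q<d$, and let $P$ be a stationary and ergodic probability measure on $\Omega=[0,1]^{\mathcal{K}^d}$ which is a product measure. Let $L_q^n=\int_0^1\beta_q^n(t)\,dt$. Then there exists a constant $\tau^2\ge0$ (depending on $d,q$) such that, as $n\to\infty$, $$\frac{1}{|\Lambda_n|}E\Big[\big(L_q^n-E[L_q^n]\big)^2\Big]\to\tau^2\quad\text{and}\quad\frac{1}{|\Lambda_n|^{1/2}}\big(L_q^n-E[L_q^n]\big)\Rightarrow\mathcal{N}(0,\tau^2),$$ where $\Rightarrow$ denotes convergence in law.
   Context: An elementary interval is $[l,l+1]$ or $[l]=[l,l]$ with $l\in\mathbb{Z}$; an elementary cube in $\mathbb{R}^d$ is a product of $d$ elementary intervals, of dimension equal to the number of nondegenerate factors; $\mathcal{K}^d$ is the set of all elementary cubes. A cubical set is a union of elementary cubes. For a cubical set $X$, $C_k(X)$ is the free $\mathbb{Z}$-module on the $k$-dimensional elementary cubes contained in $X$ with the standard cubical boundary operator; $H_k(X)$ is the resulting homology and, for bounded $X$, $\beta_k(X)$ is the rank of the free part of $H_k(X)$. $\Omega=[0,1]^{\mathcal{K}^d}$ with product topology and Borel $\sigma$-field, $\omega=(\omega_Q)_{Q\in\mathcal{K}^d}$; $\tau_x\omega=(\omega_{-x+Q})_Q$ for $x\in\mathbb{Z}^d$; stationarity: $P\circ\tau_x^{-1}=P$ for all $x$; ergodicity: translation-invariant events have probability $0$ or $1$; $E$ is expectation under $P$. $X(t)=\bigcup\{Q:\omega_Q\le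 t\}$, $\Lambda_n=[-n,n]^d$, $X^n(t)=X(t)\cap\Lambda_n$, $\beta_q^n(t)=\beta_q(X^n(t))$, $|\Lambda_n|=(2n)^d$. *)

(* Defs.v *)
From HB Require Import structures.
From mathcomp Require Import all_boot all_order all_algebra.
From mathcomp Require Import all_classical all_reals all_analysis.
Set Implicit Arguments. Unset Strict Implicit. Unset Printing Implicit Defensive.
Import Order.TTheory GRing.Theory Num.Theory.
Import numFieldTopology.Exports numFieldNormedType.Exports.
Local Open Scope classical_set_scope.
Local Open Scope ring_scope.

(* An elementary interval is encoded by (l, b) : int * bool :          *)
(*   (l, false) = [l] = [l,l]   and   (l, true) = [l, l+1].            *)
(* An elementary cube is a d-tuple of elementary intervals; this       *)
(* encoding is a bijection with K^d.                                   *)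
Definition cube (d : nat) := {ffun 'I_d -> int * bool}.

Definition cdim d (Q : cube d) : nat := #|[pred i | (Q i).2]|.

Definition cube_set (R : realType) d (Q : cube d) : set ('I_d -> R) :=
  [set p | forall i, ((Q i).1%:~R <= p i) /\ (p i <= (Q i).1%:~R + ((Q i).2 : nat)%:R)].

Definition ctrans d (x : 'I_d -> int) (Q : cube d) : cube d :=
  [ffun i => ((Q i).1 - x i, (Q i).2)].

(* Cubical boundary operator (Kaczynski-Mischaikow-Mrozek):            *)
(*  d(I_1 x ... x I_d) = sum_{j nondeg} (-1)^{#nondeg factors before j}*)
(*      ( Q with I_j:=[l_j+1]  -  Q with I_j:=[l_j] ).                 *)
Definition face_lo d (Q : cube d) (j : 'I_d) : cube d :=
  [ffun i => if i == j then ((Q i).1, false) else Q i].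
Definition face_hi d (Q : cube d) (j : 'I_d) : cube d :=
  [ffun i => if i == j then ((Q i).1 + 1, false) else Q i].

Definition bdry_coef d (Q P : cube d) : rat :=
  \sum_(j < d | (Q j).2)
     (-1) ^+ #|[pred i : 'I_d | (i < j)%N && (Q i).2]| *
     (((P == face_hi Q j)%:R) - ((P == face_lo Q j)%:R)).

(* Elementary cubes with all endpoints in [-n, n] (a finite list       *)
(* containing every elementary cube contained in Lambda_n).            *)
Definition cube_of_code d n (f : {ffun 'I_d -> 'I_(2 * n).+1 * bool}) : cube d :=
  [ffun i => ((nat_of_ord (f i).1)%:Z - n%:Z, (f i).2)].
Definition box_cubes d n : seq (cube d) := map (@cube_of_code d n) (enum {ffun 'I_d -> 'I_(2 * n).+1 * bool}).

Definition Lambda (R : realType) d (n : nat) : set ('I_d -> R) :=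
  [set p | forall i, (- (n%:R) <= p i) /\ (p i <= n%:R)].

(* k-dimensional elementary cubes contained in the set X (which is   *)
(* assumed to be a subset of Lambda_n)                                *)
Definition kcubes (R : realType) d n (X : set ('I_d -> R)) (k : nat) : seq (cube d) :=
  [seq Q <- box_cubes d n | (cdim Q == k) && `[< @cube_set R d Q `<=` X >]].

Definition cube0 d : cube d := [ffun=> (0%:Z, false)].

Definition bdry_mx (R : realType) d n (X : set ('I_d -> R)) (k : nat) :
  'M[rat]_(size (kcubes n X k.+1), size (kcubes n X k)) :=
  \matrix_(i, j) bdry_coef (nth (cube0 d) (kcubes n X k.+1) i) (nth (cube0 d) (kcubes n X k) j).

Definition bdry_rank (R : realType) d n (X : set ('I_d -> R)) (k : nat) : nat :=
  if k is k'.+1 then \rank (bdry_mx n X k') else 0%N.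

(* Betti number beta_k(X) = rank of the free part of H_k(X;Z)
   = rank Z_k - rank B_k = (dim C_k - rank d_k) - rank d_{k+1},
   for a cubical set X contained in Lambda_n. *)
Definition betti (R : realType) d n (X : set ('I_d -> R)) (k : nat) : nat :=
  (size (kcubes n X k) - bdry_rank n X k - bdry_rank n X k.+1)%N.

(* The probability space Omega = [0,1]^{K^d}.  We take the carrier     *)
(* K^d -> R with the product sigma-algebra (generated by the coordinate*)
(* maps); P is required to be concentrated on [0,1]^{K^d}.             *)
Definition coord_gens (R : realType) d : set (set (cube d -> R)) :=
  [set A | exists Q (B : set R), measurable B /\ A = (fun w => w Q) @^-1` B].

Notation Omega R d := (g_sigma_algebraType (@coord_gens R d)).

Definition tau (R : realType) d (x : 'I_d -> int) (w : Omega R d) : Omega R d :=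
  fun Q => w (ctrans x Q).

Definition stationary (R : realType) d (P : probability (Omega R d) R) :=
  forall (x : 'I_d -> int) (A : set (Omega R d)), measurable A ->
    P (tau x @^-1` A) = P A.

Definition ergodic (R : realType) d (P : probability (Omega R d) R) :=
  forall A : set (Omega R d), measurable A ->
    (forall x : 'I_d -> int, tau x @^-1` A = A) -> P A = 0%E \/ P A = 1%E.

Definition unit_valued (R : realType) d (P : probability (Omega R d) R) :=
  forall Q : cube d, P [set w : Omega R d | 0 <= w Q <= 1] = 1%E.

Definition product_measure (R : realType) d (P : probability (Omega R d) R) :=
  forall (s : seq (cube d)) (B : cube d -> set R), uniq s ->
    (forall Q, measurable (B Q)) ->
    P [set w : Omega R d | forall Q, Q \in s -> B Q (w Q)] =
    (\prod_(Q <- s) P [set w : Omega R d | B Q (w Q)])%E.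

Definition Xt (R : realType) d (w : Omega R d) (t : R) : set ('I_d -> R) :=
  \bigcup_(Q in [set Q : cube d | w Q <= t]) @cube_set R d Q.

Definition Xnt (R : realType) d (w : Omega R d) (n : nat) (t : R) :=
  Xt w t `&` @Lambda R d n.

Definition beta_n (R : realType) d (q n : nat) (w : Omega R d) (t : R) : nat :=
  betti n (Xnt w n t) q.

Definition Lqn (R : realType) d (q n : nat) (w : Omega R d) : R :=
  fine (\int[lebesgue_measure]_(t in `[0%R, 1%R]) ((beta_n q n w t)%:R : R)%:E)%E.

Definition expect (R : realType) d (P : probability (Omega R d) R) (f : Omega R d -> R) : R :=
  fine (\int[P]_w (f w)%:E)%E.

Definition volLambda (R : realType) d (n : nat) : R := ((2 * n) ^ d)%:R.

(* E[ f(Z) ] for Z ~ N(0, tau2), realised as Z = sqrt(tau2) G with G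
   standard normal (this also covers the degenerate case tau2 = 0). *)
Definition gauss_expect (R : realType) (tau2 : R) (f : R -> R) : R :=
  fine (\int[lebesgue_measure]_(x in [set: R])
          (f (Num.sqrt tau2 * x) * normal_pdf 0 1 x)%:E)%E.

Definition cvg_law_normal (R : realType) d (P : probability (Omega R d) R)
    (Y : nat -> Omega R d -> R) (tau2 : R) :=
  forall f : R -> R, continuous f -> (exists M : R, forall x, `|f x| <= M) ->
    (fun n => expect P (fun w => f (Y n w))) @ \oo --> gauss_expect tau2 f.

(* Main.v *)
(** By rank-nullity, [beta_q] is the number of [q]-cubes minus the ranks of two
    boundary matrices, and the rank is a submodular function of the set of cubes.
    Hence the rank contributed by the cubes near a site [z] decreases as the window
    around [z] grows.  Its mean, integrated over the levels [t], therefore converges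
    as the radius [k] of the window grows, so the effect on [L] of resampling the
    cubes at [z] is, in [L^2], almost determined by a large finite window around [z].

    Cut [Lambda_n] into blocks of a large fixed side [m] and let [S_n] be the sum of
    the functionals [L] of the separate blocks; they are independent because the
    measure is a product and identically distributed by stationarity.  By the
    Efron-Stein inequality the variance of [L_q^n - S_n] is at most [e * |Lambda_n|],
    where [e] tends to [0] as [m] grows: sites deep inside a block contribute little
    by the previous paragraph, and the other sites have small density.  Lindeberg's
    replacement method gives a central limit theorem for [S_n], and an approximation
    argument transfers both limits to [L_q^n]. *)

Require Import Defs.
From HB Require Import structures.
From mathcomp Require Import all_boot all_order all_algebra.
From mathcomp Require Import all_classical all_reals all_analysis.
From mathcomp Require Import measurable_realfun ring lra zify.
Set Implicit Arguments.
Unset Strict Implicit.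
Unset Printing Implicit Defensive.
Import Order.TTheory GRing.Theory Num.Theory.
Import numFieldTopology.Exports numFieldNormedType.Exports.
Local Open Scope classical_set_scope.
Local Open Scope ring_scope.

(** * Ranks of the cubical boundary operator *)

(** Resampling one weight can create or fill cycles of any size, so the effect of a site on [L] has
    no finite range, and no rate at which it stabilizes is available. Two facts replace a rate. The
    increments over nested windows differ by at most the drop of the rank contributed near the site,
    taken once at the configuration and once at its resampled copy; both have law [P], so the mean
    of this bound is twice a difference of values of one nonnegative sequence, [mean_gain], which
    can be taken close to its infimum. And the increments are bounded by a constant depending on [d]
    alone, so the first moment controls the second.

    The weight of a cube does not by itself decide whether the cube lies in X(t): it suffices to be
    a face of a cube of small weight. Hence weights are resampled together by lower corner, a site
    influences a window of side 2, and blocks lose one layer before they depend on disjoint sets of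
    weights.

    Independence is expressed on two copies of the space, by swaps of coordinates that preserve the
    product measure. No formula for [tau2] is produced: it is the limit of a Cauchy sequence of
    variances. *)

Section BoundaryRank.
Context {d : nat}.
Implicit Types (K P Q : cube d) (s u : seq (cube d)).

Definition bdry_row u K : 'rV[rat]_(size u) :=
  \row_j bdry_coef K (nth (cube0 d) u j).

(** The columns [u] are a parameter so that the boundaries of different lists live in one row space
    and can be compared there. *)
Definition rank_in u s : nat :=
  \rank (\matrix_(i < size s, j < size u)
    bdry_coef (nth (cube0 d) s i) (nth (cube0 d) u j)).

(** As the dimension of a sum of lines, one per cell, the rank depends only on the set of cells, and
    the lattice of row spaces becomes available. *)
Lemma rank_inE u s : rank_in u s = \rank (\sum_(K <- s) <<bdry_row u K>>)%MS.
Proof.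
apply/eqP; rewrite eqn_leq (big_nth (cube0 d)) big_mkord; apply/andP; split.
  apply/mxrankS/row_subP => i; apply: (sumsmx_sup i) => //; rewrite genmxE.
  suff -> : row i (\matrix_(i, j) bdry_coef (nth (cube0 d) s i) (nth (cube0 d) u j)) = bdry_row u (nth (cube0 d) s i) by [].
  by apply/rowP => j; rewrite !mxE.
apply/mxrankS/sumsmx_subP => i _; rewrite genmxE.
by apply: (eq_row_sub i); apply/rowP => j; rewrite !mxE.
Qed.

Lemma row_span_sub u s s' : {subset s <= s'} ->
  (\sum_(K <- s) <<bdry_row u K>> <= \sum_(K <- s') <<bdry_row u K>>)%MS.
Proof.
move=> ss'; rewrite big_seq; apply: (big_ind (fun M => (M <= _)%MS)) => [|x y|K /ss' Ks'].
- exact: sub0mx.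
- by rewrite addsmx_sub => -> ->.
- by rewrite (big_rem K)//= addsmxSl.
Qed.

Lemma rank_in_le u s s' : {subset s <= s'} -> (rank_in u s <= rank_in u s')%N.
Proof. by move=> ss'; rewrite !rank_inE; exact/mxrankS/row_span_sub. Qed.

(** Dimension formula for the spans C' and C + S: their sum is C' + S, and their intersection
    contains C because C lies in C'. *)
Lemma rank_in_submod u c c' s : {subset c <= c'} ->
  (rank_in u (c' ++ s) + rank_in u c <= rank_in u (c ++ s) + rank_in u c')%N.
Proof.
move=> cc'; rewrite !rank_inE !big_cat /=.
set C := (\sum_(K <- c) _)%MS; set C' := (\sum_(K <- c') _)%MS.
set S := (\sum_(K <- s) _)%MS.
have CC' : (C <= C')%MS by exact: row_span_sub.
have := mxrank_sum_cap C' (C + S)%MS.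
have -> : \rank (C' + (C + S))%MS = \rank (C' + S)%MS.
  apply/eqP; rewrite eqn_leq; apply/andP; split; apply: mxrankS.
    rewrite !addsmx_sub addsmxSl addsmxSr (submx_trans CC')//.
    exact: addsmxSl.
  by rewrite addsmx_sub addsmxSl (submx_trans (addsmxSr C S))// addsmxSr.
have : (\rank C <= \rank (C' :&: (C + S)))%N.
  by apply: mxrankS; rewrite sub_capmx CC' addsmxSl.
lia.
Qed.

Lemma rank_in_cat_le u c s : (rank_in u (c ++ s) <= rank_in u c + size s)%N.
Proof.
rewrite !rank_inE big_cat /=; apply: leq_trans (mxrank_adds_leqif _ _) _.
rewrite leq_add2l; elim: s => [|K s ih]; first by rewrite big_nil mxrank0.
rewrite big_cons; apply: leq_trans (mxrank_adds_leqif _ _) _.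
by rewrite /= -(add1n (size s)) leq_add// mxrank_gen rank_leq_row.
Qed.

Lemma rank_in_perm u s s' : s =i s' -> rank_in u s = rank_in u s'.
Proof.
by move=> ss'; apply/eqP; rewrite eqn_leq !rank_in_le// => K; rewrite ss'.
Qed.

Lemma mxrank_cols_le (F : fieldType) m n n' (A : 'M[F]_(m, n)) (B : 'M[F]_(m, n')) :
  (forall j, (forall i, A i j = 0) \/ exists j', forall i, A i j = B i j') ->
  (\rank A <= \rank B)%N.
Proof.
move=> AB; rewrite -(mxrank_tr A) -(mxrank_tr B); apply/mxrankS/row_subP => j.
case: (AB j) => [A0|[j' Aj]].
  suff -> : row j A^T = 0 by exact: sub0mx.
  by apply/rowP => i; rewrite !mxE A0.
by apply: (eq_row_sub j'); apply/rowP => i; rewrite !mxE Aj.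
Qed.

Definition covers u s := forall K P, K \in s -> bdry_coef K P != 0 -> P \in u.

(** A column of one matrix is either zero or also a column of the other, since both lists contain
    every cell with a nonzero coefficient. *)
Lemma rank_in_covers u u' s : covers u s -> covers u' s ->
  rank_in u s = rank_in u' s.
Proof.
suff H v v' : covers v' s -> (rank_in v s <= rank_in v' s)%N.
  by move=> cu cu'; apply/eqP; rewrite eqn_leq !H.
move=> cv; apply: mxrank_cols_le => j.
set P := nth (cube0 d) v j.
have [Pv'|Pv'] := boolP (P \in v').
  right; exists (Ordinal (etrans (index_mem P v') Pv')) => i.
  by rewrite !mxE /= nth_index.
left=> i; rewrite mxE -/P; apply/eqP; apply: contraNT Pv' => c0.
by apply: cv c0; apply: mem_nth.
Qed.

Definition faces s : seq (cube d) :=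
  flatten [seq [seq face_lo K j | j <- enum 'I_d] ++
               [seq face_hi K j | j <- enum 'I_d] | K <- s].

Lemma bdry_coef_face K P : bdry_coef K P != 0 ->
  exists j : 'I_d, (K j).2 /\ (P = face_lo K j \/ P = face_hi K j).
Proof.
move=> c0; apply: contrapT => nex; move: c0; apply/negP; rewrite negbK.
apply/eqP; apply: big1 => j Kj.
case: (eqVneq P (face_hi K j)) => [e|_]; first by case: nex; exists j; auto.
case: (eqVneq P (face_lo K j)) => [e|_]; first by case: nex; exists j; auto.
by rewrite subrr mulr0.
Qed.

Lemma covers_faces s : covers (faces s) s.
Proof.
move=> K P Ks /bdry_coef_face[j [_ Pj]]; apply/flattenP.
exists ([seq face_lo K j | j <- enum 'I_d] ++ [seq face_hi K j | j <- enum 'I_d]).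
  by apply/mapP; exists K.
by rewrite mem_cat; case: Pj => ->; rewrite map_f ?orbT// mem_enum.
Qed.

(** Rank of the boundary operator on the span of [s]; by [brankE] any covering list of columns gives
    the same value. *)
Definition brank s := rank_in (faces s) s.

Lemma brankE u s : covers u s -> brank s = rank_in u s.
Proof. by move=> cu; apply: rank_in_covers cu; exact: covers_faces. Qed.

Lemma covers_sub u s s' : {subset s <= s'} -> covers u s' -> covers u s.
Proof. by move=> ss' c K P /ss'; exact: c. Qed.

Lemma brank_perm s s' : s =i s' -> brank s = brank s'.
Proof.
move=> ss'; rewrite (brankE (u := faces s) (s := s')).
  exact: rank_in_perm.
by apply: covers_sub (@covers_faces _) => K; rewrite ss'.
Qed.

Lemma brank_le s s' : {subset s <= s'} -> (brank s <= brank s')%N.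
Proof.
move=> ss'; rewrite (brankE (u := faces s')); first exact: rank_in_le.
by apply: covers_sub (@covers_faces _).
Qed.

Lemma brank_submod c c' s : {subset c <= c'} ->
  (brank (c' ++ s) + brank c <= brank (c ++ s) + brank c')%N.
Proof.
move=> cc'; rewrite !(brankE (u := faces (c' ++ s))).
- exact: rank_in_submod.
- by apply: covers_sub (@covers_faces _) => K; rewrite mem_cat => ->.
- apply: covers_sub (@covers_faces _) => K; rewrite !mem_cat.
  by case/orP => [/cc' ->|->]; rewrite ?orbT.
- by apply: covers_sub (@covers_faces _) => K /cc'; rewrite mem_cat => ->.
- exact: covers_faces.
Qed.

Lemma brank_cat_le c s : (brank (c ++ s) <= brank c + size s)%N.
Proof.
rewrite (brankE (u := faces (c ++ s)) (s := c)); first exact: rank_in_cat_le.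
by apply: covers_sub (@covers_faces _) => K; rewrite mem_cat => ->.
Qed.

Lemma mxrank_mxsub (F : fieldType) m n m' n' (A : 'M[F]_(m, n)) (B : 'M[F]_(m', n'))
    (f : 'I_m -> 'I_m') (g : 'I_n -> 'I_n') :
  (forall i j, A i j = B (f i) (g j)) -> (\rank A <= \rank B)%N.
Proof.
move=> AB; have -> : A = rowsub f (colsub g B).
  by apply/matrixP => i j; rewrite AB !mxE.
apply: leq_trans (mxrankS (rowsub_sub _ _)) _.
by apply: mxrank_cols_le => j; right; exists (g j) => i; rewrite mxE.
Qed.

Lemma ctransE (x : 'I_d -> int) K i : ctrans x K i = ((K i).1 - x i, (K i).2).
Proof. by rewrite ffunE. Qed.

Lemma ctransK (x : 'I_d -> int) : cancel (ctrans x) (ctrans (fun i => - x i)).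
Proof. by move=> K; apply/ffunP => i; rewrite !ctransE/= opprK subrK -surjective_pairing. Qed.

Lemma ctransNK (x : 'I_d -> int) : cancel (ctrans (fun i => - x i)) (ctrans x).
Proof. by move=> K; apply/ffunP => i; rewrite !ctransE/= opprK addrK -surjective_pairing. Qed.

Lemma ctrans_inj (x : 'I_d -> int) : injective (ctrans x).
Proof. exact: can_inj (ctransK x). Qed.

Lemma face_lo_ctrans (x : 'I_d -> int) K j :
  face_lo (ctrans x K) j = ctrans x (face_lo K j).
Proof. by apply/ffunP => i; rewrite !ffunE /=; case: ifP. Qed.

Lemma face_hi_ctrans (x : 'I_d -> int) K j :
  face_hi (ctrans x K) j = ctrans x (face_hi K j).
Proof. by apply/ffunP => i; rewrite !ffunE /=; case: ifP => //; rewrite addrAC. Qed.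

Lemma bdry_coef_ctrans (x : 'I_d -> int) K P :
  bdry_coef (ctrans x K) (ctrans x P) = bdry_coef K P.
Proof.
rewrite /bdry_coef; apply: eq_big => [j|j _]; first by rewrite ctransE.
rewrite face_lo_ctrans face_hi_ctrans !(inj_eq (@ctrans_inj x)); congr (_ ^+ _ * _).
by apply: eq_card => i; rewrite !inE ctransE.
Qed.

Lemma faces_ctrans (x : 'I_d -> int) s :
  faces [seq ctrans x K | K <- s] = [seq ctrans x K | K <- faces s].
Proof.
rewrite /faces map_flatten -!map_comp; congr flatten; apply: eq_map => K /=.
rewrite map_cat -!map_comp; congr cat; apply: eq_map => j /=.
  exact: face_lo_ctrans.
exact: face_hi_ctrans.
Qed.

Lemma brank_ctrans_le (x : 'I_d -> int) s :
  (brank s <= brank [seq ctrans x K | K <- s])%N.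
Proof.
rewrite /brank faces_ctrans.
have ls i : (i < size s -> i < size [seq ctrans x K | K <- s])%N by rewrite size_map.
have lf i : (i < size (faces s) -> i < size [seq ctrans x K | K <- faces s])%N.
  by rewrite size_map.
apply: (mxrank_mxsub (f := fun i => Ordinal (ls i (ltn_ord i)))
                     (g := fun j => Ordinal (lf j (ltn_ord j)))) => i j.
by rewrite !mxE /= !(nth_map (cube0 d))// bdry_coef_ctrans.
Qed.

Lemma brank_ctrans (x : 'I_d -> int) s : brank [seq ctrans x K | K <- s] = brank s.
Proof.
apply/eqP; rewrite eqn_leq brank_ctrans_le andbT.
apply: leq_trans (brank_ctrans_le (fun i => - x i) _) _.
by rewrite -map_comp (eq_map (ctransK x)) map_id.
Qed.

Lemma cdim_ctrans (x : 'I_d -> int) K : cdim (ctrans x K) = cdim K.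
Proof. by apply: eq_card => i; rewrite !inE ctransE. Qed.

(* The order sign of [face j] then [face i] flips when [i] and [j] are exchanged. *)
Definition osign K (i : 'I_d) : rat := (-1) ^+ #|[pred k : 'I_d | (k < i)%N && (K k).2]|.

(** Passing to a face in direction [j] makes that direction degenerate, and the sign of [i] counted
    it exactly when it precedes [i]. *)
Lemma osign_face K K' i j : (forall k, (K' k).2 = (K k).2 && (k != j)) -> (K j).2 ->
  osign K' i = (if (j < i)%N then -1 else 1) * osign K i.
Proof.
move=> K'E Kj; rewrite /osign; case: ifPn => [ji|ji].
  rewrite (cardD1 j [pred k : 'I_d | (k < i)%N && (K k).2]) !inE ji Kj /= exprS mulrA mulrNN mulr1 mul1r.
  by congr (_ ^+ _); apply: eq_card => k; rewrite !inE K'E andbA [RHS]andbC.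
rewrite mul1r; congr (_ ^+ _); apply: eq_card => k; rewrite !inE K'E.
case: (eqVneq k j) => [->|]; last by rewrite andbT.
by rewrite (negbTE ji).
Qed.

Lemma bdry_coefE K P : bdry_coef K P =
  \sum_(j | (K j).2) osign K j * ((P == face_hi K j)%:R - (P == face_lo K j)%:R).
Proof. by []. Qed.

Lemma face_hi2 K j k : (face_hi K j k).2 = (K k).2 && (k != j).
Proof. by rewrite ffunE; case: eqVneq; rewrite ?andbF ?andbT. Qed.

Lemma face_lo2 K j k : (face_lo K j k).2 = (K k).2 && (k != j).
Proof. by rewrite ffunE; case: eqVneq; rewrite ?andbF ?andbT. Qed.

(** The boundary of a boundary vanishes: in the double sum over directions [i != j], exchanging [i]
    and [j] gives the same iterated faces with the opposite sign, so the sum equals its own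
    negative. *)
Lemma bdry_bdry_faces K S :
  \sum_(j | (K j).2) osign K j *
    (bdry_coef (face_hi K j) S - bdry_coef (face_lo K j) S) = 0.
Proof.
pose X i j : rat := ((S == face_hi (face_hi K j) i)%:R - (S == face_lo (face_hi K j) i)%:R)
  - ((S == face_hi (face_lo K j) i)%:R - (S == face_lo (face_lo K j) i)%:R).
pose e (i j : 'I_d) : rat := if (j < i)%N then -1 else 1.
pose T := \sum_(j | (K j).2) \sum_(i | (K i).2 && (i != j))
  e i j * (osign K i * osign K j) * X i j.
have -> : \sum_(j | (K j).2) osign K j *
    (bdry_coef (face_hi K j) S - bdry_coef (face_lo K j) S) = T.
  apply: eq_bigr => j Kj; rewrite !bdry_coefE.
  rewrite (eq_bigl (fun i => (K i).2 && (i != j))); last by move=> i; rewrite face_hi2.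
  rewrite [X in _ - X](eq_bigl (fun i => (K i).2 && (i != j))); last first.
    by move=> i; rewrite face_lo2.
  rewrite -sumrB mulr_sumr; apply: eq_bigr => i /andP[Ki ij].
  rewrite (osign_face i (face_hi2 K j) Kj) (osign_face i (face_lo2 K j) Kj).
  by rewrite /X /e; ring.
have XC i j : i != j -> X i j = X j i.
  move=> ij; rewrite /X.
  have hh : face_hi (face_hi K j) i = face_hi (face_hi K i) j.
    apply/ffunP => k; rewrite !ffunE.
    by case: (eqVneq k i) => [->|]; case: (eqVneq k j) => // [|/eqP]; rewrite ?(negbTE ij)//; case: eqVneq ij => // ->; rewrite eqxx.
  have ll : face_lo (face_lo K j) i = face_lo (face_lo K i) j.
    apply/ffunP => k; rewrite !ffunE.
    by case: (eqVneq k i) => [->|]; rewrite ?(negbTE ij)//.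
  have lh : face_lo (face_hi K j) i = face_hi (face_lo K i) j.
    apply/ffunP => k; rewrite !ffunE.
    by case: (eqVneq k i) => [->|]; rewrite ?(negbTE ij)//.
  have hl : face_hi (face_lo K j) i = face_lo (face_hi K i) j.
    apply/ffunP => k; rewrite !ffunE.
    by case: (eqVneq k i) => [->|]; rewrite ?(negbTE ij)//.
  by rewrite hh ll lh hl; ring.
have : T = - T.
  rewrite {1}/T (exchange_big_dep (fun i => (K i).2))/=; last by move=> ? ? _ /andP[].
  rewrite /T -sumrN; apply: eq_bigr => j Kj; rewrite -sumrN.
  apply: eq_big => [i|i /andP[_ /andP[_ ij]]]; first by rewrite Kj eq_sym.
  have -> : e j i = - e i j.
    rewrite /e; case: ltngtP ij => //; last by move/val_inj => ->; rewrite eqxx.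
  by rewrite (XC _ _ ij); ring.
by move/eqP; rewrite -subr_eq0 opprK -mulr2n mulrn_eq0 /= => /eqP.
Qed.

(** Entrywise form of the vanishing of a product of two boundary matrices: a duplicate-free [s]
    picks each face of [K] exactly once. *)
Lemma bdry_bdry s K S : uniq s -> covers s [:: K] ->
  (forall j, (K j).2 -> face_lo K j \in s /\ face_hi K j \in s) ->
  \sum_(P <- s) bdry_coef K P * bdry_coef P S = 0.
Proof.
move=> us cs fs; rewrite -[RHS](bdry_bdry_faces K S).
under eq_bigr do rewrite bdry_coefE mulr_suml.
rewrite exchange_big /=; apply: eq_bigr => j Kj.
under eq_bigr do rewrite -mulrA.
rewrite -mulr_sumr; congr (_ * _).
under eq_bigr do rewrite mulrBl.
rewrite sumrB; have [lo hi] := fs j Kj.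
have sel F : F \in s -> \sum_(i <- s) (i == F)%:R * bdry_coef i S = bdry_coef F S.
  move=> Fs; rewrite (bigD1_seq F)//= eqxx mul1r big1 ?addr0// => P /negbTE ->.
  by rewrite mul0r.
by rewrite !sel.
Qed.

End BoundaryRank.

(** * Betti numbers of unions of cubes *)

Section Windows.
Context {d : nat}.
Implicit Types (K P Q : cube d) (V : seq (cube d)) (a : 'I_d -> int).

Definition face_of K Q : bool := [forall i, ((Q i).1 <= (K i).1) &&
  ((K i).1 + ((K i).2 : nat)%:Z <= (Q i).1 + ((Q i).2 : nat)%:Z)].

Lemma face_ofP K Q : reflect (forall i, (Q i).1 <= (K i).1 /\
  (K i).1 + ((K i).2 : nat)%:Z <= (Q i).1 + ((Q i).2 : nat)%:Z) (face_of K Q).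
Proof. by apply: (iffP forallP) => h i; apply/andP/h. Qed.

Lemma face_of_trans K P Q : face_of K P -> face_of P Q -> face_of K Q.
Proof.
move=> /face_ofP h1 /face_ofP h2; apply/face_ofP => i.
have [a1 a2] := h1 i; have [b1 b2] := h2 i.
by split; [exact: le_trans b1 a1|exact: le_trans a2 b2].
Qed.

Lemma face_of_ctrans x K Q : face_of (ctrans x K) (ctrans x Q) = face_of K Q.
Proof. by apply: eq_forallb => i; rewrite !ctransE/=; lia. Qed.

Lemma face_of_lo K j : face_of (face_lo K j) K.
Proof. by apply/face_ofP => i; rewrite ffunE; case: ifP => //= _; lia. Qed.

Lemma face_of_hi K j : (K j).2 -> face_of (face_hi K j) K.
Proof.
by move=> Kj; apply/face_ofP => i; rewrite ffunE; case: eqP => //= ->; rewrite Kj; lia.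
Qed.

(** Cells are selected by lower corner only, so all shapes at a site come together; those at the
    upper end reach the coordinate [a i + L], and the list is not closed under faces. *)
Definition window a (L : nat) : seq (cube d) :=
  [seq [ffun i => (a i + ((f i).1 : nat)%:Z, (f i).2)] | f : {ffun 'I_d -> 'I_L * bool}].

Lemma window_uniq a L : uniq (window a L).
Proof.
rewrite map_inj_uniq ?enum_uniq// => f g /ffunP fg; apply/ffunP => i.
have := fg i; rewrite !ffunE; case: (f i) (g i) => [k b] [k' b'] /= [e ->].
by congr pair; apply: val_inj => /=; lia.
Qed.

Lemma size_window a L : size (window a L) = ((2 * L) ^ d)%N.
Proof.
by rewrite size_map -cardE card_ffun card_prod card_ord card_bool card_ord mulnC.
Qed.

Lemma mem_windowP a L K :
  reflect (forall i, a i <= (K i).1 /\ (K i).1 < a i + L%:Z) (K \in window a L).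
Proof.
apply: (iffP mapP) => [[f _ ->] i|h].
  by rewrite ffunE /=; move: (ltn_ord (f i).1); move: (nat_of_ord _) (a i) => k ai; lia.
have lt i : (absz ((K i).1 - a i) < L)%N by have := h i; lia.
exists [ffun i => (Ordinal (lt i), (K i).2)]; first by rewrite mem_enum.
apply/ffunP => i; rewrite !ffunE /= [LHS]surjective_pairing; congr pair.
by have := h i; lia.
Qed.

Lemma window_ctrans x a L :
  [seq ctrans x K | K <- window a L] = window (fun i => a i - x i) L.
Proof.
rewrite /window /image_mem -map_comp; apply: eq_map => f /=.
by apply/ffunP => i; rewrite ctransE !ffunE /= addrAC.
Qed.

Lemma box_cubesE n : box_cubes d n = window (fun=> - n%:Z) (2 * n).+1.
Proof.
by apply: eq_map => f; apply/ffunP => i; rewrite !ffunE addrC.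
Qed.

Definition in_box (n : nat) K : bool := [forall i, (- n%:Z <= (K i).1) &&
  ((K i).1 + ((K i).2 : nat)%:Z <= n%:Z)].

Lemma in_boxP n K : reflect (forall i, - n%:Z <= (K i).1 /\
  (K i).1 + ((K i).2 : nat)%:Z <= n%:Z) (in_box n K).
Proof. by apply: (iffP forallP) => h i; apply/andP/h. Qed.

(** [box_cubes] also lists cubes that stick out of the box on its upper side; these are removed. *)
Definition box_window n : seq (cube d) := [seq K <- box_cubes d n | in_box n K].

Lemma mem_box_window n K : (K \in box_window n) = in_box n K.
Proof.
rewrite mem_filter; case: in_boxP => //= h; rewrite box_cubesE.
by apply/mem_windowP => i; have := h i; lia.
Qed.

Lemma box_window_uniq n : uniq (box_window n).
Proof. by rewrite filter_uniq// box_cubesE window_uniq. Qed.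

Lemma in_box_face n K Q : face_of K Q -> in_box n Q -> in_box n K.
Proof.
move=> /face_ofP h /in_boxP hQ; apply/in_boxP => i.
by have := h i; have := hQ i; lia.
Qed.

Definition of_dim k (s : seq (cube d)) := [seq K <- s | cdim K == k].

Lemma brank_of_dim0 s : brank (of_dim 0 s) = 0%N.
Proof.
apply/eqP; rewrite mxrank_eq0; apply/eqP/matrixP => i j; rewrite !mxE.
have : nth (cube0 d) (of_dim 0 s) i \in of_dim 0 s by exact: mem_nth.
rewrite mem_filter => /andP[/eqP/card0_eq K0 _].
by apply: big_pred0 => k; have := K0 k; rewrite inE.
Qed.

Lemma of_dim_cat k s s' : of_dim k (s ++ s') = of_dim k s ++ of_dim k s'.
Proof. exact: filter_cat. Qed.

(** The non-additive part of the Betti number, see [bettiE]. Both ranks enter with the same sign, so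
    submodularity passes to their sum. *)
Definition rho q s : nat := (brank (of_dim q s) + brank (of_dim q.+1 s))%N.

Lemma rho_perm q s s' : s =i s' -> rho q s = rho q s'.
Proof.
move=> ss'; congr (_ + _)%N; apply: brank_perm => K; by rewrite !mem_filter ss'.
Qed.

Lemma rho_le q s s' : {subset s <= s'} -> (rho q s <= rho q s')%N.
Proof.
by move=> ss'; apply: leq_add; apply: brank_le => K; rewrite !mem_filter => /andP[-> /ss'].
Qed.

Lemma rho_submod q c c' s : {subset c <= c'} ->
  (rho q (c' ++ s) + rho q c <= rho q (c ++ s) + rho q c')%N.
Proof.
move=> cc'; rewrite /rho !of_dim_cat.
have sub k : {subset of_dim k c <= of_dim k c'}.
  by move=> K; rewrite !mem_filter => /andP[-> /cc'].
have h := leq_add (brank_submod (of_dim q s) (sub q)) (brank_submod (of_dim q.+1 s) (sub q.+1)).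
by rewrite addnACA [leqRHS]addnACA.
Qed.

Lemma rho_cat_le q c s : (rho q (c ++ s) <= rho q c + 2 * size s)%N.
Proof.
rewrite /rho !of_dim_cat.
have h k : (brank (of_dim k c ++ of_dim k s) <= brank (of_dim k c) + size s)%N.
  apply: leq_trans (brank_cat_le _ _) _.
  by rewrite leq_add2l size_filter count_size.
by apply: leq_trans (leq_add (h q) (h q.+1)) _; rewrite addnACA mul2n addnn.
Qed.

Lemma rho_ctrans q x s : rho q [seq ctrans x K | K <- s] = rho q s.
Proof.
have h k : of_dim k [seq ctrans x K | K <- s] = [seq ctrans x K | K <- of_dim k s].
  by rewrite /of_dim filter_map; congr map; apply: eq_filter => K /=; rewrite cdim_ctrans.
by rewrite /rho !h !brank_ctrans.
Qed.

(** * Cells of the random cubical set *)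

Section Presence.
Context {R : realType}.
Notation Om := (Omega R d).
Implicit Types (w : Om) (t : R).

(** A cell lies in X(t) as soon as it is a face of a cube of weight at most [t], whatever its own
    weight. *)
Definition present w t K : bool := `[< exists Q, face_of K Q /\ w Q <= t >].

Lemma present_face w t K Q : face_of K Q -> present w t Q -> present w t K.
Proof.
move=> KQ /asboolP[Q' [QQ' wQ']]; apply/asboolP; exists Q'; split => //.
exact: face_of_trans KQ QQ'.
Qed.

Lemma present_tau x w t K : present w t (ctrans x K) = present (tau x w) t K.
Proof.
apply/asboolP/asboolP => -[Q [KQ wQ]].
  exists (ctrans (fun i => - x i) Q); split; last by rewrite /tau ctransNK.
  by rewrite -(face_of_ctrans x) ctransNK.
by exists (ctrans x Q); rewrite face_of_ctrans.
Qed.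

Definition complex V w t : seq (cube d) := [seq K <- V | present w t K].

Lemma complex_ctrans x V w t :
  complex [seq ctrans x K | K <- V] w t = [seq ctrans x K | K <- complex V (tau x w) t].
Proof.
rewrite /complex filter_map; congr map; apply: eq_filter => K /=.
exact: present_tau.
Qed.

Definition center K (i : 'I_d) : R := (K i).1%:~R + ((K i).2 : nat)%:R / 2.

Lemma center_in K : cube_set K (center K).
Proof. by move=> i; rewrite /center; case: (K i).2 => /=; lra. Qed.

(** The centre is a relative interior point of [K], so a cube with integer endpoints that contains
    it contains all of [K]. This reduces inclusion in an infinite union of cubes to inclusion in one
    of them. *)
Lemma center_face K Q : cube_set Q (center K) -> face_of K Q.
Proof.
move=> h; apply/face_ofP => i; have [] := h i; rewrite /center.
set k := (K i).1; set l := (Q i).1; set b := nat_of_bool _; set c := nat_of_bool _.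
move=> h1 h2.
have e1 : (2 * l <= 2 * k + b%:Z)%R.
  by rewrite -(ler_int R) rmorphD/= !rmorphM/=; rewrite -[X in _ + X]/(b%:R : R); lra.
have e2 : (2 * k + b%:Z <= 2 * l + 2 * c%:Z)%R.
  rewrite -(ler_int R) !rmorphD/= !rmorphM/=.
  by rewrite -[X in _ + X <= _]/(b%:R : R) -[X in _ <= _ + _ * X]/(c%:R : R); lra.
have : (b <= 1)%N by rewrite /b; case: (K i).2.
have : (c <= 1)%N by rewrite /c; case: (Q i).2.
lia.
Qed.

Lemma face_cube_set K Q : face_of K Q -> @cube_set R d K `<=` @cube_set R d Q.
Proof.
move=> /face_ofP h p pK i; have [h1 h2] := h i; have [p1 p2] := pK i.
rewrite -(ler_int R) in h1; rewrite -(ler_int R) !rmorphD/= in h2.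
by split; [exact: le_trans h1 p1|exact: le_trans p2 h2].
Qed.

(** The centre of [K] detects a cube of X(t) that contains [K]; its two extreme corners detect
    containment in the box. *)
Lemma cube_set_Xnt w n t K :
  `[< @cube_set R d K `<=` Xnt w n t >] = in_box n K && present w t K.
Proof.
apply/asboolP/andP => [h|[/in_boxP nK /asboolP[Q [KQ wQ]]] p pK].
  split; last first.
    have [[Q wQ QK] _] := h _ (center_in K).
    by apply/asboolP; exists Q; split => //; exact: center_face.
  apply/in_boxP => i.
  have lowin : cube_set K (fun i => (K i).1%:~R : R) by move=> j; split; lra || rewrite lerDl.
  have [_ /(_ i)[l1 _]] := h _ lowin.
  have upin : cube_set K (fun i => (K i).1%:~R + ((K i).2 : nat)%:R : R).
    by move=> j; split => //; rewrite lerDl.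
  have [_ /(_ i)[_ u1]] := h _ upin.
  split; rewrite -(ler_int R).
    by rewrite rmorphN.
  by rewrite rmorphD.
split; first by exists Q => //; exact: face_cube_set KQ _ pK.
move=> i; have [p1 p2] := pK i; have [n1 n2] := nK i.
rewrite -(ler_int R) rmorphN/= in n1; rewrite -(ler_int R) rmorphD/= in n2.
by split; [exact: le_trans n1 p1|exact: le_trans p2 n2].
Qed.

Lemma kcubesE w n t k : kcubes n (Xnt w n t) k = of_dim k (complex (box_window n) w t).
Proof.
rewrite /kcubes /of_dim /complex /box_window -!filter_predI; apply: eq_filter => K /=.
by rewrite cube_set_Xnt -andbA [in_box n K && _]andbC.
Qed.

Lemma cdim_lo K j : (K j).2 -> (cdim (face_lo K j)).+1 = cdim K.
Proof.
move=> Kj; rewrite /cdim [RHS](cardD1 j) inE Kj add1n; congr S.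
by apply: eq_card => i; rewrite !inE face_lo2 andbC.
Qed.

Lemma cdim_hi K j : (K j).2 -> (cdim (face_hi K j)).+1 = cdim K.
Proof.
move=> Kj; rewrite /cdim [RHS](cardD1 j) inE Kj add1n; congr S.
by apply: eq_card => i; rewrite !inE face_hi2 andbC.
Qed.

Let cells w n t k := of_dim k (complex (box_window n) w t).

Let mem_cells w n t k K : (K \in cells w n t k) = [&& cdim K == k, present w t K & in_box n K].
Proof. by rewrite 2!mem_filter mem_box_window. Qed.

Let cells_face w n t k K j : K \in cells w n t k.+1 -> (K j).2 ->
  face_lo K j \in cells w n t k /\ face_hi K j \in cells w n t k.
Proof.
rewrite !mem_cells => /and3P[/eqP dK pK nK] Kj.
rewrite -eqSS cdim_lo// -[cdim (face_hi _ _) == _]eqSS cdim_hi// dK eqxx /=.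
have lo := face_of_lo K j; have hi := face_of_hi Kj.
by rewrite !(present_face lo, present_face hi, in_box_face lo, in_box_face hi).
Qed.

Let cells_covers w n t k : covers (cells w n t k) (cells w n t k.+1).
Proof.
move=> K Q Kc /bdry_coef_face[j [Kj]].
by have [lo hi] := cells_face Kc Kj; case => ->.
Qed.

Let cells_uniq w n t k : uniq (cells w n t k).
Proof. by apply: filter_uniq; apply: filter_uniq; exact: box_window_uniq. Qed.

Lemma bdry_rankE w n t k : bdry_rank n (Xnt w n t) k = brank (cells w n t k).
Proof.
case: k => [|k]; first by rewrite brank_of_dim0.
rewrite (brankE (@cells_covers w n t k)) /cells -!kcubesE.
by [].
Qed.

(** The truncated subtractions in [betti] are exact: consecutive boundary matrices multiply to zero,
    so their ranks add up to at most the number of [q]-cells. *)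
Lemma bettiE q w n t : (betti n (Xnt w n t) q)%:R =
  (count (fun K => cdim K == q) (complex (box_window n) w t))%:R -
  (rho q (complex (box_window n) w t))%:R :> R.
Proof.
rewrite /betti kcubesE !bdry_rankE -subnDA natrB; first by rewrite size_filter.
rewrite -/(cells w n t q) (brankE (@cells_covers w n t q)).
case: q => [|q]; first by rewrite brank_of_dim0 add0n rank_leq_col.
rewrite (brankE (@cells_covers w n t q)) addnC; apply: mulmx0_rank_max.
apply/matrixP => i j; rewrite !mxE.
have Kc : nth (cube0 d) (cells w n t q.+2) i \in cells w n t q.+2 by exact: mem_nth.
set K := nth _ _ i in Kc *; set S := nth (cube0 d) (cells w n t q) j.
rewrite -[RHS](@bdry_bdry _ (cells w n t q.+1) K S) ?cells_uniq//.
- rewrite (big_nth (cube0 d)) big_mkord; apply: eq_bigr => k _.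
  by rewrite !mxE.
- by apply: covers_sub (@cells_covers w n t q.+1) => K'; rewrite inE => /eqP ->.
- by move=> l Kl; exact: cells_face.
Qed.

(** * Rank contributed by the cells near a site *)

Section Gain.
Variables (q : nat) (N : pred (cube d)).

(* Antitone in [V] because [rho] is submodular, see [gain_anti]; the truncated subtraction is exact. *)
Definition gain V w t : nat :=
  (rho q (complex V w t) - rho q [seq K <- complex V w t | ~~ N K])%N.

(** The formula of [bettiE] for an arbitrary list [V]. On lists not closed under faces, such as
    windows, it need not be a Betti number; only the formula is used. *)
Definition bet V w t : R :=
  (count (fun K => cdim K == q) (complex V w t))%:R - (rho q (complex V w t))%:R.

Let split_mem (s : seq (cube d)) :
  s =i [seq K <- s | ~~ N K] ++ [seq K <- s | N K].
Proof. by move=> K; rewrite mem_cat !mem_filter; case: (N K); rewrite ?orbF. Qed.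

Let rho_far_le V w t : (rho q [seq K <- complex V w t | ~~ N K] <= rho q (complex V w t))%N.
Proof. by apply: rho_le => K; rewrite mem_filter => /andP[]. Qed.

Lemma gain_size V w t : (gain V w t <= 2 * size [seq K <- V | N K])%N.
Proof.
rewrite /gain (rho_perm q (split_mem (complex V w t))).
apply: leq_trans (_ : 2 * size [seq K <- complex V w t | N K] <= _)%N.
  by have := rho_cat_le q [seq K <- complex V w t | ~~ N K] [seq K <- complex V w t | N K]; lia.
by rewrite leq_mul2l /= !size_filter count_filter sub_count// => K /andP[].
Qed.

(** The larger list adds only far cells, and by submodularity the same near cells raise the rank of
    a larger far part by less. *)
Lemma gain_anti V V2 w t : {subset V <= V2} ->
  (forall K, N K -> K \in V2 -> K \in V) -> (gain V2 w t <= gain V w t)%N.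
Proof.
move=> VV2 NV.
have sub : {subset [seq K <- complex V w t | ~~ N K] <= [seq K <- complex V2 w t | ~~ N K]}.
  by move=> K; rewrite !mem_filter => /and3P[-> -> /VV2].
have e2 : complex V2 w t =i [seq K <- complex V2 w t | ~~ N K] ++ [seq K <- complex V w t | N K].
  move=> K; rewrite mem_cat !mem_filter; case NK: (N K) => //=; last by rewrite orbF.
  by case: (present w t K) => //=; apply/idP/idP => [/NV ->//|/VV2].
have := rho_submod q [seq K <- complex V w t | N K] sub.
rewrite -(rho_perm q e2) -(rho_perm q (split_mem _)).
have := rho_far_le V w t; have := rho_far_le V2 w t; rewrite /gain; lia.
Qed.

Let near_count V w t : nat := count (fun K => (cdim K == q) && N K) (complex V w t).

(** The far parts of the two complexes coincide and cancel, which leaves the near cells and the two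
    gains. *)
Lemma bet_diff V w w' t : (forall K, ~~ N K -> present w t K = present w' t K) ->
  bet V w t - bet V w' t = (near_count V w t)%:R - (near_count V w' t)%:R
    - ((gain V w t)%:R - (gain V w' t)%:R).
Proof.
move=> ww'.
have far : [seq K <- complex V w t | ~~ N K] = [seq K <- complex V w' t | ~~ N K].
  rewrite /complex -!filter_predI; apply: eq_filter => K /=.
  by case: (boolP (N K)) => //= /ww' ->.
have cE u : count (fun K => cdim K == q) (complex V u t) =
    (near_count V u t + count (fun K => cdim K == q) [seq K <- complex V u t | ~~ N K])%N.
  rewrite /near_count count_filter -count_predUI.
  rewrite [X in (_ + X)%N](_ : _ = 0%N) ?addn0.
    by apply: eq_count => K /=; case: (cdim K == q); case: (N K).
  by apply/eqP; rewrite -leqn0 leqNgt -has_count; apply/hasPn => K _ /=; case: (N K); rewrite ?andbF.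
rewrite /bet !cE far /gain !natrB ?rho_far_le// far !natrD; ring.
Qed.

Lemma near_count_size V w t : (near_count V w t <= size [seq K <- V | N K])%N.
Proof.
by rewrite /near_count size_filter count_filter sub_count// => K /= /andP[/andP[]].
Qed.

(** The factor 3 charges each near cell once in the count and twice in the gain, once for each of
    the two ranks. *)
Lemma bet_diff_le V w w' t : (forall K, ~~ N K -> present w t K = present w' t K) ->
  `|bet V w t - bet V w' t| <= (3 * size [seq K <- V | N K])%:R.
Proof.
move=> ww'; rewrite bet_diff//.
have := near_count_size V w t; have := near_count_size V w' t.
have := gain_size V w t; have := gain_size V w' t.
rewrite -!(ler_nat R) !natrM => h1 h2 h3 h4.
have p1 := ler0n R (near_count V w t); have p2 := ler0n R (near_count V w' t).
have p3 := ler0n R (gain V w t); have p4 := ler0n R (gain V w' t).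
by rewrite ler_norml; lra.
Qed.

(** Both lists have the same near cells, so the counts cancel; what remains is a difference of two
    nonnegative drops of the gain, bounded by their sum. *)
Lemma bet_diff_window V V2 w w' t : uniq V -> uniq V2 -> {subset V <= V2} ->
  (forall K, N K -> K \in V2 -> K \in V) ->
  (forall K, ~~ N K -> present w t K = present w' t K) ->
  `|(bet V w t - bet V w' t) - (bet V2 w t - bet V2 w' t)| <=
  ((gain V w t)%:R - (gain V2 w t)%:R) + ((gain V w' t)%:R - (gain V2 w' t)%:R).
Proof.
move=> uV uV2 VV2 NV ww'; rewrite !bet_diff//.
have nE u : near_count V u t = near_count V2 u t.
  rewrite /near_count !count_filter -!size_filter; apply/perm_size/uniq_perm.
  - exact: filter_uniq.
  - exact: filter_uniq.
  move=> K; rewrite !mem_filter /=.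
  have [NK|NK] := boolP (N K); last by rewrite andbF.
  by congr (_ && _); apply/idP/idP => [/VV2//|]; exact: NV.
rewrite !nE.
have := gain_anti w t VV2 NV; have := gain_anti w' t VV2 NV.
rewrite -!(ler_nat R) => h1 h2.
by rewrite ler_norml; lra.
Qed.

End Gain.

Lemma bet_ctrans q x V w t : bet q [seq ctrans x K | K <- V] w t = bet q V (tau x w) t.
Proof.
rewrite /bet complex_ctrans rho_ctrans count_map; congr (_%:R - _).
by apply: eq_count => K /=; rewrite cdim_ctrans.
Qed.

Lemma gain_ctrans q (N N' : pred (cube d)) x V w t : (forall K, N (ctrans x K) = N' K) ->
  gain q N [seq ctrans x K | K <- V] w t = gain q N' V (tau x w) t.
Proof.
move=> NN'; rewrite /gain complex_ctrans filter_map !rho_ctrans.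
by congr (_ - rho _ _)%N; apply: eq_filter => K /=; rewrite NN'.
Qed.

End Presence.
End Windows.

(** * Bounded measurable functions *)

(** All random variables of the proof are of this kind, which makes every integrability condition
    under a probability automatic. *)
Definition bmfun (R : realType) dd (T : measurableType dd) (f : T -> R) :=
  measurable_fun setT f /\ exists M : R, forall x, `|f x| <= M.

Section BoundedFunctions.
Context {R : realType} {dd} {T : measurableType dd}.
Implicit Types f g : T -> R.

Lemma bmfun_cst (c : R) : bmfun (fun _ : T => c).
Proof. by split; [exact: measurable_cst|exists `|c|]. Qed.

Lemma bmfunD f g : bmfun f -> bmfun g -> bmfun (fun x => f x + g x).
Proof.
move=> [mf [M fM]] [mg [N gN]]; split; first exact: measurable_funD.
by exists (M + N) => x; rewrite (le_trans (ler_normD _ _))// lerD.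
Qed.

Lemma bmfunN f : bmfun f -> bmfun (fun x => - f x).
Proof.
move=> [mf [M fM]]; split; first exact: measurableT_comp.
by exists M => x; rewrite normrN.
Qed.

Lemma bmfunB f g : bmfun f -> bmfun g -> bmfun (fun x => f x - g x).
Proof. by move=> bf bg; exact/bmfunD/bmfunN. Qed.

Lemma bmfunM f g : bmfun f -> bmfun g -> bmfun (fun x => f x * g x).
Proof.
move=> [mf [M fM]] [mg [N gN]]; split; first exact: measurable_funM.
by exists (M * N) => x; rewrite normrM ler_pM.
Qed.

Lemma bmfunX f n : bmfun f -> bmfun (fun x => f x ^+ n).
Proof.
move=> bf; elim: n => [|n ih]; first exact: bmfun_cst.
by under eq_fun do rewrite exprS; exact: bmfunM.
Qed.

Lemma bmfun_norm f : bmfun f -> bmfun (fun x => `|f x|).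
Proof.
move=> [mf [M fM]]; split; first exact: measurableT_comp.
by exists M => x; rewrite normr_id.
Qed.

Lemma bmfun_sum I (s : seq I) (f : I -> T -> R) : (forall i, bmfun (f i)) ->
  bmfun (fun x => \sum_(i <- s) f i x).
Proof.
move=> bf; elim: s => [|i s ih].
  by under eq_fun do rewrite big_nil; exact: bmfun_cst.
by under eq_fun do rewrite big_cons; exact: bmfunD.
Qed.

Lemma bmfun_comp dd' (T' : measurableType dd') f (h : T' -> T) :
  bmfun f -> measurable_fun setT h -> bmfun (fun x => f (h x)).
Proof.
move=> [mf [M fM]] mh; split; first exact: measurableT_comp.
by exists M => x.
Qed.

Variable P : probability T R.

Lemma bmfun_integrable f : bmfun f -> P.-integrable setT (EFin \o f).
Proof.
move=> [mf [M fM]]; apply: measurable_bounded_integrable => //.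
  by apply: (@le_lt_trans _ _ 1%E); [exact: probability_le1|exact: ltry].
exists M; split; first exact: num_real.
by move=> N MN x _ /=; rewrite (le_trans (fM x))// ltW.
Qed.

Lemma integral_cst_prob (c : R) : \int[P]_x c = c.
Proof. by rewrite Rintegral_cst// [X in fine X](_ : _ = 1%E) ?mulr1//; exact: probability_setT. Qed.

Lemma bmfun_intD f g : bmfun f -> bmfun g ->
  \int[P]_x (f x + g x) = \int[P]_x f x + \int[P]_x g x.
Proof. by move=> bf bg; rewrite RintegralD//; exact: bmfun_integrable. Qed.

Lemma bmfun_intB f g : bmfun f -> bmfun g ->
  \int[P]_x (f x - g x) = \int[P]_x f x - \int[P]_x g x.
Proof. by move=> bf bg; rewrite RintegralB//; exact: bmfun_integrable. Qed.

Lemma bmfun_intZl c f : bmfun f -> \int[P]_x (c * f x) = c * \int[P]_x f x.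
Proof. by move=> bf; rewrite RintegralZl//; exact: bmfun_integrable. Qed.

Lemma bmfun_int_sum I (s : seq I) (f : I -> T -> R) : (forall i, bmfun (f i)) ->
  \int[P]_x (\sum_(i <- s) f i x) = \sum_(i <- s) \int[P]_x f i x.
Proof.
move=> bf; elim: s => [|i s ih].
  by under eq_Rintegral do rewrite big_nil; rewrite integral_cst_prob big_nil.
under eq_Rintegral do rewrite big_cons.
by rewrite big_cons bmfun_intD ?ih//; exact: bmfun_sum.
Qed.

Lemma bmfun_int_le f g : bmfun f -> bmfun g -> (forall x, f x <= g x) ->
  \int[P]_x f x <= \int[P]_x g x.
Proof. by move=> bf bg fg; apply: le_Rintegral => //; exact: bmfun_integrable. Qed.

Lemma bmfun_int_le_cst f c : bmfun f -> (forall x, f x <= c) -> \int[P]_x f x <= c.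
Proof.
move=> bf fc; rewrite -[leRHS]integral_cst_prob.
by apply: bmfun_int_le => //; exact: bmfun_cst.
Qed.

Lemma bmfun_int_norm f : bmfun f -> `|\int[P]_x f x| <= \int[P]_x `|f x|.
Proof. by move=> bf; apply: le_normr_Rintegral => //; exact: bmfun_integrable. Qed.

Lemma bmfun_int_norm_le f c : bmfun f -> (forall x, `|f x| <= c) ->
  `|\int[P]_x f x| <= c.
Proof.
move=> bf fc; apply: le_trans (bmfun_int_norm bf) _.
by apply: bmfun_int_le_cst => //; exact: bmfun_norm.
Qed.

Lemma sqr_int_le f : bmfun f -> (\int[P]_x f x) ^+ 2 <= \int[P]_x f x ^+ 2.
Proof.
move=> bf; set c := \int[P]_x f x.
have : 0 <= \int[P]_x (f x - c) ^+ 2 by apply: Rintegral_ge0 => x _; exact: sqr_ge0.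
under eq_Rintegral do rewrite sqrrB -mulr_natl mulrA mulrAC.
rewrite bmfun_intD ?bmfun_intB ?bmfun_intZl ?integral_cst_prob -/c//.
- by rewrite -subr_ge0; lra.
all: repeat (apply: bmfunX || apply: bmfunB || apply: bmfunM || apply: bmfunD || apply: bmfun_cst || done).
Qed.

Lemma int_norm_le_sqrt f : bmfun f ->
  \int[P]_x `|f x| <= Num.sqrt (\int[P]_x f x ^+ 2).
Proof.
move=> bf; rewrite -(ler_pXn2r (n := 2))// ?nnegrE ?sqrtr_ge0//; last first.
  by apply: Rintegral_ge0.
rewrite sqr_sqrtr; last by apply: Rintegral_ge0 => x _; exact: sqr_ge0.
apply: le_trans (sqr_int_le (bmfun_norm bf)) _.
by rewrite le_eqVlt; apply/orP; left; apply/eqP/eq_Rintegral => x _; rewrite real_normK ?num_real.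
Qed.

Lemma int_measure_preserving dd' (T' : measurableType dd') (Q : probability T' R)
    (h : T' -> T) f : measurable_fun setT h ->
  (forall A, measurable A -> Q (h @^-1` A) = P A) -> bmfun f ->
  \int[Q]_x f (h x) = \int[P]_y f y.
Proof.
move=> mh hQ bf; congr fine.
have := @integral_pushforward _ _ _ _ R h mh Q setT (EFin \o f).
rewrite preimage_setT => <- //.
- by apply: eq_measure_integral => A mA _; exact: hQ.
- by apply/measurable_EFinP; case: bf.
- have [mf [M fM]] := bmfun_comp bf mh; apply: measurable_bounded_integrable => //.
    by apply: (@le_lt_trans _ _ 1%E); [exact: probability_le1|exact: ltry].
  exists M; split; first exact: num_real.
  by move=> N MN x _ /=; rewrite (le_trans (fM x))// ltW.
Qed.

End BoundedFunctions.

(** * Fubini's theorem for bounded functions *)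

Section FubiniBounded.
Context {R : realType} {d1 d2} {T1 : measurableType d1} {T2 : measurableType d2}.
Variables (P1 : probability T1 R) (P2 : probability T2 R).
Variable f : T1 * T2 -> R.
Hypothesis bf : bmfun f.

Lemma bmfun_pair1 x : bmfun (fun y => f (x, y)).
Proof. by apply: (bmfun_comp bf); exact: pair1_measurable. Qed.

Lemma bmfun_pair2 y : bmfun (fun x => f (x, y)).
Proof. by apply: (bmfun_comp bf); exact: pair2_measurable. Qed.

Lemma bmfun_int2 : bmfun (fun x => \int[P2]_y f (x, y)).
Proof.
split.
  apply: measurableT_comp => //.
  exact: (measurable_fubini_F (m1 := P1) (bmfun_integrable _ bf)).
by have [mf [M fM]] := bf; exists M => x; exact: bmfun_int_norm_le (bmfun_pair1 x) _.
Qed.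

Lemma bmfun_int1 : bmfun (fun y => \int[P1]_x f (x, y)).
Proof.
split.
  apply: measurableT_comp => //.
  exact: (measurable_fubini_G (m2 := P2) (bmfun_integrable _ bf)).
by have [mf [M fM]] := bf; exists M => x; exact: bmfun_int_norm_le (bmfun_pair2 x) _.
Qed.

Lemma int_prod12 : \int[P1]_x \int[P2]_y f (x, y) = \int[(P1 \x P2)%E]_z f z.
Proof.
rewrite /Rintegral -(integral12_prod_meas1 (bmfun_integrable _ bf)).
congr fine; apply: eq_integral => x _; rewrite fineK//.
by apply: integrable_fin_num => //; exact: bmfun_integrable (bmfun_pair1 x).
Qed.

Lemma int_prod21 : \int[P2]_y \int[P1]_x f (x, y) = \int[(P1 \x P2)%E]_z f z.
Proof.
rewrite /Rintegral -(integral21_prod_meas1 (bmfun_integrable _ bf)).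
congr fine; apply: eq_integral => x _; rewrite fineK//.
by apply: integrable_fin_num => //; exact: bmfun_integrable (bmfun_pair2 x).
Qed.

End FubiniBounded.

(** * Product measures and the Efron-Stein inequality *)

Section Resampling.
Context {R : realType} {d : nat}.
Notation Om := (Omega R d).
Implicit Types (S : pred (cube d)) (s : seq (cube d)) (B : cube d -> set R).

Lemma measurable_coord (Q : cube d) : measurable_fun setT (fun w : Om => w Q).
Proof.
move=> _ B mB; rewrite setTI; apply: sub_sigma_algebra.
by exists Q, B.
Qed.

Lemma measurable_into_Omega dd (T : measurableType dd) (h : T -> Om) :
  (forall Q, measurable_fun setT (fun x => h x Q)) -> measurable_fun setT h.
Proof.
move=> mh; apply: (@measurability _ _ T Om setT h (@coord_gens R d)) => //.
by move=> _ [_ [Q [B [mB ->]]] <-]; exact: (mh Q).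
Qed.

Definition cyl s B : set Om := [set w : Om | forall Q, Q \in s -> B Q (w Q)].

Lemma measurable_cyl s B : (forall Q, measurable (B Q)) -> measurable (cyl s B).
Proof.
move=> mB; elim: s => [|Q s ih].
  by rewrite (_ : cyl _ _ = setT)//; apply/seteqP; split.
rewrite (_ : cyl _ _ = [set w | B Q (w Q)] `&` cyl s B).
  apply: measurableI => //; rewrite -[X in measurable X]setTI.
  exact: measurable_coord.
apply/seteqP; split => w /=.
  by move=> h; split => [|Q' Q's]; apply: h; rewrite inE ?eqxx// Q's orbT.
by move=> [BQ h] Q'; rewrite inE => /predU1P[->//|]; exact: h.
Qed.

Variable P : probability Om R.
Hypothesis prodP : product_measure P.

Lemma prob_cyl s B : (forall Q, measurable (B Q)) ->
  P (cyl s B) = (\prod_(Q <- undup s) P [set w : Om | B Q (w Q)])%E.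
Proof.
move=> mB; rewrite -prodP ?undup_uniq//; congr (P _).
by apply/seteqP; split => w /= h Q; have := h Q; rewrite mem_undup.
Qed.

Definition pair_cyl s B B' : set (Om * Om) := (cyl s B) `*` (cyl s B').

(** A generating pi-system. One list of coordinates serves both copies, so that a swap of
    coordinates maps a member to a member. *)
Definition pair_cyls : set (set (Om * Om)) :=
  [set C | exists s B B', [/\ forall Q, measurable (B Q),
     forall Q, measurable (B' Q) & C = pair_cyl s B B']].

Lemma measurable_pair_cyl s B B' : (forall Q, measurable (B Q)) ->
  (forall Q, measurable (B' Q)) -> measurable (pair_cyl s B B').
Proof. by move=> mB mB'; apply: measurableX; exact: measurable_cyl. Qed.

Lemma pair_cylsI : setI_closed pair_cyls.
Proof.
move=> _ _ [s1 [B1 [B1' [m1 m1' ->]]]] [s2 [B2 [B2' [m2 m2' ->]]]].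
pose J C1 C2 (Q : cube d) := (if Q \in s1 then C1 Q else setT) `&`
                  (if Q \in s2 then C2 Q else setT) : set R.
have mJ C1 C2 : (forall Q, measurable (C1 Q)) -> (forall Q, measurable (C2 Q)) ->
    forall Q, measurable (J C1 C2 Q).
  by move=> mC1 mC2 Q; apply: measurableI; case: ifP => // _; exact: measurableT.
have cJ C1 C2 : cyl (s1 ++ s2) (J C1 C2) = cyl s1 C1 `&` cyl s2 C2.
  apply/seteqP; split => w /=.
    move=> h; split => Q Qs; have := h Q; rewrite mem_cat Qs ?orbT => /(_ erefl) [].
      by rewrite /J Qs.
    by rewrite /J Qs.
  move=> [h1 h2] Q _; split; case: ifP => // Qs; [exact: h1|exact: h2].
exists (s1 ++ s2), (J B1 B2), (J B1' B2'); split; try exact: mJ.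
by rewrite /pair_cyl !cJ; apply/seteqP; split => -[a b] /= [] [] ? ? [].
Qed.

Lemma pair_cyls_gen : @measurable _ (Om * Om)%type = <<s pair_cyls >>.
Proof.
apply/seteqP; split; last first.
  apply: smallest_sub; first exact: sigma_algebra_measurable.
  by move=> _ [s [B [B' [mB mB' ->]]]]; exact: measurable_pair_cyl.
move=> A mA.
(* The identity is measurable from the sigma-algebra generated by the cylinders, so that
   sigma-algebra contains [A]. *)
have mid : measurable_fun setT (fun z : g_sigma_algebraType pair_cyls => z : Om * Om).
  apply/measurable_fun_pairP; split; apply: measurable_into_Omega => Q _ B mB;
    rewrite setTI; apply: sub_sigma_algebra.
    exists [:: Q], (fun=> B), (fun=> setT); split => //.
    apply/seteqP; split => -[a b] /=; last by case => /(_ Q); rewrite inE => /(_ (eqxx _)).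
    by move=> BaQ; split => // Q'; rewrite inE => /eqP ->.
  exists [:: Q], (fun=> setT), (fun=> B); split => //.
  apply/seteqP; split => -[a b] /=; last by case => _ /(_ Q); rewrite inE => /(_ (eqxx _)).
  by move=> BaQ; split => // Q'; rewrite inE => /eqP ->.
by have := mid measurableT A mA; rewrite setTI.
Qed.

Definition mix S (a b : Om) : Om := fun Q => if S Q then a Q else b Q.

Definition swap_on S (z : Om * Om) : Om * Om := (mix S z.2 z.1, mix S z.1 z.2).

Lemma measurable_mix S : measurable_fun setT (fun z : Om * Om => mix S z.2 z.1).
Proof.
apply: measurable_into_Omega => Q; rewrite /mix; case: (S Q).
  by apply: (measurableT_comp (measurable_coord Q)); exact: measurable_snd.
by apply: (measurableT_comp (measurable_coord Q)); exact: measurable_fst.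
Qed.

Lemma measurable_swap_on S : measurable_fun setT (swap_on S).
Proof.
apply: measurable_fun_pair; first exact: measurable_mix.
exact: (measurableT_comp (measurable_mix S) (@measurable_swap _ _ _ _)).
Qed.

HB.instance Definition _ S := isMeasurableFun.Build _ _ _ _ (swap_on S) (measurable_swap_on S).

Notation PP := (P \x P)%E.

(** On pair cylinders both sides are products over coordinates and the swap exchanges the two
    factors at each coordinate of [S]; uniqueness of measures does the rest. This symmetry is the
    form in which the product hypothesis is used below. *)
Lemma swap_on_preserving S (A : set (Om * Om)) : measurable A ->
  PP (swap_on S @^-1` A) = PP A.
Proof.
move=> mA.
pose m' : {measure set (Om * Om) -> \bar R} := distribution PP (swap_on S).
rewrite -[LHS]/(m' A).
apply: (measure_unique pair_cyls (fun=> setT) pair_cyls_gen pair_cylsI) => //.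
- move=> _; exists [::], (fun=> setT), (fun=> setT); split => //.
  by apply/seteqP; split.
- by rewrite bigcup_const.
- move=> _ [s [B [B' [mB mB' ->]]]].
  pose B1 Q := if S Q then B' Q else B Q; pose B2 Q := if S Q then B Q else B' Q.
  have mB1 Q : measurable (B1 Q) by rewrite /B1; case: ifP.
  have mB2 Q : measurable (B2 Q) by rewrite /B2; case: ifP.
  have -> : m' (pair_cyl s B B') = PP (cyl s B1 `*` cyl s B2).
    congr (PP _); apply/seteqP; split => -[a b] /= [h1 h2]; split => Q Qs /=.
    + by move: (h1 Q Qs) (h2 Q Qs); rewrite /swap_on /mix /B1 /B2 /=; case: ifP.
    + by move: (h1 Q Qs) (h2 Q Qs); rewrite /swap_on /mix /B1 /B2 /=; case: ifP.
    + by move: (h1 Q Qs) (h2 Q Qs); rewrite /swap_on /mix /B1 /B2 /=; case: ifP.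
    + by move: (h1 Q Qs) (h2 Q Qs); rewrite /swap_on /mix /B1 /B2 /=; case: ifP.
  have prodE C C' : (forall Q, measurable (C Q)) -> (forall Q, measurable (C' Q)) ->
      PP (cyl s C `*` cyl s C') = (\prod_(Q <- undup s)
        (P [set w : Om | C Q (w Q)] * P [set w : Om | C' Q (w Q)]))%E.
    move=> mC mC'; rewrite big_split/=.
    apply: eq_trans (product_measure1E _ _ _ _) _; try exact: measurable_cyl.
    by congr (_ * _)%E; exact: prob_cyl.
  apply: eq_trans (prodE _ _ mB1 mB2) _; apply: eq_trans (esym (prodE _ _ mB mB')).
  by apply: eq_bigr => Q _; rewrite /B1 /B2; case: ifP => // _; rewrite muleC.
- move=> _; apply: (@le_lt_trans _ _ 1%E); last exact: ltry.
  rewrite -[m' setT]/(distribution PP (swap_on S) setT).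
  exact: probability_le1.
Qed.

Lemma int_swap_on S (f : Om * Om -> R) : bmfun f ->
  \int[PP]_z f (swap_on S z) = \int[PP]_z f z.
Proof.
move=> bf; apply: (int_measure_preserving (measurable_swap_on S)) => // A mA.
exact: swap_on_preserving.
Qed.

Lemma int_fst (f : Om -> R) : bmfun f -> \int[PP]_z f z.1 = \int[P]_w f w.
Proof.
move=> bf; rewrite -int_prod12; last exact: bmfun_comp measurable_fst.
by apply: eq_Rintegral => x _ /=; rewrite integral_cst_prob.
Qed.

(** The hybrid is the first component of the swapped pair. *)
Lemma int_mix S (f : Om -> R) : bmfun f ->
  \int[PP]_z f (mix S z.2 z.1) = \int[P]_w f w.
Proof.
move=> bf; rewrite -int_fst// -(int_swap_on S (f := fun z => f z.1))//.
exact: bmfun_comp measurable_fst.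
Qed.

Definition depends_on S (f : Om -> R) :=
  forall a b : Om, (forall Q, S Q -> a Q = b Q) -> f a = f b.

Lemma int_prod_indep (f g : Om -> R) : bmfun f -> bmfun g ->
  \int[PP]_z (f z.1 * g z.2) = (\int[P]_w f w) * (\int[P]_w g w).
Proof.
move=> bf bg; rewrite -int_prod12; last first.
  by apply: bmfunM; [exact: bmfun_comp measurable_fst|exact: bmfun_comp measurable_snd].
rewrite /=; under eq_Rintegral do rewrite bmfun_intZl//.
under eq_Rintegral do rewrite mulrC.
by rewrite bmfun_intZl// mulrC.
Qed.

(** * The Efron-Stein inequality *)

Section EfronStein.
Variables (I : eqType) (group : cube d -> I).

Definition grp (z : I) : pred (cube d) := fun Q => group Q == z.
Definition grps (l : seq I) : pred (cube d) := fun Q => group Q \in l.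

Variable F : Om -> R.
Hypothesis bF : bmfun F.

Definition resample_sqr z : R := \int[PP]_p (F p.1 - F (mix (grp z) p.2 p.1)) ^+ 2.

Let bmfun_mix S : bmfun (fun p : Om * Om => F (mix S p.2 p.1)).
Proof. by apply: (bmfun_comp bF); exact: measurable_mix. Qed.

Let bmfun_F1 : bmfun (fun p : Om * Om => F p.1).
Proof. by apply: (bmfun_comp bF); exact: measurable_fst. Qed.

(* Swapping the two copies on the group [z] exchanges the hybrids for [l] and [z :: l];
   AM-GM then bounds the symmetrized product. *)
Let efron_stein_step z l : z \notin l ->
  \int[PP]_p (F p.1 * (F (mix (grps l) p.2 p.1) - F (mix (grps (z :: l)) p.2 p.1)))
  <= 2^-1 * resample_sqr z.
Proof.
move=> zl.
pose A p := F (mix (grps l) p.2 p.1); pose C p := F (mix (grps (z :: l)) p.2 p.1).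
pose Z p := F (mix (grp z) p.2 p.1).
have bA : bmfun A by exact: bmfun_mix.
have bC : bmfun C by exact: bmfun_mix.
have bZ : bmfun Z by exact: bmfun_mix.
have zlF Q : group Q == z -> (group Q \in l) = false by move=> /eqP ->; exact: negbTE.
have Az p : A (swap_on (grp z) p) = C p.
  congr F; apply/funext => Q; rewrite /mix /swap_on /= /mix /grp /grps inE.
  by have [/zlF ->|_] := boolP (group Q == z); case: (group Q \in l).
have Cz p : C (swap_on (grp z) p) = A p.
  congr F; apply/funext => Q; rewrite /mix /swap_on /= /mix /grp /grps inE.
  by have [/zlF ->|_] := boolP (group Q == z); case: (group Q \in l).
have bFAC : bmfun (fun p => F p.1 * (A p - C p)) by apply/bmfunM/bmfunB.
have bZCA : bmfun (fun p => Z p * (C p - A p)) by apply/bmfunM/bmfunB.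
have sw : \int[PP]_p (F p.1 * (A p - C p)) = \int[PP]_p (Z p * (C p - A p)).
  rewrite -(int_swap_on (grp z) bFAC); apply: eq_Rintegral => p _.
  by rewrite Az Cz.
have half : \int[PP]_p (F p.1 * (A p - C p)) =
    2^-1 * \int[PP]_p ((F p.1 - Z p) * (A p - C p)).
  under [in RHS]eq_Rintegral do rewrite mulrBl -[X in _ - X]opprK -mulrN opprB opprK.
  by rewrite bmfun_intD// -sw; lra.
rewrite half ler_pM2l ?invr_gt0//.
have bFZ : bmfun (fun p => F p.1 - Z p) by exact: bmfunB.
have bAC : bmfun (fun p => A p - C p) by exact: bmfunB.
(* Swapping the groups of [l] carries the original and its resampling at [z] to the two consecutive
   hybrids [A] and [C]. *)
have sqAC : \int[PP]_p (A p - C p) ^+ 2 = resample_sqr z.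
  rewrite /resample_sqr -(int_swap_on (grps l) (bmfunX 2 bFZ)).
  apply: eq_Rintegral => p _; congr ((_ - F _) ^+ 2).
  apply/funext => Q; rewrite /mix /swap_on /= /mix /grp /grps inE.
  by have [/zlF ->|_] := boolP (group Q == z); case: (group Q \in l).
have : \int[PP]_p ((F p.1 - Z p) * (A p - C p)) <=
    \int[PP]_p (2^-1 * (F p.1 - Z p) ^+ 2 + 2^-1 * (A p - C p) ^+ 2).
  apply: bmfun_int_le; first exact: bmfunM.
    by apply: bmfunD; apply: bmfunM; try exact: bmfunX; exact: bmfun_cst.
  by move=> p; have := sqr_ge0 ((F p.1 - Z p) - (A p - C p)); nra.
rewrite bmfun_intD ?bmfun_intZl ?sqAC//; try exact: bmfunX.
- by rewrite -/(resample_sqr z) => /le_trans; apply; lra.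
- by apply: bmfunM; [exact: bmfun_cst|exact: bmfunX].
- by apply: bmfunM; [exact: bmfun_cst|exact: bmfunX].
Qed.

(** The variance is the mean of [F p.1 * (F p.1 - F p.2)]. Since [F] depends only on the groups in
    [l], [F p.2] is its value at the last hybrid, and replacing the groups one at a time gives a
    telescoping sum. *)
Lemma efron_stein l : uniq l -> depends_on (grps l) F ->
  \int[P]_w F w ^+ 2 - (\int[P]_w F w) ^+ 2 <= 2^-1 * \sum_(z <- l) resample_sqr z.
Proof.
move=> ul dF.
have H l' : uniq l' -> \int[PP]_p (F p.1 * (F p.1 - F (mix (grps l') p.2 p.1)))
    <= 2^-1 * \sum_(z <- l') resample_sqr z.
  elim: l' => [_|z l' ih /= /andP[zl' ul']].
    rewrite big_nil mulr0 (_ : (fun p : Om * Om => _) = cst 0) ?integral_cst_prob//.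
    by apply/funext => p /=; rewrite (_ : mix _ _ _ = p.1) ?subrr ?mulr0.
  rewrite big_cons mulrDr addrC.
  apply: le_trans (lerD (ih ul') (efron_stein_step zl')).
  rewrite -bmfun_intD; [|by apply/bmfunM/bmfunB|by apply: bmfunM => //; exact: bmfunB].
  rewrite le_eqVlt; apply/orP; left; apply/eqP/eq_Rintegral => p _.
  by ring.
apply: le_trans (H l ul); rewrite le_eqVlt; apply/orP; left; apply/eqP.
have -> : \int[PP]_p (F p.1 * (F p.1 - F (mix (grps l) p.2 p.1))) =
    \int[PP]_p (F p.1 ^+ 2 - F p.1 * F p.2).
  apply: eq_Rintegral => p _; rewrite (dF (mix (grps l) p.2 p.1) p.2); first by ring.
  by move=> Q Ql; rewrite /mix Ql.
rewrite bmfun_intB ?int_prod_indep ?(int_fst (f := fun w => F w ^+ 2))//.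
- exact: bmfunX.
- exact: bmfunX.
- by apply: bmfunM => //; apply: (bmfun_comp bF); exact: measurable_snd.
Qed.

End EfronStein.
End Resampling.

(** * Smoothing by moving averages *)

Section Smoothing.
Context {R : realType}.
Implicit Types f g : R -> R.
Notation mu := (@lebesgue_measure R).

Lemma is_derive_continuous f df : (forall x : R, is_derive x 1 f (df x)) -> continuous f.
Proof.
move=> fdf x; apply: differentiable_continuous; apply/derivable1_diffP.
by have [] := fdf x.
Qed.

Lemma is_derive_shiftr f df (h : R) : (forall x : R, is_derive x 1 f (df x)) ->
  forall x : R, is_derive x 1 (fun y => f (y + h)) (df (x + h)).
Proof.
move=> fdf x; rewrite -[df _]mulr1.
apply: (@is_derive1_comp _ f (fun y => y + h)).
by rewrite -[X in is_derive _ _ _ X]addr0; exact: is_deriveD.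
Qed.

Lemma is_derive_shiftl f df (h : R) : (forall x : R, is_derive x 1 f (df x)) ->
  forall x : R, is_derive x 1 (fun y => f (h + y)) (df (h + x)).
Proof.
move=> fdf x; rewrite (_ : (fun y => _) = fun y => f (y + h)).
  by rewrite addrC; exact: is_derive_shiftr.
by apply/funext => y; rewrite addrC.
Qed.

Lemma is_derive_subM f (a b c x : R) : is_derive x 1 f a ->
  is_derive x 1 (fun y => f y - b - c * y) (a - c).
Proof.
move=> fa; have := is_deriveB fa (is_deriveZ c (is_derive_id x 1)).
move/(fun H => is_deriveB H (is_derive_cst b x 1)).
rewrite subr0 (_ : c *: 1 = c * 1)// mulr1; congr is_derive.
by apply/funext => y; exact: addrAC.
Qed.

(** Either order of [x] and [y] is allowed, and the intermediate point is located by its distance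
    from [x], as the Taylor remainders require. *)
Lemma mean_value f df (x y : R) : (forall z : R, is_derive z 1 f (df z)) ->
  exists2 c, `|c - x| <= `|y - x| & f y - f x = df c * (y - x).
Proof.
move=> fdf; have cf := is_derive_continuous fdf.
have [xy|/ltW yx] := leP x y.
  have [c] := @MVT_segment _ f df x y xy (fun z _ => fdf z) (continuous_subspaceT cf).
  rewrite in_itv/= => /andP[xc cy] ->; exists c => //.
  by rewrite !ger0_norm ?subr_ge0// lerD2r.
have [c] := @MVT_segment _ f df y x yx (fun z _ => fdf z) (continuous_subspaceT cf).
rewrite in_itv/= => /andP[yc cx] e; exists c; last by rewrite -opprB e -mulrN opprB.
by rewrite !ler0_norm ?subr_le0// lerN2 lerD2r.
Qed.

(** As [f] vanishes up to [L], one integral serves every [x]; starting it at [L - 1] makes [x = L]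
    an interior point. *)
Lemma antiderivative f L : continuous f -> (forall x, x <= L -> f x = 0) ->
  exists F : R -> R, (forall x : R, is_derive x 1 F (f x)) /\ forall x, x <= L -> F x = 0.
Proof.
move=> cf f0; pose F x := \int[mu]_(t in `[L - 1, x]) f t.
have F0 x : x <= L -> F x = 0.
  move=> xL; rewrite /F (@eq_Rintegral _ _ _ mu _ (cst 0)).
    by rewrite Rintegral_cst ?mul0r//; exact: measurable_itv.
  by move=> t; rewrite inE/= in_itv/= => /andP[_ tx]; rewrite f0// (le_trans tx).
exists F; split => // x; have [Lx|xL] := leP L x.
  have int_f : mu.-integrable `[L - 1, x + 1] (EFin \o f).
    apply: continuous_compact_integrable; first exact: segment_compact.
    exact: continuous_subspaceT.
  have xu : x < x + 1 by lra.
  have ax : L - 1 < x by lra.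
  have [dF Fx] := continuous_FTC1_closed xu int_f ax (cf x).
  by apply: (DeriveDef dF); rewrite -Fx derive1E.
rewrite f0 ?(ltW xL)//; apply: (@near_eq_is_derive _ _ _ (cst (0 : R))).
near=> y; rewrite F0//; near: y.
by apply/filterS/(lt_nbhsl xL) => y /ltW.
Unshelve. all: by end_near. Qed.

(** The average of [f] over [[x, x + h]], written with an antiderivative. It gains one derivative,
    and the last clause carries both sup bounds and closeness to [f] through repeated averaging. *)
Lemma moving_average f L h : 0 < h -> continuous f -> (forall x, x <= L -> f x = 0) ->
  exists g : R -> R, [/\ forall x : R, is_derive x 1 g (h^-1 * (f (x + h) - f x)),
    forall x, x <= L - h -> g x = 0 &
    forall x, exists2 z, x <= z <= x + h & g x = f z].
Proof.
move=> h0 cf f0; have [F [dF F0]] := antiderivative cf f0.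
exists (fun x => h^-1 * (F (x + h) - F x)); split => [x|x xLh|x].
- by apply: is_deriveZ; apply: is_deriveB => //; exact: is_derive_shiftr.
- by rewrite !F0 ?subrr ?mulr0//; lra.
have xh : x <= x + h by rewrite lerDl ltW.
have [z] := @MVT_segment _ F f x (x + h) xh (fun z _ => dF z)
  (continuous_subspaceT (is_derive_continuous dF)).
rewrite in_itv/= => xz e; exists z => //; rewrite e; field.
by rewrite gt_eqF.
Qed.

Definition smooth3 g := exists g1 g2 g3 : R -> R, exists K : R,
  [/\ forall x : R, is_derive x 1 g (g1 x), forall x : R, is_derive x 1 g1 (g2 x),
      forall x : R, is_derive x 1 g2 (g3 x) &
      forall x, [/\ `|g x| <= K, `|g1 x| <= K, `|g2 x| <= K & `|g3 x| <= K]].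

Lemma smooth3_bounded g : smooth3 g -> exists K, forall x, `|g x| <= K.
Proof. by move=> [g1 [g2 [g3 [K [_ _ _ b]]]]]; exists K => x; case: (b x). Qed.

Lemma smooth3_continuous g : smooth3 g -> continuous g.
Proof. by move=> [g1 [g2 [g3 [K [dg _ _ _]]]]]; exact: is_derive_continuous dg. Qed.

Lemma smooth3_lipschitz g : smooth3 g ->
  exists2 K, 0 <= K & forall x y, `|g x - g y| <= K * `|x - y|.
Proof.
move=> [g1 [g2 [g3 [K [dg _ _ b]]]]]; exists K.
  by have [_ + _ _] := b 0; apply: le_trans.
move=> x y; have [c _ ->] := mean_value y x dg.
by rewrite normrM ler_wpM2r//; have [] := b c.
Qed.

(** The mean value theorem is applied to the remainder of each order in turn; this gives [K] in
    place of the sharp [K / 6]. *)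
Lemma smooth3_taylor g : smooth3 g -> exists g1 g2 : R -> R, exists2 K, 0 <= K &
  [/\ continuous g1, continuous g2, forall x, `|g1 x| <= K, forall x, `|g2 x| <= K &
  forall x y, `|g (x + y) - g x - g1 x * y - 2^-1 * g2 x * y ^+ 2| <= K * `|y| ^+ 3].
Proof.
move=> [g1 [g2 [g3 [K [dg dg1 dg2 b]]]]]; exists g1, g2, K.
  by have [_ + _ _] := b 0; apply: le_trans.
split; [exact: is_derive_continuous dg1|exact: is_derive_continuous dg2| | |].
- by move=> x; have [] := b x.
- by move=> x; have [] := b x.
move=> x y.
have K0 : 0 <= K by have [_ + _ _] := b 0; apply: le_trans.
have r2 u : `|g2 (x + u) - g2 x| <= K * `|u|.
  have [c _ ->] := mean_value x (x + u) dg2; rewrite normrM addrC addKr.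
  by rewrite ler_wpM2r//; have [] := b c.
have r1 u : `|g1 (x + u) - g1 x - g2 x * u| <= K * `|u| ^+ 2.
  pose r v := g1 (x + v) - g1 x - g2 x * v.
  have dr (v : R) : is_derive v 1 r (g2 (x + v) - g2 x).
    exact: (is_derive_subM (g1 x) (g2 x) (is_derive_shiftl x dg1 v)).
  have [c cu e] := mean_value 0 u dr.
  have -> : g1 (x + u) - g1 x - g2 x * u = r u - r 0 by rewrite /r addr0; ring.
  rewrite e normrM subr0 expr2 mulrA ler_wpM2r//.
  apply: le_trans (r2 c) _; rewrite ler_wpM2l//.
  by move: cu; rewrite !subr0.
pose r v := g (x + v) - g x - g1 x * v - 2^-1 * g2 x * v ^+ 2.
have dr (v : R) : is_derive v 1 r (g1 (x + v) - g1 x - g2 x * v).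
  have d1 := is_derive_subM (g x) (g1 x) (is_derive_shiftl x dg v).
  have d2 : is_derive v 1 (fun v => 2^-1 * g2 x * v ^+ 2) (g2 x * v).
    have := is_deriveZ (2^-1 * g2 x) (is_deriveX 2 (is_derive_id v 1)).
    by congr is_derive; rewrite /GRing.scale /= expr1 mulr1; field.
  by have := is_deriveB d1 d2; congr is_derive.
have [c cu e] := mean_value 0 y dr.
have -> : g (x + y) - g x - g1 x * y - 2^-1 * g2 x * y ^+ 2 = r y - r 0.
  by rewrite /r addr0; ring.
rewrite e normrM subr0 exprSr mulrA ler_wpM2r//.
apply: le_trans (r1 c) _; rewrite ler_wpM2l//.
by move: cu; rewrite !subr0 => cu; rewrite lerXn2r// nnegrE.
Qed.

(** Only [x] is confined to the segment; [y] may leave it. *)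
Lemma uniform_continuous_segment f (a b e : R) : continuous f -> 0 < e ->
  exists2 delta, 0 < delta &
    forall x y, a <= x <= b -> `|x - y| < delta -> `|f x - f y| < e.
Proof.
move=> cf e0.
have /compact_near_coveringP/(_ R (0^'+) (fun delta x => forall y, `|x - y| < delta -> `|f x - f y| < e)) := @segment_compact R a b.
case=> [x _|].
  have /cvgrPdist_lt/(_ (e / 2)) := cf x; rewrite divr_gt0// => /(_ isT).
  move=> /nbhs_ballP[r /= r0 rf].
  exists (ball x (r / 2), [set t | 0 < t < r / 2]) => /=.
    split; first exact/nbhsx_ballx/divr_gt0.
    near=> t; apply/andP; split; near: t; first exact: nbhs_right_gt.
    by apply: nbhs_right_lt; exact: divr_gt0.
  move=> [z t] /= [xz /andP[t0 tr]] y zy.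
  have fz : `|f x - f z| < e / 2.
    by apply: rf; rewrite /ball/= in xz *; lra.
  have fy : `|f x - f y| < e / 2.
    apply: rf; rewrite /ball/= in xz *; rewrite (_ : x - y = (x - z) + (z - y)); last ring.
    by apply: le_lt_trans (ler_normD _ _) _; lra.
  rewrite (_ : f z - f y = (f x - f y) - (f x - f z)); last ring.
  by apply: le_lt_trans (ler_normB _ _) _; lra.
move=> r /= r0 rf; exists (r / 2); first exact: divr_gt0.
move=> x y xab xy; apply: (rf (r / 2)) => //=.
- by rewrite sub0r normrN gtr0_norm ?divr_gt0//; lra.
- by rewrite divr_gt0.
Unshelve. all: by end_near. Qed.

(* Three moving averages of width [h] make [f] three times differentiable, and
   the mean value theorem shows that the result takes at [x] a value of [f] within [3h]. *)
Lemma smoothing f (B e : R) : continuous f -> (forall x, `|f x| <= B) -> 0 < e ->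
  exists2 g, smooth3 g & forall x, `|f x - g x| <= e * (1 + x ^+ 2).
Proof.
move=> cf fB e0.
have B0 : 0 <= B by exact: le_trans (fB 0).
(* Beyond [M] the crude bound [2 * B] is below [e * x ^+ 2], so [f] and [g] need to be close only on
   [[- M, M]]. *)
pose M := Num.sqrt (2 * B / e) + 1.
have M1 : 1 <= M by rewrite lerDr sqrtr_ge0.
have MB : 2 * B <= e * M ^+ 2.
  have h : Num.sqrt (2 * B / e) ^+ 2 = 2 * B / e.
    by rewrite sqr_sqrtr//; apply: divr_ge0; [exact: mulr_ge0|exact: ltW].
  have : 2 * B = e * Num.sqrt (2 * B / e) ^+ 2 by rewrite h; field; rewrite gt_eqF.
  have : Num.sqrt (2 * B / e) ^+ 2 <= M ^+ 2.
    by rewrite lerXn2r ?nnegrE ?sqrtr_ge0// ?lerDl//; lra.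
  by move=> h1 ->; rewrite ler_pM2l.
(* A cutoff equal to 1 from [- M] on: it makes the function vanish on a left half-line, as
   [moving_average] requires, without changing it where closeness matters. *)
pose chi (x : R) := Num.min 1 (Num.max 0 (x + (M + 1))).
have cchi : continuous chi.
  rewrite (_ : chi = (fun=> 1) \min ((fun=> 0) \max (fun x => x + (M + 1))))//.
  move=> x; apply: continuous_min; first exact: cvg_cst.
  apply: continuous_max; first exact: cvg_cst.
  by apply: cvgD; [exact: cvg_id|exact: cvg_cst].
have chi01 x : 0 <= chi x <= 1.
  by rewrite /chi le_min ler01 le_max lexx ge_min lexx.
have chi1 x : - M <= x -> chi x = 1.
  by move=> Mx; rewrite /chi min_l// le_max; apply/orP; right; lra.
have chi0 x : x <= - (M + 1) -> chi x = 0.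
  by move=> xM; rewrite /chi max_l ?min_r//; lra.
pose k x := f x * chi x.
have ck : continuous k by move=> x; apply: cvgM; [exact: cf|exact: cchi].
have kB x : `|k x| <= B.
  have /andP[c0 c1] := chi01 x.
  by rewrite /k normrM (ger0_norm c0) -[B]mulr1 ler_pM.
have k0 x : x <= - (M + 1) -> k x = 0 by move=> xM; rewrite /k chi0 ?mulr0.
have [delta delta0 unif] := uniform_continuous_segment (- (M + 4)) (M + 4) cf e0.
pose h := Num.min 1 (delta / 6).
have h0 : 0 < h by rewrite lt_min ltr01 divr_gt0.
have h1 : h <= 1 by rewrite ge_min lexx.
have hd : 3 * h < delta.
  have : h <= delta / 6 by rewrite ge_min lexx orbT.
  lra.
have [a [da a0 ak]] := moving_average h0 ck k0.
have [b [db b0 ba]] := moving_average h0 (is_derive_continuous da) a0.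
have [g [dg _ gb]] := moving_average h0 (is_derive_continuous db) b0.
have aB x : `|a x| <= B by have [z _ ->] := ak x.
have bB x : `|b x| <= B by have [z _ ->] := ba x.
have gB x : `|g x| <= B by have [z _ ->] := gb x.
have D1 (u : R -> R) (C x : R) : (forall x, `|u x| <= C) ->
    `|h^-1 * (u (x + h) - u x)| <= h^-1 * (2 * C).
  move=> uC; rewrite normrM gtr0_norm ?invr_gt0// ler_pM2l ?invr_gt0//.
  apply: le_trans (ler_normB _ _) _.
  by have := uC (x + h); have := uC x; lra.
exists g.
  pose K1 := h^-1 * (2 * B); pose K2 := h^-1 * (2 * K1); pose K3 := h^-1 * (2 * K2).
  have h'0 : 0 <= h^-1 by rewrite invr_ge0 ltW.
  have K10 : 0 <= K1 by rewrite !mulr_ge0.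
  have K20 : 0 <= K2 by rewrite !mulr_ge0.
  have K30 : 0 <= K3 by rewrite !mulr_ge0.
  pose d1 x := h^-1 * (b (x + h) - b x).
  pose e1 x := h^-1 * (a (x + h) - a x).
  pose e0' x := h^-1 * (k (x + h) - k x).
  pose d2 x := h^-1 * (e1 (x + h) - e1 x).
  pose f2 x := h^-1 * (e0' (x + h) - e0' x).
  pose d3 x := h^-1 * (f2 (x + h) - f2 x).
  have dZ (u du : R -> R) : (forall x : R, is_derive x 1 u (du x)) ->
      forall x : R, is_derive x 1 (fun x => h^-1 * (u (x + h) - u x)) (h^-1 * (du (x + h) - du x)).
    move=> du' x; apply: is_deriveZ; apply: is_deriveB.
    exact: is_derive_shiftr.
  exists d1, d2, d3, (B + K1 + K2 + K3); split => [//|x|x|x].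
  - exact: (dZ b e1 db).
  - apply: (dZ e1 f2); exact: (dZ a e0' da).
  - have B1 y : `|e0' y| <= K1 by exact: D1.
    have B2 y : `|f2 y| <= K2 by exact: D1.
    have B1' y : `|e1 y| <= K1 by exact: D1.
    have B1'' y : `|d1 y| <= K1 by exact: D1.
    have B2' y : `|d2 y| <= K2 by exact: D1.
    have B3 y : `|d3 y| <= K3 by exact: D1.
    by have := gB x; have := B1'' x; have := B2' x; have := B3 x; split; lra.
move=> x; have x2 : 0 <= x ^+ 2 by exact: sqr_ge0.
have [xM|Mx] := leP `|x| M; last first.
  have : `|f x - g x| <= 2 * B.
    by apply: le_trans (ler_normB _ _) _; have := fB x; have := gB x; lra.
  have : M ^+ 2 <= x ^+ 2.
    by rewrite -[x ^+ 2]real_normK ?num_real// lerXn2r ?nnegrE//; lra.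
  by rewrite -(ler_pM2l e0); lra.
have /andP[xM1 xM2] : - M <= x <= M by rewrite -ler_norml.
have [z1 /andP[] h11 h12 ->] := gb x; have [z2 /andP[] h21 h22 ->] := ba z1.
have [z3 /andP[] h31 h32 ->] := ak z2.
rewrite /k chi1 ?mulr1; last lra.
have : `|f x - f z3| < e.
  apply: unif; first lra.
  by rewrite ler0_norm; lra.
by move=> /ltW /le_trans; apply; rewrite ler_peMr ?lerDl// ltW.
Qed.

End Smoothing.

(** * Gaussian smoothing *)

Section Gaussian.
Context {R : realType}.
Implicit Types f g : R -> R.
Notation mu := (@lebesgue_measure R).
Notation phi := (@normal_pdf R 0 1).
Notation gamma := (@normal_prob R 0 1).

Lemma integral_gamma f : gamma.-integrable setT (EFin \o f) ->
  (\int[gamma]_x (f x)%:E = \int[mu]_x (f x * phi x)%:E)%E.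
Proof.
move=> fint; have mf : measurable_fun setT (EFin \o f) by exact: measurable_int fint.
rewrite -(Radon_Nikodym_change_of_variables (@normal_prob_dominates R 0 1))//=.
under [RHS]eq_integral do rewrite EFinM.
apply: ae_eq_integral => //.
- apply: emeasurable_funM => //; apply: (measurable_int mu).
  by apply: Radon_Nikodym_integrable; exact: normal_prob_dominates.
- by apply: emeasurable_funM => //; apply/measurable_EFinP; exact: measurable_normal_pdf.
- apply: ae_eqe_mul2l => /=.
  rewrite Radon_NikodymE//=; first exact: normal_prob_dominates.
  move=> abmu; case: cid => /= h [h1 h2 h3].
  apply: integral_ae_eq => //=.
    by apply/measurable_EFinP; exact: measurable_normal_pdf.
  by move=> E E01 mE; rewrite -h3.
Qed.

Lemma bmfun_continuous g : continuous g -> (exists M, forall x, `|g x| <= M) ->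
  bmfun (g : measurableTypeR R -> R).
Proof. by move=> cg bg; split => //; exact: continuous_measurable_fun. Qed.

Lemma Rintegral_gamma f : bmfun (f : measurableTypeR R -> R) ->
  \int[gamma]_x f x = \int[mu]_x (f x * phi x).
Proof. by move=> bf; congr fine; rewrite integral_gamma//; exact: bmfun_integrable. Qed.

Lemma measurable_affine (a b : R) :
  measurable_fun setT (fun x : measurableTypeR R => a + b * x : measurableTypeR R).
Proof. by apply: measurable_funD => //; exact: measurable_funM. Qed.

Lemma gauss_expectE (t : R) f : continuous f -> (exists M, forall x, `|f x| <= M) ->
  gauss_expect t f = \int[gamma]_x f (Num.sqrt t * x).
Proof.
move=> cf bf; rewrite Rintegral_gamma//.
have := bmfun_comp (bmfun_continuous cf bf) (measurable_affine 0 (Num.sqrt t)).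
by congr bmfun; apply/funext => x; rewrite add0r.
Qed.

Lemma phiE x : phi x = normal_peak 1 * expR (- (x ^+ 2) / 2).
Proof. by rewrite normal_pdfE ?oner_neq0// /normal_fun subr0 expr1n. Qed.

Lemma phiN x : phi (- x) = phi x.
Proof. by rewrite !phiE sqrrN. Qed.

(** Change of variables for independent standard Gaussians U and V: W = (s U + r V) / c is standard,
    and given W = w, U is Gaussian with mean [s * w / c] and deviation [r / c]. The factor [c / r]
    is the Jacobian. *)
Lemma phi_prod (s r c w u : R) : 0 < r -> 0 < c -> c ^+ 2 = s ^+ 2 + r ^+ 2 ->
  c / r * (phi u * phi ((c * w - s * u) / r)) = phi w * normal_pdf (s * w / c) (r / c) u.
Proof.
move=> r0 c0 csr; rewrite !phiE normal_pdfE; last by rewrite gt_eqF// divr_gt0.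
rewrite /normal_fun.
have -> : normal_peak (r / c) = c / r * normal_peak 1.
  rewrite /normal_peak expr1n mul1r -mulrnAr sqrtrM ?sqr_ge0// sqrtr_sqr.
  by rewrite invfM ger0_norm ?invf_div// divr_ge0 ?ltW.
rewrite [LHS](_ : _ = c / r * normal_peak 1 * normal_peak 1 *
    (expR (- u ^+ 2 / 2) * expR (- ((c * w - s * u) / r) ^+ 2 / 2))); last ring.
rewrite [RHS](_ : _ = c / r * normal_peak 1 * normal_peak 1 *
    (expR (- w ^+ 2 / 2) * expR (- (u - s * w / c) ^+ 2 / ((r / c) ^+ 2 *+ 2)))); last ring.
congr (_ * _); rewrite -!expRD; congr expR.
have rc : c ^+ 2 - s ^+ 2 = r ^+ 2 by rewrite csr; ring.
have r2 : r ^+ 2 != 0 by rewrite expf_neq0// gt_eqF.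
have c2 : c ^+ 2 != 0 by rewrite expf_neq0// gt_eqF.
have e1 : - u ^+ 2 / 2 + - ((c * w - s * u) / r) ^+ 2 / 2 =
    - ((r ^+ 2) * u ^+ 2 + (c * w - s * u) ^+ 2) / (2 * r ^+ 2).
  by field; rewrite gt_eqF.
have e2 : - w ^+ 2 / 2 + - (u - s * w / c) ^+ 2 / ((r / c) ^+ 2 *+ 2) =
    - (r ^+ 2 * w ^+ 2 + (c * u - s * w) ^+ 2) / (2 * r ^+ 2).
  by field; rewrite !gt_eqF.
by rewrite e1 e2 -rc; congr (- _ / _); ring.
Qed.

Lemma int_affine (a b : R) g : 0 < a -> continuous g -> (forall x, 0 <= g x) ->
  (\int[mu]_x (g x)%:E = \int[mu]_x (a * g (a * x + b))%:E)%E.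
Proof.
move=> a0 cg g0.
pose F (x : R) := a * x + b.
have dF (x : R) : is_derive x 1 F a.
  have := is_deriveD (is_deriveZ a (is_derive_id x 1)) (is_derive_cst b x 1).
  by rewrite addr0 (_ : a *: 1 = a * 1)// mulr1.
have F' : (F^`())%classic = cst a.
  by apply/funext => x; rewrite derive1E; exact: derive_val.
rewrite (@increasing_ge0_integration_by_substitutionT R F g)//.
- by apply: eq_integral => x _; rewrite F' mulrC.
- by move=> x y xy; rewrite /F ltrD2r ltr_pM2l.
- by rewrite F' => x; exact: cvg_cst.
- by rewrite F'; exact: is_cvg_cst.
- by rewrite F'; exact: is_cvg_cst.
- rewrite /F; apply/cvgrNyPle => A; near=> x.
  have -> : A = a * ((A - b) / a) + b by field; rewrite gt_eqF.
  by rewrite lerD2r ler_pM2l//; near: x; exact: nbhs_ninfty_le.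
- rewrite /F; apply/cvgryPge => A; near=> x.
  have -> : A = a * ((A - b) / a) + b by field; rewrite gt_eqF.
  by rewrite lerD2r ler_pM2l//; near: x; exact: nbhs_pinfty_ge.
Unshelve. all: by end_near. Qed.

(** Substituting [w] for [v] turns the joint density into that of [phi_prod]; Tonelli then
    integrates out [u], whose conditional density has mass 1. Nonnegativity of [g] spares
    integrability conditions. *)
Lemma gaussian_semigroup_ge0 g (s r : R) : continuous g ->
  (forall x, 0 <= g x) -> 0 < r ->
  (\int[mu]_u \int[mu]_v (phi u * (g (s * u + r * v) * phi v))%:E =
   \int[mu]_w (g (Num.sqrt (s ^+ 2 + r ^+ 2) * w) * phi w)%:E)%E.
Proof.
move=> cg g0 r0.
set c := Num.sqrt _.
have sr0 : 0 < s ^+ 2 + r ^+ 2 by rewrite ltr_wpDl ?sqr_ge0// exprn_gt0.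
have c0 : 0 < c by rewrite sqrtr_gt0.
have c2 : c ^+ 2 = s ^+ 2 + r ^+ 2 by rewrite sqr_sqrtr// ltW.
have phi0 x : 0 <= phi x by exact: normal_pdf_ge0.
have cphi : continuous phi by apply: continuous_normal_pdf; exact: oner_neq0.
have n0 m sg x : 0 <= normal_pdf m sg x :> R by exact: normal_pdf_ge0.
pose k (z : measurableTypeR R * measurableTypeR R) : R :=
  g (c * z.2) * (phi z.2 * normal_pdf (s * z.2 / c) (r / c) z.1).
transitivity (\int[mu]_u \int[mu]_w (k (u, w))%:E)%E.
  apply: eq_integral => u _.
  have cgu : continuous (fun v => phi u * (g (s * u + r * v) * phi v)).
    move=> v; apply: cvgM; first exact: cvg_cst.
    apply: cvgM; last exact: cphi.
    apply: (cvg_comp (fun v => s * u + r * v) g); last exact: cg.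
    by apply: cvgD; [exact: cvg_cst|apply: cvgM; [exact: cvg_cst|exact: cvg_id]].
  rewrite (@int_affine (c / r) (- (s * u / r)) _ (divr_gt0 c0 r0) cgu); last first.
    by move=> v; rewrite !mulr_ge0.
  apply: eq_integral => w _; congr EFin; rewrite /k /=.
  have -> : c / r * w - s * u / r = (c * w - s * u) / r by ring.
  have -> : s * u + r * ((c * w - s * u) / r) = c * w by field; rewrite gt_eqF.
  by rewrite -(phi_prod _ _ r0 c0 c2); ring.
have mk : measurable_fun setT k.
  rewrite /k; apply: measurable_funM.
    apply: measurableT_comp; first exact: continuous_measurable_fun.
    by apply: measurable_funM => //; exact: measurable_snd.
  have -> : (fun z : measurableTypeR R * measurableTypeR R =>
      phi z.2 * normal_pdf (s * z.2 / c) (r / c) z.1) =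
      (fun z => c / r * (phi z.1 * phi ((c * z.2 - s * z.1) / r))).
    by apply/funext => z; rewrite phi_prod.
  apply: measurable_funM => //; apply: measurable_funM.
    by apply: (measurableT_comp (measurable_normal_pdf 0 1)); exact: measurable_fst.
  apply: (measurableT_comp (measurable_normal_pdf 0 1)).
  apply: measurable_funM => //; apply: measurable_funB.
    by apply: measurable_funM => //; exact: measurable_snd.
  by apply: measurable_funM => //; exact: measurable_fst.
rewrite (@fubini_tonelli _ _ _ _ _ mu mu (EFin \o k)); last 2 first.
- exact/measurable_EFinP.
- by move=> z; rewrite lee_fin /k !mulr_ge0.
apply: eq_integral => w _ /=; rewrite /k /=.
under eq_integral do rewrite mulrA EFinM.
rewrite ge0_integralZl//.
- by rewrite integral_normal_pdf mule1.
- by apply/measurable_EFinP; exact: measurable_normal_pdf.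
- by move=> x _; rewrite lee_fin.
- by rewrite lee_fin mulr_ge0.
Qed.

(** The heat semigroup parametrized by the standard deviation, so composition adds squares. *)
Definition gsmooth (s : R) g (x : R) : R := \int[gamma]_y g (x + s * y).

Lemma bmfun_affine g (x s : R) : continuous g -> (exists M, forall x, `|g x| <= M) ->
  bmfun (fun y : measurableTypeR R => g (x + s * y)).
Proof.
by move=> cg bg; exact: (bmfun_comp (bmfun_continuous cg bg) (measurable_affine x s)).
Qed.

Lemma bmfun_affine2 g (x s r : R) : continuous g -> (exists M, forall x, `|g x| <= M) ->
  bmfun (fun z : measurableTypeR R * measurableTypeR R => g (x + s * z.1 + r * z.2)).
Proof.
move=> cg bg; apply: (bmfun_comp (bmfun_continuous cg bg)
  (h := fun z : measurableTypeR R * measurableTypeR R => x + s * z.1 + r * z.2 : measurableTypeR R)).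
apply: measurable_funD; first apply: measurable_funD => //.
  by apply: measurable_funM => //; exact: measurable_fst.
by apply: measurable_funM => //; exact: measurable_snd.
Qed.

Lemma gaussian_semigroup g (s r x : R) : continuous g ->
  (exists M, forall x, `|g x| <= M) -> 0 <= s -> 0 <= r ->
  gsmooth s (gsmooth r g) x = gsmooth (Num.sqrt (s ^+ 2 + r ^+ 2)) g x.
Proof.
move=> cg bg s0; rewrite le_eqVlt => /predU1P[<-|r0].
  rewrite expr0n addr0 sqrtr_sqr ger0_norm// /gsmooth; apply: eq_Rintegral => y _.
  under eq_Rintegral do rewrite mul0r addr0.
  exact: integral_cst_prob.
have [M gM] := bg.
(* Adding the bound [M] makes the function nonnegative; the constant is cancelled at the end. *)
pose h y := g (x + y) + M.
have ch : continuous h.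
  move=> y; apply: cvgD; last exact: cvg_cst.
  apply: (cvg_comp (fun y => x + y) g); last exact: cg.
  by apply: cvgD; [exact: cvg_cst|exact: cvg_id].
have h0 y : 0 <= h y by have := gM (x + y); rewrite ler_norml /h; lra.
have bh : exists M, forall x, `|h x| <= M.
  exists (M + `|M|) => y; apply: le_trans (ler_normD _ _) _; by rewrite lerD2r.
have phi0 y : 0 <= phi y by exact: normal_pdf_ge0.
have key : \int[gamma]_u \int[gamma]_v h (s * u + r * v) =
    \int[gamma]_w h (Num.sqrt (s ^+ 2 + r ^+ 2) * w).
  have b2 : bmfun (fun z : measurableTypeR R * measurableTypeR R => h (s * z.1 + r * z.2)).
    by have := bmfun_affine2 0 s r ch bh; congr bmfun; apply/funext => z; rewrite add0r.
  rewrite Rintegral_gamma; last exact: (bmfun_int2 gamma gamma b2).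
  rewrite Rintegral_gamma; last first.
    have := bmfun_affine 0 (Num.sqrt (s ^+ 2 + r ^+ 2)) ch bh.
    by congr bmfun; apply/funext => w; rewrite add0r.
  rewrite /Rintegral -(gaussian_semigroup_ge0 s ch h0 r0); congr fine.
  apply: eq_integral => u _.
  have bu : bmfun (fun v : measurableTypeR R => h (s * u + r * v)).
    exact: bmfun_affine.
  under [RHS]eq_integral do rewrite EFinM.
  have iu := bmfun_integrable gamma bu.
  have mhphi : measurable_fun setT (fun v => (h (s * u + r * v) * phi v)%:E).
    apply/measurable_EFinP; apply: measurable_funM; last exact: measurable_normal_pdf.
    by case: bu.
  rewrite ge0_integralZl//; last 2 first.
  - by move=> v _; rewrite lee_fin mulr_ge0.
  - by rewrite lee_fin.
  rewrite -integral_gamma// muleC -[in RHS](@fineK _ (\int[_]_ _ _)%E) ?EFinM//.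
  exact: integrable_fin_num.
have hE u : \int[gamma]_v h (s * u + r * v) = gsmooth r g (x + s * u) + M.
  rewrite (@bmfun_intD _ _ _ gamma (fun v => g (x + (s * u + r * v))) (fun=> M)).
  - by rewrite integral_cst_prob; congr (_ + _); apply: eq_Rintegral => v _; rewrite addrA.
  - have := bmfun_affine (x + s * u) r cg bg.
    by congr bmfun; apply/funext => v; rewrite addrA.
  - exact: bmfun_cst.
move: key; under eq_Rintegral do rewrite hE.
rewrite (@bmfun_intD _ _ _ gamma (fun u => gsmooth r g (x + s * u)) (fun=> M)); last 2 first.
- exact: (bmfun_int2 gamma gamma (bmfun_affine2 x s r cg bg)).
- exact: bmfun_cst.
rewrite (@bmfun_intD _ _ _ gamma (fun w => g (x + Num.sqrt (s ^+ 2 + r ^+ 2) * w)) (fun=> M)).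
- by move=> /addIr.
- exact: bmfun_affine.
- exact: bmfun_cst.
Qed.

Let C0 := normal_peak 1 / normal_peak (Num.sqrt 2) : R.

Let C0_ge0 : 0 <= C0.
Proof. by rewrite divr_ge0// normal_peak_ge0. Qed.

(** Half of the Gaussian exponent, [y ^+ 2 / 4], absorbs the polynomial because [1 + y ^+ 2 / 8] is
    at most [expR (y ^+ 2 / 8)]; the other half is the Gaussian of variance 2. Moments up to order
    four become integrable at once. *)
Lemma phi_tail y : (1 + y ^+ 2 / 8) ^+ 2 * phi y <= C0 * normal_pdf 0 (Num.sqrt 2) y.
Proof.
rewrite phiE normal_pdfE// /normal_fun subr0 sqr_sqrtr//.
have -> : C0 * (normal_peak (Num.sqrt 2) * expR (- y ^+ 2 / (2 *+ 2))) =
    normal_peak 1 * expR (- y ^+ 2 / (2 *+ 2)).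
  by rewrite /C0 mulrA divfK// gt_eqF// normal_peak_gt0.
rewrite mulrCA ler_wpM2l ?normal_peak_ge0//.
have -> : expR (- y ^+ 2 / 2) = expR (- y ^+ 2 / (2 *+ 2)) * expR (- (y ^+ 2 / 4)).
  by rewrite -expRD; congr expR; field.
rewrite mulrCA ler_piMr ?expR_ge0//.
have y2 : 0 <= y ^+ 2 by exact: sqr_ge0.
rewrite expRN ler_pdivrMr ?expR_gt0// mul1r.
have -> : expR (y ^+ 2 / 4) = expR (y ^+ 2 / 8) ^+ 2.
  by rewrite [RHS]expr2 -expRD; congr expR; field.
rewrite lerXn2r ?nnegrE ?expR_ge0 ?expR_ge1Dx//; lra.
Qed.

Lemma integrable_phi h (C : R) : measurable_fun setT (h : R -> R) -> 0 <= C ->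
  (forall y, `|h y| <= C * (1 + y ^+ 2 / 8) ^+ 2) ->
  mu.-integrable setT (fun y => (h y * phi y)%:E).
Proof.
move=> mh C_ge0 hC.
apply: (@le_integrable _ _ _ mu setT _ _ (fun y => (C * C0)%:E * (normal_pdf 0 (Num.sqrt 2) y)%:E)%E).
- exact: measurableT.
- apply/measurable_EFinP; apply: measurable_funM => //; exact: measurable_normal_pdf.
- move=> y _; rewrite -EFinM lee_fin.
  have -> : `|h y * phi y| = `|h y| * phi y by rewrite normrM (ger0_norm (normal_pdf_ge0 _ _ _)).
  rewrite [leRHS]ger0_norm; last first.
    by apply: mulr_ge0; [exact: mulr_ge0|exact: normal_pdf_ge0].
  rewrite -mulrA; apply: le_trans (ler_wpM2l C_ge0 (phi_tail y)).
  by rewrite mulrA ler_wpM2r ?normal_pdf_ge0.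
- by apply: integrableZl => //; exact: integrable_normal_pdf.
Qed.

Lemma integrable_cM (c : R) (h : R -> R) : mu.-integrable setT (EFin \o h) ->
  mu.-integrable setT (EFin \o (fun y => c * h y)).
Proof.
move=> ih; have := integrableZl measurableT c ih.
by apply: eq_integrable => // y _ /=; rewrite EFinM.
Qed.

Lemma integrable_sub (h k : R -> R) : mu.-integrable setT (EFin \o h) ->
  mu.-integrable setT (EFin \o k) -> mu.-integrable setT (EFin \o (fun y => h y - k y)).
Proof.
move=> ih ik; have := integrableB measurableT ih ik.
by apply: eq_integrable => // y _ /=; rewrite EFinB.
Qed.

Lemma integrable_phi_norm3 : mu.-integrable setT (fun y : R => (`|y| ^+ 3 * phi y)%:E).
Proof.
(* With the constant 64 the dominating polynomial is [64 + 16 * y ^+ 2 + y ^+ 4]. *)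
apply: (@integrable_phi _ 64) => //.
  by apply: measurable_funX.
move=> y; rewrite ger0_norm ?exprn_ge0//.
have -> : y ^+ 2 = `|y| ^+ 2 by rewrite real_normK ?num_real.
have := normr_ge0 y; set a := `|y| => a0.
have -> : 64 * (1 + a ^+ 2 / 8) ^+ 2 = 64 + 16 * a ^+ 2 + (a ^+ 2) ^+ 2 by field.
have -> : a ^+ 3 = a * a ^+ 2 by ring.
have := sqr_ge0 a; set b := a ^+ 2 => b0.
have : 0 <= a ^+ 2 * (a / 2 - 1) ^+ 2 by rewrite mulr_ge0// sqr_ge0.
have -> : a ^+ 2 * (a / 2 - 1) ^+ 2 = b ^+ 2 / 4 - a * b + b by rewrite /b; field.
have := sqr_ge0 b; lra.
Qed.

Lemma integrable_phi_id : mu.-integrable setT (fun y : R => (y * phi y)%:E).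
Proof.
apply: (@integrable_phi id 64) => // y.
have -> : y ^+ 2 = `|y| ^+ 2 by rewrite real_normK ?num_real.
have := normr_ge0 y; set a := `|y| => a0.
have := sqr_ge0 (a - 1); have := sqr_ge0 (a ^+ 2); have := sqr_ge0 a.
have -> : 64 * (1 + a ^+ 2 / 8) ^+ 2 = 64 + 16 * a ^+ 2 + (a ^+ 2) ^+ 2 by field.
by rewrite sqrrB; lra.
Qed.

Lemma integrable_phi_sqr : mu.-integrable setT (fun y : R => (y ^+ 2 * phi y)%:E).
Proof.
apply: (@integrable_phi _ 64) => // y.
rewrite ger0_norm ?sqr_ge0//; have := sqr_ge0 y; have := sqr_ge0 (y ^+ 2).
have -> : 64 * (1 + y ^+ 2 / 8) ^+ 2 = 64 + 16 * y ^+ 2 + (y ^+ 2) ^+ 2 by field.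
lra.
Qed.

Lemma Rintegral_mu_oppr (h : R -> R) : mu.-integrable setT (EFin \o h) ->
  \int[mu]_x h (- x) = \int[mu]_x h x.
Proof.
move=> ih.
have mN : measurable_fun setT (-%R : measurableTypeR R -> measurableTypeR R) by [].
have iN : mu.-integrable setT (EFin \o (h \o -%R)).
  have /integrableP[mh fh] := ih; apply/integrableP; split.
    by apply: (measurableT_comp mh).
  have := @ge0_integral_pushforward _ _ _ _ R _ mN mu setT (fun y => `|(h y)%:E|)%E.
  rewrite preimage_setT => <- //.
  - rewrite (eq_measure_integral mu)// => A mA _; exact: lebesgue_measureN.
  - exact: measurableT_comp.
congr fine.
have := @integral_pushforward _ _ _ _ R _ mN mu setT (EFin \o h).
rewrite preimage_setT => <- //.
- by apply: eq_measure_integral => A mA _; exact: lebesgue_measureN.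
- by case/integrableP : ih.
Qed.

Lemma gauss_mean : \int[mu]_y (y * phi y) = 0.
Proof.
have := Rintegral_mu_oppr integrable_phi_id.
under eq_Rintegral do rewrite phiN mulNr -mulN1r.
rewrite RintegralZl//; last exact: integrable_phi_id.
by rewrite mulN1r => e; lra.
Qed.

Lemma gauss_mass : \int[mu]_y phi y = 1.
Proof. by rewrite /Rintegral integral_normal_pdf. Qed.

(** An antiderivative of [(y ^+ 2 - 1) * phi y] that vanishes at 0 and at infinity; it identifies
    the second moment with the total mass. *)
Let G (y : R) := - (y * phi y).

Let is_derive_G (y : R) : is_derive y 1 G ((y ^+ 2 - 1) * phi y).
Proof.
have d1 : is_derive y 1 (fun x : R => - x ^+ 2 / 2) (- y).
  have := is_deriveZ (- 2^-1) (is_deriveX 2 (is_derive_id y 1)).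
  rewrite (_ : (fun x => _) = (- 2^-1) \*: (id : R -> R) ^+ 2).
    by congr is_derive; rewrite /GRing.scale /= expr1 mulr1; field.
  by apply/funext => x; change (- x ^+ 2 / 2 = - 2^-1 * (x * x)); ring.
have d2 := @is_derive1_comp _ expR _ y _ _ (is_derive_expR (- y ^+ 2 / 2)) d1.
have d3 := is_deriveZ (- normal_peak 1) (is_deriveM (is_derive_id y 1) d2).
rewrite (_ : G = (- normal_peak 1) \*: (id * (expR \o (fun x : R => - x ^+ 2 / 2)))).
  move: d3; congr is_derive; rewrite phiE /GRing.scale /= mulr1; ring.
apply/funext => x; rewrite /G phiE.
change (- (x * (normal_peak 1 * expR (- x ^+ 2 / 2))) =
  - normal_peak 1 * (x * expR (- x ^+ 2 / 2))); ring.
Qed.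

Let cG : continuous G. Proof. exact: is_derive_continuous is_derive_G. Qed.

Let cG' : continuous (fun y : R => (y ^+ 2 - 1) * phi y).
Proof.
move=> y; apply: cvgM; last by apply: continuous_normal_pdf; exact: oner_neq0.
by apply: cvgB; [exact: exprn_continuous|exact: cvg_cst].
Qed.

Let G_cvg : G x @[x --> +oo] --> (0 : R).
Proof.
pose C1 := C0 * normal_peak (Num.sqrt 2).
have C1_ge0 : 0 <= C1 by rewrite mulr_ge0// normal_peak_ge0.
apply/cvgrPdist_le => e e0; near=> y.
have y1 : 1 <= y by near: y; apply: nbhs_pinfty_ge; exact: num_real.
have ye : 8 * C1 <= e * y.
  have : 8 * C1 / e <= y by near: y; apply: nbhs_pinfty_ge; exact: num_real.
  by rewrite ler_pdivrMr// [e * y]mulrC.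
have p0 : 0 <= phi y by exact: normal_pdf_ge0.
have y0 : 0 < y by lra.
rewrite sub0r /G opprK ger0_norm; last by apply: mulr_ge0 => //; exact: ltW.
have : y ^+ 2 * phi y <= 8 * C1.
  have h1 : (1 + y ^+ 2 / 8) ^+ 2 * phi y <= C1.
    apply: le_trans (phi_tail y) _; rewrite /C1 ler_wpM2l//.
    exact: normal_pdf_ub.
  have h2 : y ^+ 2 <= 8 * (1 + y ^+ 2 / 8) ^+ 2.
    have := sqr_ge0 (y ^+ 2); have := sqr_ge0 y.
    have -> : 8 * (1 + y ^+ 2 / 8) ^+ 2 = 8 + 2 * y ^+ 2 + (y ^+ 2) ^+ 2 / 8 by field.
    lra.
  apply: le_trans (ler_wpM2r p0 h2) _; rewrite -mulrA ler_pM2l//.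
rewrite expr2 -mulrA => h; rewrite -(ler_pM2l y0).
by apply: le_trans h _; rewrite [y * e]mulrC.
Unshelve. all: by end_near. Qed.

Let integrable_G' (D : set R) : measurable D ->
  mu.-integrable D (EFin \o (fun y : R => (y ^+ 2 - 1) * phi y)).
Proof.
move=> mD; apply: (integrableS measurableT) => //.
have := integrableB measurableT integrable_phi_sqr (integrable_normal_pdf 0 1).
by apply: eq_integrable => // y _; rewrite /= mulrBl mul1r EFinB.
Qed.

Let half_variance : \int[mu]_(y in `[0, +oo[) ((y ^+ 2 - 1) * phi y) = 0.
Proof.
(* The half-line is split at 1, where the integrand changes sign, because the improper fundamental
   theorem is applied to a nonnegative integrand. *)
have i01 : \int[mu]_(y in `[0, 1]) ((y ^+ 2 - 1) * phi y) = G 1 - G 0.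
  rewrite /Rintegral (@continuous_FTC2 _ _ G)//.
  - exact: continuous_subspaceT.
  - split.
    + by move=> x _; have [] := is_derive_G x.
    + by apply: cvg_at_right_filter; exact: cG.
    + by apply: cvg_at_left_filter; exact: cG.
  - by move=> x _; rewrite derive1E; have [] := is_derive_G x.
have i1y : \int[mu]_(y in `[1, +oo[) ((y ^+ 2 - 1) * phi y) = 0 - G 1.
  apply: Rintegral_ge0_continuous_FTC2y => //.
  - move=> x x1; rewrite mulr_ge0 ?normal_pdf_ge0// subr_ge0.
    by rewrite expr_ge1//; lra.
  - exact: continuous_subspaceT.
  - by move=> x _; have [] := is_derive_G x.
  - by apply: cvg_at_right_filter; exact: cG.
  - by move=> x _; rewrite derive1E; have [] := is_derive_G x.
have := @Rintegral_itvB _ (fun y : R => (y ^+ 2 - 1) * phi y) (BLeft 0) +oo%O 1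
  (integrable_G' (measurable_itv _)).
rewrite Rintegral_itv_obnd_cbnd ?i1y ?i01; last exact: integrable_G'.
rewrite [in X in _ -> _ -> X]/G mul0r oppr0 subr0 sub0r => h.
have b1 : (BLeft 0 <= BRight 1 :> itv_bound R)%O by rewrite bnd_simp.
have b2 : (BRight 1 <= +oo :> itv_bound R)%O by rewrite bnd_simp.
by have := h b1 b2; lra.
Qed.

Lemma gauss_variance : \int[mu]_y (y ^+ 2 * phi y) = 1.
Proof.
have cphi : continuous phi by apply: continuous_normal_pdf; exact: oner_neq0.
have itvE : [set x : R | (0 <= x)%R] = `[0, +oo[%classic.
  by apply/seteqP; split => x /=; rewrite in_itv/= andbT.
have fold (h : R -> R) : (forall x, 0 <= h x) -> continuous h -> h =1 h \o -%R ->
    mu.-integrable setT (EFin \o h) ->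
    \int[mu]_y h y = 2 * \int[mu]_(y in `[0, +oo[) h y.
  move=> h0 ch eh ih; rewrite /Rintegral ge0_symfun_integralT// itvE fineM//.
  apply: integrable_fin_num => //; exact: integrableS ih.
have cs : continuous (fun y : R => y ^+ 2 * phi y).
  by move=> y; apply: cvgM; [exact: exprn_continuous|exact: cphi].
have p0 x : 0 <= phi x by exact: normal_pdf_ge0.
have E1 : \int[mu]_y (y ^+ 2 * phi y) = 2 * \int[mu]_(y in `[0, +oo[) (y ^+ 2 * phi y).
  apply: fold => //; last exact: integrable_phi_sqr.
    by move=> x; rewrite mulr_ge0 ?sqr_ge0.
  by move=> x /=; rewrite sqrrN phiN.
have E2 : \int[mu]_y phi y = 2 * \int[mu]_(y in `[0, +oo[) phi y.
  apply: fold => //; last exact: integrable_normal_pdf.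
  by move=> x /=; rewrite phiN.
rewrite E1 -[RHS]gauss_mass E2; congr (_ * _); apply/eqP; rewrite -subr_eq0; apply/eqP.
rewrite -RintegralB//.
- by rewrite -[RHS]half_variance; apply: eq_Rintegral => y _; rewrite mulrBl mul1r.
- by apply: (integrableS measurableT) => //; exact: integrable_phi_sqr.
- by apply: (integrableS measurableT) => //; exact: integrable_normal_pdf.
Qed.

Definition gauss_m3 : R := \int[mu]_y (`|y| ^+ 3 * phi y).

Lemma gauss_m3_ge0 : 0 <= gauss_m3.
Proof. by apply: Rintegral_ge0 => y _; rewrite mulr_ge0 ?exprn_ge0 ?normal_pdf_ge0. Qed.

(** Under the Gaussian mean the linear term vanishes and the quadratic one contributes [s ^+ 2];
    only the remainder is left, with the third absolute moment. *)
Lemma gsmooth_taylor g (g1 g2 : R -> R) (K s x : R) : continuous g ->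
  (exists M, forall x, `|g x| <= M) -> 0 <= s ->
  (forall x y, `|g (x + y) - g x - g1 x * y - 2^-1 * g2 x * y ^+ 2| <= K * `|y| ^+ 3) ->
  `|gsmooth s g x - g x - 2^-1 * g2 x * s ^+ 2| <= K * gauss_m3 * s ^+ 3.
Proof.
move=> cg bg s0 gT.
pose r y := g (x + s * y) - g x - g1 x * (s * y) - 2^-1 * g2 x * (s * y) ^+ 2.
have i0 : mu.-integrable setT (EFin \o (fun y => g (x + s * y) * phi y)).
  have [mg [M gM]] := bmfun_affine x s cg bg.
  apply: (@integrable_phi _ `|M|) => // y.
  apply: le_trans (gM y) _; apply: le_trans (ler_norm _) _.
  by rewrite ler_peMr// exprn_ege1// lerDl divr_ge0// sqr_ge0.
have i1 c : mu.-integrable setT (EFin \o (fun y => c * phi y)).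
  by apply: integrable_cM; exact: integrable_normal_pdf.
have i2 c : mu.-integrable setT (EFin \o (fun y => c * (y * phi y))).
  by apply: integrable_cM; exact: integrable_phi_id.
have i3 c : mu.-integrable setT (EFin \o (fun y => c * (y ^+ 2 * phi y))).
  by apply: integrable_cM; exact: integrable_phi_sqr.
have i4 c : mu.-integrable setT (EFin \o (fun y => c * (`|y| ^+ 3 * phi y))).
  by apply: integrable_cM; exact: integrable_phi_norm3.
have i01 : mu.-integrable setT (EFin \o (fun y => g (x + s * y) * phi y - g x * phi y)).
  exact: integrable_sub.
have i012 : mu.-integrable setT
    (EFin \o (fun y => g (x + s * y) * phi y - g x * phi y - (g1 x * s) * (y * phi y))).
  exact: integrable_sub.
have -> : gsmooth s g x - g x - 2^-1 * g2 x * s ^+ 2 =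
    \int[mu]_y (g (x + s * y) * phi y - g x * phi y - (g1 x * s) * (y * phi y)
     - (2^-1 * g2 x * s ^+ 2) * (y ^+ 2 * phi y)).
  rewrite !RintegralB// !RintegralZl ?gauss_mean ?gauss_variance ?gauss_mass//.
  - by rewrite -Rintegral_gamma -/(gsmooth s g x) ?mulr0 ?subr0 ?mulr1//; exact: bmfun_affine.
  - exact: integrable_phi_sqr.
  - exact: integrable_phi_id.
  - exact: integrable_normal_pdf.
apply: le_trans (le_normr_Rintegral _ _) _ => //; first exact: integrable_sub.
have -> : K * gauss_m3 * s ^+ 3 = \int[mu]_y (K * s ^+ 3 * (`|y| ^+ 3 * phi y)).
  by rewrite RintegralZl ?/gauss_m3//; [ring|exact: integrable_phi_norm3].
apply: le_Rintegral => //; first by apply/integrable_norm/integrable_sub.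
move=> y _; have p0 : 0 <= phi y by exact: normal_pdf_ge0.
have -> : g (x + s * y) * phi y - g x * phi y - (g1 x * s) * (y * phi y)
     - (2^-1 * g2 x * s ^+ 2) * (y ^+ 2 * phi y) = r y * phi y by rewrite /r; ring.
rewrite normrM (ger0_norm p0) mulrA ler_wpM2r//.
by apply: le_trans (gT x (s * y)) _; rewrite normrM (ger0_norm s0) exprMn mulrA.
Qed.

Lemma gsmooth_lipschitz g (K s r x : R) : continuous g ->
  (exists M, forall x, `|g x| <= M) -> 0 <= K ->
  (forall x y, `|g x - g y| <= K * `|x - y|) ->
  `|gsmooth s g x - gsmooth r g x| <= K * `|s - r| * (1 + gauss_m3).
Proof.
move=> cg bg K0 gL.
have b1 := bmfun_affine x s cg bg; have b2 := bmfun_affine x r cg bg.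
rewrite /gsmooth -bmfun_intB//.
apply: le_trans (bmfun_int_norm _ (bmfunB b1 b2)) _.
rewrite Rintegral_gamma; last exact: bmfun_norm (bmfunB b1 b2).
have i4 c : mu.-integrable setT (EFin \o (fun y => c * (`|y| ^+ 3 * phi y))).
  by apply: integrable_cM; exact: integrable_phi_norm3.
have i1 c : mu.-integrable setT (EFin \o (fun y => c * phi y)).
  by apply: integrable_cM; exact: integrable_normal_pdf.
have -> : K * `|s - r| * (1 + gauss_m3) = \int[mu]_y (K * `|s - r| * phi y +
    K * `|s - r| * (`|y| ^+ 3 * phi y)).
  rewrite RintegralD// !RintegralZl ?gauss_mass//; first by rewrite mulrDr.
    exact: integrable_phi_norm3.
  exact: integrable_normal_pdf.
have [mn [M nM]] := bmfun_norm (bmfunB b1 b2).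
apply: le_Rintegral => //.
- apply: (@integrable_phi _ `|M|) => // y.
  apply: le_trans (nM y) _; apply: le_trans (ler_norm _) _.
  by rewrite ler_peMr// exprn_ege1// lerDl divr_ge0// sqr_ge0.
- have := integrableD measurableT (i1 (K * `|s - r|)) (i4 (K * `|s - r|)).
  by apply: eq_integrable => // y _ /=; rewrite EFinD.
move=> y _; have p0 : 0 <= phi y by exact: normal_pdf_ge0.
rewrite [leRHS](_ : _ = K * `|s - r| * (1 + `|y| ^+ 3) * phi y); last ring.
rewrite ler_wpM2r//; apply: le_trans (gL _ _) _.
rewrite (_ : x + s * y - (x + r * y) = (s - r) * y); last ring.
rewrite normrM mulrA ler_wpM2l ?mulr_ge0//.
(* Bounding [a] by [1 + a ^+ 3] lets the third moment stand in for the first. *)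
have := normr_ge0 y; set a := `|y| => a0.
have a3 : 0 <= a ^+ 3 by exact: exprn_ge0.
have [a1|/ltW a1] := leP a 1; first by lra.
have : a ^+ 1 <= a ^+ 3 by rewrite ler_weXn2l.
by rewrite expr1; lra.
Qed.

(** The quadratic weight left by [smoothing] costs only a second moment. *)
Lemma gsmooth_close f g (e s : R) : continuous f -> (exists M, forall x, `|f x| <= M) ->
  continuous g -> (exists M, forall x, `|g x| <= M) ->
  (forall x, `|f x - g x| <= e * (1 + x ^+ 2)) ->
  `|gsmooth s f 0 - gsmooth s g 0| <= e * (1 + s ^+ 2).
Proof.
move=> cf bf cg bg fg.
have b1 := bmfun_affine 0 s cf bf; have b2 := bmfun_affine 0 s cg bg.
rewrite /gsmooth -bmfun_intB//.
apply: le_trans (bmfun_int_norm _ (bmfunB b1 b2)) _.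
rewrite Rintegral_gamma; last exact: bmfun_norm (bmfunB b1 b2).
have i3 c : mu.-integrable setT (EFin \o (fun y => c * (y ^+ 2 * phi y))).
  by apply: integrable_cM; exact: integrable_phi_sqr.
have i1 c : mu.-integrable setT (EFin \o (fun y => c * phi y)).
  by apply: integrable_cM; exact: integrable_normal_pdf.
have -> : e * (1 + s ^+ 2) = \int[mu]_y (e * phi y + e * s ^+ 2 * (y ^+ 2 * phi y)).
  rewrite RintegralD// !RintegralZl ?gauss_mass ?gauss_variance//; first by ring.
    exact: integrable_phi_sqr.
  exact: integrable_normal_pdf.
have [mn [M nM]] := bmfun_norm (bmfunB b1 b2).
apply: le_Rintegral => //.
- apply: (@integrable_phi _ `|M|) => // y.
  apply: le_trans (nM y) _; apply: le_trans (ler_norm _) _.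
  by rewrite ler_peMr// exprn_ege1// lerDl divr_ge0// sqr_ge0.
- have := integrableD measurableT (i1 e) (i3 (e * s ^+ 2)).
  by apply: eq_integrable => // y _ /=; rewrite EFinD.
move=> y _; have p0 : 0 <= phi y by exact: normal_pdf_ge0.
rewrite [leRHS](_ : _ = e * (1 + (s * y) ^+ 2) * phi y); last ring.
by rewrite ler_wpM2r//; apply: le_trans (fg _) _; rewrite add0r.
Qed.

End Gaussian.

(** * Lindeberg's method *)

Lemma bmfun_post (R : realType) dd (T : measurableType dd) (u : T -> R) (g : R -> R) :
  continuous g -> (exists M, forall x, `|g x| <= M) -> measurable_fun setT u -> bmfun (fun x => g (u x)).
Proof.
move=> cg [M gM] mu; split; last by exists M.
by apply: (measurableT_comp _ mu); exact: continuous_measurable_fun.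
Qed.

Section Lindeberg.
Context {R : realType} {d : nat}.
Notation Om := (Omega R d).
Variable P : probability Om R.
Hypothesis prodP : product_measure P.
Notation PP := (P \x P)%E.
Notation gamma := (@normal_prob R 0 1).
Variables (I : eqType) (S : I -> pred (cube d)) (F : I -> Om -> R).
Hypothesis bF : forall i, bmfun (F i).
Hypothesis depF : forall i, depends_on (S i) (F i).
Hypothesis disjS : forall i j Q, S i Q -> S j Q -> i = j.

(** The sets [S] are disjoint, so resampling on [S i] moves the [i]-th term alone to the second
    copy; independence of the terms is then visible as a product. *)
Let sum_mix i l (p : Om * Om) : i \notin l ->
  F i (mix (S i) p.2 p.1) = F i p.2 /\
  \sum_(j <- l) F j (mix (S i) p.2 p.1) = \sum_(j <- l) F j p.1.
Proof.
move=> il; split; first by apply: depF => Q SQ; rewrite /mix SQ.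
rewrite big_seq [RHS]big_seq; apply: eq_bigr => j jl; apply: depF => Q SQ.
rewrite /mix; case: ifP => // iQ; move: il.
by rewrite (disjS iQ SQ) jl.
Qed.

Lemma variance_sum l : uniq l -> (forall i, \int[P]_w F i w = 0) ->
  \int[P]_w (\sum_(i <- l) F i w) ^+ 2 = \sum_(i <- l) \int[P]_w F i w ^+ 2.
Proof.
move=> + F0; elim: l => [_|i l ih /= /andP[il ul]].
  by rewrite big_nil; under eq_Rintegral do rewrite big_nil expr0n; rewrite integral_cst_prob.
have bS : bmfun (fun w => \sum_(j <- l) F j w) by exact: bmfun_sum.
have bfull : bmfun (fun w => (\sum_(j <- i :: l) F j w) ^+ 2) by apply/bmfunX/bmfun_sum.
rewrite -(int_mix prodP (S i) bfull).
(* The factor 1 puts the last term in the product form that [int_prod_indep] integrates. *)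
have -> : \int[PP]_z (\sum_(j <- i :: l) F j (mix (S i) z.2 z.1)) ^+ 2 =
    \int[PP]_z ((\sum_(j <- l) F j z.1) ^+ 2 + 2 * ((\sum_(j <- l) F j z.1) * F i z.2) + 1 * F i z.2 ^+ 2).
  apply: eq_Rintegral => z _; rewrite big_cons; have [-> ->] := sum_mix z il; ring.
have bS1 : bmfun (fun z : Om * Om => \sum_(j <- l) F j z.1).
  by apply: (bmfun_comp bS); exact: measurable_fst.
have bF2 : bmfun (fun z : Om * Om => F i z.2) by apply: (bmfun_comp (bF i)); exact: measurable_snd.
rewrite bmfun_intD; last 2 first.
- by apply: bmfunD; [exact: bmfunX|apply: bmfunM; [exact: bmfun_cst|exact: bmfunM]].
- by apply: bmfunM; [exact: bmfun_cst|exact: bmfunX].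
rewrite bmfun_intD; last 2 first.
- exact: bmfunX.
- by apply: bmfunM; [exact: bmfun_cst|exact: bmfunM].
rewrite bmfun_intZl; last exact: bmfunM.
rewrite (int_prod_indep P bS (bF i)) F0 mulr0 mulr0 addr0.
rewrite (int_fst P (f := fun w => (\sum_(j <- l) F j w) ^+ 2)); last exact: bmfunX.
rewrite (int_prod_indep P (bmfun_cst 1) (bmfunX 2 (bF i))) integral_cst_prob mul1r.
by rewrite ih// big_cons addrC.
Qed.

Variables (g : R -> R) (s delta : R).
Hypotheses (cg : continuous g) (bg : exists M, forall x, `|g x| <= M).
Hypotheses (s0 : 0 <= s).
Hypothesis close : forall i z, `|\int[P]_w g (z + F i w) - gsmooth s g z| <= delta.

(** Induction with the starting point [x] free. The induction hypothesis replaces the tail at the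
    point shifted by the [i]-th term, Fubini brings that term inside the Gaussian mean, where
    [close] replaces it, and the semigroup law merges the two Gaussians; each term costs [delta]. *)
Lemma lindeberg l x : uniq l ->
  `|\int[P]_w g (x + \sum_(i <- l) F i w) - gsmooth (s * Num.sqrt (size l)%:R) g x|
  <= (size l)%:R * delta.
Proof.
elim: l x => [x _|i l ih x /= /andP[il ul]].
  under eq_Rintegral do rewrite big_nil addr0.
  rewrite sqrtr0 mulr0 mul0r /gsmooth.
  under [X in _ - X]eq_Rintegral do rewrite mul0r addr0.
  by rewrite !integral_cst_prob subrr normr0.
set N := size l.
have bS l' : bmfun (fun w => \sum_(j <- l') F j w) by exact: bmfun_sum.
have bsum u l' : bmfun (fun w => g (u + \sum_(j <- l') F j w)).
  by apply: bmfun_post => //; apply: measurable_funD => //; case: (bS l').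
pose r := s * Num.sqrt N%:R.
have r0 : 0 <= r by rewrite mulr_ge0 ?sqrtr_ge0.
have bpair : bmfun (fun z : Om * Om => g ((x + F i z.2) + \sum_(j <- l) F j z.1)).
  apply: bmfun_post => //; apply: measurable_funD; first apply: measurable_funD => //.
    by apply: (measurableT_comp (bF i).1); exact: measurable_snd.
  by apply: (measurableT_comp (bS l).1); exact: measurable_fst.
have -> : \int[P]_w g (x + \sum_(j <- i :: l) F j w) =
    \int[P]_w' \int[P]_w g ((x + F i w') + \sum_(j <- l) F j w).
  rewrite -(int_mix prodP (S i) (bsum x (i :: l))) (int_prod21 P P bpair).
  apply: eq_Rintegral => z _; rewrite big_cons; have [-> ->] := sum_mix z il.
  by rewrite addrA.
have b1 := bmfun_int1 P P bpair.
have bgam : bmfun (fun z : Om * measurableTypeR R => g (x + F i z.1 + r * z.2)).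
  apply: bmfun_post => //; apply: measurable_funD; first apply: measurable_funD => //.
    by apply: (measurableT_comp (bF i).1); exact: measurable_fst.
  by apply: measurable_funM => //; exact: measurable_snd.
have b2 : bmfun (fun w' => gsmooth r g (x + F i w')) by exact: (bmfun_int2 P gamma bgam).
have fub : \int[P]_w' gsmooth r g (x + F i w') =
    \int[gamma]_y \int[P]_w' g ((x + r * y) + F i w').
  rewrite /gsmooth (int_prod12 P gamma bgam) -(int_prod21 P gamma bgam).
  by apply: eq_Rintegral => y _; apply: eq_Rintegral => w _; rewrite addrAC.
have b3 : bmfun (fun y : measurableTypeR R => \int[P]_w' g ((x + r * y) + F i w')).
  have := bmfun_int1 P gamma bgam; congr bmfun; apply/funext => y.
  by apply: eq_Rintegral => w _; rewrite addrAC.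
have b4 : bmfun (fun y : measurableTypeR R => gsmooth s g (x + r * y)).
  exact: (bmfun_int2 gamma gamma (bmfun_affine2 x r s cg bg)).
have -> : s * Num.sqrt N.+1%:R = Num.sqrt (r ^+ 2 + s ^+ 2).
  rewrite /r exprMn sqr_sqrtr ?ler0n// -[X in _ + X]mulr1 -mulrDr -natr1.
  by rewrite sqrtrM ?sqr_ge0// sqrtr_sqr ger0_norm.
rewrite -gaussian_semigroup// {1}/gsmooth.
rewrite (_ : \int[P]_w' _ - _ = (\int[P]_w' \int[P]_w g ((x + F i w') + \sum_(j <- l) F j w)
   - \int[P]_w' gsmooth r g (x + F i w')) + (\int[P]_w' gsmooth r g (x + F i w')
   - \int[gamma]_y gsmooth s g (x + r * y))); last ring.
apply: le_trans (ler_normD _ _) _; rewrite -natr1 mulrDl mul1r lerD//.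
  rewrite -bmfun_intB//; apply: bmfun_int_norm_le; first exact: bmfunB.
  by move=> w'; exact: ih.
rewrite fub -bmfun_intB//; apply: bmfun_int_norm_le; first exact: bmfunB.
by move=> y; exact: close.
Qed.

End Lindeberg.

(** * Replacing one small centred term by a Gaussian *)

Section ThirdOrder.
Context {R : realType} {dd} {T : measurableType dd} (P : probability T R).

(* Both expectations agree with [g z + g'' z s^2 / 2] up to third-order terms. *)
Lemma smooth3_close (g : R -> R) : smooth3 g -> exists2 K, 0 <= K &
  forall (X : T -> R) (b s z : R), bmfun X -> \int[P]_w X w = 0 ->
    0 <= s -> \int[P]_w X w ^+ 2 = s ^+ 2 -> (forall w, `|X w| <= b) ->
    `|\int[P]_w g (z + X w) - gsmooth s g z| <= K * b ^+ 3.
Proof.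
move=> sg; have cg := smooth3_continuous sg; have bg := smooth3_bounded sg.
have [g1 [g2 [K K0 [_ _ _ _ gT]]]] := smooth3_taylor sg.
exists (K + K * gauss_m3); first by rewrite addr_ge0// mulr_ge0// gauss_m3_ge0.
move=> X b s z bX X0 s0 X2 Xb.
have b0 : 0 <= b by have := Xb point; apply: le_trans.
(* The deviation is at most the sup bound, so both remainders are of order [b ^+ 3]. *)
have sb : s <= b.
  rewrite -(ler_pXn2r (n := 2))// -X2; apply: bmfun_int_le_cst; first exact: bmfunX.
  by move=> w; rewrite -[X w ^+ 2]real_normK ?num_real// lerXn2r// nnegrE.
have bgX : bmfun (fun w => g (z + X w)).
  by apply: bmfun_post => //; apply: measurable_funD => //; case: bX.
have e1 : `|\int[P]_w g (z + X w) - g z - 2^-1 * g2 z * s ^+ 2| <= K * b ^+ 3.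
  have -> : \int[P]_w g (z + X w) - g z - 2^-1 * g2 z * s ^+ 2 =
      \int[P]_w (g (z + X w) - g z - g1 z * X w - 2^-1 * g2 z * X w ^+ 2).
    have bc c (Y : T -> R) : bmfun Y -> bmfun (fun w => c * Y w).
      by move=> bY; apply: bmfunM => //; exact: bmfun_cst.
    have bX2 := bmfunX 2 bX.
    have bA : bmfun (fun w => g (z + X w) - g z) by apply: bmfunB => //; exact: bmfun_cst.
    have bB : bmfun (fun w => g (z + X w) - g z - g1 z * X w) by apply: bmfunB => //; exact: bc.
    rewrite bmfun_intB//; last exact: bc.
    rewrite bmfun_intB//; last exact: bc.
    rewrite bmfun_intB//; last exact: bmfun_cst.
    by rewrite !bmfun_intZl// X0 X2 integral_cst_prob mulr0 subr0.
  apply: bmfun_int_norm_le.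
    apply: bmfunB; first apply: bmfunB; first apply: bmfunB => //; first exact: bmfun_cst.
      by apply: bmfunM => //; exact: bmfun_cst.
    by apply: bmfunM; [exact: bmfun_cst|exact: bmfunX].
  by move=> w; apply: le_trans (gT _ _) _; rewrite ler_wpM2l// lerXn2r// nnegrE.
have e2 := gsmooth_taylor z cg bg s0 gT.
have e3 : K * gauss_m3 * s ^+ 3 <= K * gauss_m3 * b ^+ 3.
  by rewrite ler_wpM2l ?mulr_ge0 ?gauss_m3_ge0// lerXn2r// nnegrE.
rewrite (_ : \int[P]_w g (z + X w) - gsmooth s g z =
  (\int[P]_w g (z + X w) - g z - 2^-1 * g2 z * s ^+ 2) -
  (gsmooth s g z - g z - 2^-1 * g2 z * s ^+ 2)); last ring.
apply: le_trans (ler_normB _ _) _; rewrite mulrDl lerD//.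
exact: le_trans e2 e3.
Qed.

End ThirdOrder.

(** * From mean-square approximations to the limit law *)

Section ApproximationCLT.
Context {R : realType} {dd} {T : measurableType dd} (P : probability T R).
Variable W : nat -> T -> R.
Hypothesis bW : forall n, bmfun (W n).

Definition approx_by (e sigma : R) (Y : nat -> T -> R) := [/\ 0 <= sigma,
  forall n, bmfun (Y n),
  \forall n \near \oo, \int[P]_w (W n w - Y n w) ^+ 2 <= e,
  (fun n => \int[P]_w Y n w ^+ 2) @ \oo --> sigma ^+ 2 &
  forall g, smooth3 g -> (fun n => \int[P]_w g (Y n w)) @ \oo --> gsmooth sigma g 0].

Hypothesis approx : forall e, 0 < e -> exists sigma Y, approx_by e sigma Y.

Let v n := \int[P]_w W n w ^+ 2.

Let bWY n (Y : nat -> T -> R) : (forall n, bmfun (Y n)) -> bmfun (fun w => (W n w - Y n w) ^+ 2).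
Proof. by move=> bY; apply: bmfunX; exact: bmfunB. Qed.

Let var_bounded : exists2 B, 1 <= B & \forall n \near \oo, v n <= B.
Proof.
have [sigma [Y [s0 bY WY Y2 _]]] := approx ltr01.
exists (2 + 2 * (sigma ^+ 2 + 1)); first by have := sqr_ge0 sigma; lra.
move/cvgrPdist_le/(_ 1 ltr01) : Y2 => Y2.
near=> n.
have h1 : \int[P]_w (W n w - Y n w) ^+ 2 <= 1 by near: n; exact: WY.
have h2 : `|sigma ^+ 2 - \int[P]_w Y n w ^+ 2| <= 1 by near: n; exact: Y2.
have h3 : v n <= \int[P]_w (2 * (W n w - Y n w) ^+ 2 + 2 * Y n w ^+ 2).
  apply: bmfun_int_le; first exact: bmfunX.
    by apply: bmfunD; (apply: bmfunM; first exact: bmfun_cst); [exact: bWY|exact: bmfunX].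
  by move=> w; have := sqr_ge0 (W n w - 2 * Y n w); nra.
apply: le_trans h3 _; rewrite bmfun_intD; last 2 first.
- by apply: bmfunM; [exact: bmfun_cst|exact: bWY].
- by apply: bmfunM; [exact: bmfun_cst|exact: bmfunX].
rewrite !bmfun_intZl; [|exact: bmfunX|exact: bWY].
by move: h2; rewrite ler_norml; lra.
Unshelve. all: by end_near. Qed.

Let var_close eta : 0 < eta -> exists2 e0, 0 < e0 & forall e sigma Y, e <= e0 ->
  approx_by e sigma Y -> \forall n \near \oo, `|v n - sigma ^+ 2| <= eta.
Proof.
move=> eta0; have [B B1 vB] := var_bounded.
have B0 : 0 < B by lra.
(* Weight for AM-GM on [(W n - Y n) * (W n + Y n)]: [kappa * B] equals [eta / 20], and [e0] is then
   chosen so that [kappa^-1 * e] is at most [eta / 2]. *)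
pose kappa := eta / (20 * B).
have k0 : 0 < kappa by rewrite divr_gt0// mulr_gt0.
exists (Num.min B (kappa * eta / 2)); first by rewrite lt_min B0 divr_gt0// mulr_gt0.
move=> e sigma Y; rewrite le_min => /andP[eB ek] [s0 bY WY Y2 _].
have eta2 : 0 < eta / 2 by rewrite divr_gt0.
move/cvgrPdist_le/(_ _ eta2) : Y2 => Y2.
near=> n.
have h1 : \int[P]_w (W n w - Y n w) ^+ 2 <= e by near: n; exact: WY.
have h2 : `|sigma ^+ 2 - \int[P]_w Y n w ^+ 2| <= eta / 2 by near: n; exact: Y2.
have h3 : v n <= B by near: n; exact: vB.
have bW2 : bmfun (fun w => W n w ^+ 2) by exact: bmfunX.
have bY2 : bmfun (fun w => Y n w ^+ 2) by exact: bmfunX.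
have bD2 : bmfun (fun w => (W n w - Y n w) ^+ 2) by exact: bWY.
have bD : bmfun (fun w => W n w ^+ 2 - Y n w ^+ 2) by exact: bmfunB.
have h4 : `|v n - \int[P]_w Y n w ^+ 2| <= eta / 2.
  rewrite /v -bmfun_intB//; apply: le_trans (bmfun_int_norm _ bD) _.
  have ki : 0 < kappa^-1 by rewrite invr_gt0.
  have : \int[P]_w `|W n w ^+ 2 - Y n w ^+ 2| <=
      \int[P]_w ((kappa^-1 / 2 + kappa) * (W n w - Y n w) ^+ 2 + 4 * kappa * W n w ^+ 2).
    apply: bmfun_int_le; first exact: bmfun_norm.
      by apply: bmfunD; (apply: bmfunM; first exact: bmfun_cst).
    move=> w; rewrite subr_sqr normrM.
    set a := W n w - Y n w; set c := W n w + Y n w.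
    have -> : W n w = (a + c) / 2 by rewrite /a /c; field.
    have -> : a ^+ 2 = `|a| ^+ 2 by rewrite real_normK ?num_real.
    have : `|c| ^+ 2 <= 2 * `|a| ^+ 2 + 2 * (a + c) ^+ 2.
      rewrite !real_normK ?num_real//; have := sqr_ge0 (2 * a + c); nra.
    have : 0 <= kappa^-1 * (`|a| - kappa * `|c|) ^+ 2 by rewrite mulr_ge0 ?sqr_ge0// ltW.
    have -> : kappa^-1 * (`|a| - kappa * `|c|) ^+ 2 =
      kappa^-1 * `|a| ^+ 2 - 2 * (`|a| * `|c|) + kappa * `|c| ^+ 2 by field; rewrite gt_eqF.
    move=> p1 p2; have := ler_wpM2l (ltW k0) p2.
    have -> : 4 * kappa * ((a + c) / 2) ^+ 2 = kappa * (a + c) ^+ 2 by field.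
    by lra.
  rewrite bmfun_intD; try by apply: bmfunM => //; exact: bmfun_cst.
  rewrite !bmfun_intZl// -/(v n) => /le_trans; apply.
  have p1 : (kappa^-1 / 2 + kappa) * \int[P]_w (W n w - Y n w) ^+ 2 <= (kappa^-1 / 2 + kappa) * e.
    by rewrite ler_wpM2l//; lra.
  have p2 : kappa^-1 * e <= eta / 2.
    by rewrite ler_pdivrMl// mulrA.
  have p3 : kappa * e <= kappa * B by rewrite ler_pM2l.
  have p4 : kappa * v n <= kappa * B by rewrite ler_pM2l.
  have p5 : kappa * B = eta / 20 by rewrite /kappa; field; rewrite gt_eqF.
  lra.
rewrite (_ : v n - sigma ^+ 2 = (v n - \int[P]_w Y n w ^+ 2) -
  (sigma ^+ 2 - \int[P]_w Y n w ^+ 2)); last ring.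
by apply: le_trans (ler_normB _ _) _; lra.
Unshelve. all: by end_near. Qed.

Let sqrt_close (a b : R) : 0 <= a -> 0 <= b -> `|a - b| <= Num.sqrt `|a ^+ 2 - b ^+ 2|.
Proof.
move=> a0 b0; rewrite -(ler_pXn2r (n := 2))// ?nnegrE ?sqrtr_ge0//.
rewrite sqr_sqrtr// subr_sqr normrM expr2 ler_wpM2l//.
by rewrite (ger0_norm (addr_ge0 a0 b0)) ler_norml; lra.
Qed.

(** Every approximation pins the variances near its own [sigma ^+ 2], so they form a Cauchy
    sequence. A test function then passes through five errors of [eps / 8]: [f] to [g] under both
    laws, [W] to [Y], [Y] to its Gaussian, and [sigma] to the root of [tau2]. *)
Lemma clt_of_approx : exists tau2 : R, [/\ 0 <= tau2,
  (fun n => \int[P]_w W n w ^+ 2) @ \oo --> tau2 &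
  forall f, continuous f -> (exists M, forall x, `|f x| <= M) ->
    (fun n => \int[P]_w f (W n w)) @ \oo --> gsmooth (Num.sqrt tau2) f 0].
Proof.
have : cvg (v @ \oo).
  apply/cauchy_cvgP/cauchy_exP => eps eps0.
  have [e0 e00 he] := var_close (divr_gt0 eps0 (ltr0n _ 2)).
  have [sigma [Y aY]] := approx e00.
  exists (sigma ^+ 2); have := he _ _ _ (lexx _) aY.
  apply: (@filterS _ \oo _ _ (v @^-1` ball (sigma ^+ 2) eps)) => n h.
  by rewrite /ball/= distrC; apply: le_lt_trans h _; lra.
move=> /cvg_ex[tau2 vt]; exists tau2.
have tau0 : 0 <= tau2.
  apply: (@closed_cvg _ _ \oo _ v (fun x => 0 <= x) _ _ _ vt); first exact: closed_ge.
  by near=> n; apply: Rintegral_ge0 => w _; exact: sqr_ge0.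
split => // f cf [Bf fB]; apply/cvgrPdist_le => eps eps0.
(* Eventually the mean of [1 + W n w ^+ 2] is at most [2 + tau2], so the smoothing error is at most
   [eps / 8]. *)
pose e1 := eps / (8 * (2 + tau2)).
have e10 : 0 < e1 by rewrite divr_gt0// mulr_gt0//; lra.
have [g sg fg] := smoothing cf fB e10.
have cg := smooth3_continuous sg; have bg := smooth3_bounded sg.
have [K K0 gL] := smooth3_lipschitz sg.
have bf : exists M, forall x, `|f x| <= M by exists Bf.
pose K' := K * (1 + gauss_m3) + 1.
have m30 := @gauss_m3_ge0 R.
have K'0 : 0 < K' by rewrite /K'; have := mulr_ge0 K0 m30; lra.
(* The root of [eta] bounds both the distance of [sigma] from the root of [tau2] and the mean-square
   distance of [W] from [Y]; each is then multiplied by at most [K']. *)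
pose eta := (eps / (8 * K')) ^+ 2.
have eta0 : 0 < eta by rewrite exprn_gt0// divr_gt0// mulr_gt0.
have sqrt_eta : Num.sqrt eta = eps / (8 * K').
  by rewrite sqrtr_sqr ger0_norm// ltW// divr_gt0// mulr_gt0.
have [e0 e00 he] := var_close eta0.
have min0 : 0 < Num.min e0 eta by rewrite lt_min e00.
have [sigma [Y aY]] := approx min0.
have vs : \forall n \near \oo, `|v n - sigma ^+ 2| <= eta.
  by apply: he aY; rewrite ge_min lexx.
have [s0 bY WY Y2 Yg] := aY.
have ts : `|tau2 - sigma ^+ 2| <= eta.
  apply: (@closed_cvg _ _ \oo _ (fun n => `|v n - sigma ^+ 2|) (fun x => x <= eta)).
  - exact: closed_le.
  - exact: vs.
  - by apply: cvg_norm; apply: cvgB => //; exact: cvg_cst.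
have gs : `|gsmooth sigma g 0 - gsmooth (Num.sqrt tau2) g 0| <= eps / 8.
  apply: le_trans (gsmooth_lipschitz sigma (Num.sqrt tau2) 0 cg bg K0 gL) _.
  have : `|sigma - Num.sqrt tau2| <= Num.sqrt eta.
    apply: le_trans (sqrt_close s0 (sqrtr_ge0 _)) _.
    by rewrite ler_wsqrtr// sqr_sqrtr// distrC.
  rewrite sqrt_eta => h.
  rewrite mulrAC; apply: le_trans (ler_wpM2l _ h) _.
    by rewrite mulr_ge0//; lra.
  rewrite mulrA ler_pdivrMr ?mulr_gt0//.
  have -> : eps / 8 * (8 * K') = eps * K' by field.
  by rewrite mulrC ler_pM2l// /K'; lra.
have gf := gsmooth_close (Num.sqrt tau2) cf bf cg bg fg.
have gf' : `|gsmooth (Num.sqrt tau2) f 0 - gsmooth (Num.sqrt tau2) g 0| <= eps / 8.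
  apply: le_trans gf _; rewrite sqr_sqrtr// /e1.
  have -> : eps / (8 * (2 + tau2)) * (1 + tau2) = eps / 8 * ((1 + tau2) / (2 + tau2)).
    by field; rewrite gt_eqF//; lra.
  rewrite ler_piMr ?divr_ge0 ?(ltW eps0)// ler_pdivrMr; lra.
have eps8 : 0 < eps / 8 by rewrite divr_gt0.
move/cvgrPdist_le/(_ _ eps8) : (Yg g sg) => Ygn.
move/cvgrPdist_le/(_ 1 ltr01) : (vt) => vtn.
near=> n.
have n1 : `|gsmooth sigma g 0 - \int[P]_w g (Y n w)| <= eps / 8 by near: n; exact: Ygn.
have n2 : `|tau2 - v n| <= 1 by near: n; exact: vtn.
have n3 : \int[P]_w (W n w - Y n w) ^+ 2 <= eta.
  have : \int[P]_w (W n w - Y n w) ^+ 2 <= Num.min e0 eta by near: n; exact: WY.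
  by rewrite le_min => /andP[].
have bfW : bmfun (fun w => f (W n w)) by apply: bmfun_post => //; case: (bW n).
have bgW : bmfun (fun w => g (W n w)) by apply: bmfun_post => //; case: (bW n).
have bgY : bmfun (fun w => g (Y n w)) by apply: bmfun_post => //; case: (bY n).
have d1 : `|\int[P]_w f (W n w) - \int[P]_w g (W n w)| <= eps / 8.
  rewrite -bmfun_intB//; apply: le_trans (bmfun_int_norm _ (bmfunB bfW bgW)) _.
  have : \int[P]_w `|f (W n w) - g (W n w)| <= \int[P]_w (e1 * 1 + e1 * W n w ^+ 2).
    apply: bmfun_int_le; first exact/bmfun_norm/bmfunB.
      by apply: bmfunD; [exact: bmfun_cst|apply: bmfunM; [exact: bmfun_cst|exact: bmfunX]].
    by move=> w; rewrite -mulrDr.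
  rewrite bmfun_intD; last 2 first.
  - exact: bmfun_cst.
  - by apply: bmfunM; [exact: bmfun_cst|exact: bmfunX].
  rewrite integral_cst_prob bmfun_intZl; last exact: bmfunX.
  move=> /le_trans; apply; rewrite -/(v n) -mulrDr.
  have -> : eps / 8 = e1 * (2 + tau2) by rewrite /e1; field; rewrite gt_eqF//; lra.
  by rewrite ler_pM2l//; move: n2; rewrite ler_norml; lra.
have d2 : `|\int[P]_w g (W n w) - \int[P]_w g (Y n w)| <= eps / 8.
  rewrite -bmfun_intB//; apply: le_trans (bmfun_int_norm _ (bmfunB bgW bgY)) _.
  have bD : bmfun (fun w => W n w - Y n w) by exact: bmfunB.
  have : \int[P]_w `|g (W n w) - g (Y n w)| <= \int[P]_w (K * `|W n w - Y n w|).
    apply: bmfun_int_le; first exact/bmfun_norm/bmfunB.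
      by apply: bmfunM; [exact: bmfun_cst|exact: bmfun_norm].
    by move=> w; exact: gL.
  rewrite bmfun_intZl; last exact: bmfun_norm.
  move=> /le_trans; apply.
  apply: le_trans (ler_wpM2l K0 (int_norm_le_sqrt P bD)) _.
  apply: le_trans (ler_wpM2l K0 (ler_wsqrtr n3)) _.
  rewrite sqrt_eta mulrA ler_pdivrMr ?mulr_gt0//.
  have -> : eps / 8 * (8 * K') = eps * K' by field.
  rewrite mulrC ler_pM2l// /K'; have := mulr_ge0 K0 m30; lra.
rewrite (_ : gsmooth (Num.sqrt tau2) f 0 - \int[P]_w f (W n w) =
  (gsmooth (Num.sqrt tau2) f 0 - gsmooth (Num.sqrt tau2) g 0)
  - (gsmooth sigma g 0 - gsmooth (Num.sqrt tau2) g 0)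
  + (gsmooth sigma g 0 - \int[P]_w g (Y n w))
  - (\int[P]_w g (W n w) - \int[P]_w g (Y n w))
  - (\int[P]_w f (W n w) - \int[P]_w g (W n w))); last ring.
apply: le_trans (ler_normB _ _) _; apply: le_trans (lerD (ler_normB _ _) (lexx _)) _.
apply: le_trans (lerD (lerD (ler_normD _ _) (lexx _)) (lexx _)) _.
apply: le_trans (lerD (lerD (lerD (ler_normB _ _) (lexx _)) (lexx _)) (lexx _)) _.
lra.
Unshelve. all: by end_near. Qed.

End ApproximationCLT.

(** * Gain of persistence under local resampling *)

Lemma bmfun_if (R : realType) dd (T : measurableType dd) (c : T -> bool) (f g : T -> R) :
  measurable_fun setT c -> bmfun f -> bmfun g -> bmfun (fun x => if c x then f x else g x).
Proof.
move=> mc [mf [M fM]] [mg [N gN]]; split; first exact: measurable_fun_ifT.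
exists (Num.max M N) => x; rewrite le_max.
by case: (c x); rewrite ?fM ?gN ?orbT.
Qed.

Section Lifetime.
Context {R : realType} {d : nat}.
Notation Om := (Omega R d).
Notation RR := (measurableTypeR R).
Notation U := (uniform_prob (@ltr01 R)).
Implicit Types (K Q : cube d) (V : seq (cube d)) (w : Om).

Lemma measurable_present K :
  measurable_fun setT (fun z : Om * RR => present z.1 z.2 K).
Proof.
apply: (@measurable_fun_bool _ _ _ _ true).
rewrite setTI (_ : _ @^-1` _ = \bigcup_(n in setT)
    (if unpickle n is Some Q then
       if face_of K Q then [set z : Om * RR | z.1 Q <= z.2] else set0 else set0)).
  apply: bigcupT_measurable => n; case: (unpickle n) => // Q; case: ifP => // _.
  rewrite (_ : [set z | _] = (fun z : Om * RR => z.1 Q <= z.2) @^-1` [set true]); last first.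
    by apply/seteqP; split.
  have mle : measurable_fun setT (fun z : Om * RR => z.1 Q <= z.2).
    apply: measurable_fun_ler; last exact: measurable_snd.
    by apply: (measurableT_comp (measurable_coord Q)); exact: measurable_fst.
  by rewrite -[X in measurable X]setTI; exact: mle.
apply/seteqP; split => z /=.
  move=> /asboolP[Q [KQ zQ]]; exists (pickle Q) => //.
  by rewrite pickleK KQ.
by move=> [n _]; case: (unpickle n) => // Q; case: ifP => // KQ zQ; apply/asboolP; exists Q.
Qed.

(** The complex is determined by finitely many measurable presence bits, so any function of it is
    bounded and measurable; [f] varies in the induction. *)
Lemma bmfun_complex V (f : seq (cube d) -> R) :
  bmfun (fun z : Om * RR => f (complex V z.1 z.2)).
Proof.
elim: V f => [|K V ih] f; first exact: (bmfun_cst (f [::])).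
have := bmfun_if (measurable_present K) (ih (fun s => f (K :: s))) (ih f).
by congr bmfun; apply/funext => z; rewrite /complex /=; case: ifP.
Qed.

Variable q : nat.

(** Levels are integrated against the uniform probability, so the Fubini lemmas for probabilities
    apply to the pair of configuration and level. *)
Definition life V w : R := \int[U]_t bet q V w t.

Definition gain_life (N : pred (cube d)) V w : R := \int[U]_t (gain q N V w t)%:R.

Let bmfun_bet2 V : bmfun (fun z : Om * RR => bet q V z.1 z.2 : R).
Proof.
exact: (bmfun_complex V (fun A => (count (fun K => cdim K == q) A)%:R - (rho q A)%:R)).
Qed.

Let bmfun_gain2 N V : bmfun (fun z : Om * RR => (gain q N V z.1 z.2)%:R : R).
Proof.
exact: (bmfun_complex V (fun A => (rho q A - rho q [seq K <- A | ~~ N K])%:R)).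
Qed.

Let bmfun_bet V w : bmfun (fun t : RR => bet q V w t : R).
Proof. exact: (bmfun_pair1 (bmfun_bet2 V) w). Qed.

Let bmfun_gain N V w : bmfun (fun t : RR => (gain q N V w t)%:R : R).
Proof. exact: (bmfun_pair1 (bmfun_gain2 N V) w). Qed.

Variable P : probability Om R.

Lemma bmfun_life V : bmfun (life V).
Proof. exact: (bmfun_int2 P U (bmfun_bet2 V)). Qed.

Lemma bmfun_gain_life N V : bmfun (gain_life N V).
Proof. exact: (bmfun_int2 P U (bmfun_gain2 N V)). Qed.

Lemma LqnE n w : Lqn q n w = life (box_window n) w.
Proof.
rewrite /Lqn /life /Rintegral.
have betE t : bet q (box_window n) w t = (beta_n q n w t)%:R by rewrite /beta_n bettiE.
under [in RHS]eq_integral do rewrite betE.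
rewrite integral_uniform.
- by rewrite subr0 invr1 mul1e.
- apply/measurable_EFinP; have [+ _] := bmfun_bet (box_window n) w.
  by congr measurable_fun; apply/funext => t; rewrite betE.
- by move=> t; rewrite lee_fin.
Qed.

Lemma life_depends V : depends_on (fun Q => has (face_of^~ Q) V) (life V).
Proof.
move=> a b ab; apply: eq_Rintegral => t _.
suff e : complex V a t = complex V b t by rewrite /bet e.
apply: eq_in_filter => K KV; apply/asboolP/asboolP => -[Q [KQ Qt]]; exists Q; split => //.
  by rewrite -ab//; apply/hasP; exists K.
by rewrite ab//; apply/hasP; exists K.
Qed.

Lemma life_ctrans x V w : life [seq ctrans x K | K <- V] w = life V (tau x w).
Proof. by apply: eq_Rintegral => t _; rewrite bet_ctrans. Qed.

Lemma gain_life_ctrans (N N' : pred (cube d)) x V w : (forall K, N (ctrans x K) = N' K) ->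
  gain_life N [seq ctrans x K | K <- V] w = gain_life N' V (tau x w).
Proof. by move=> NN'; apply: eq_Rintegral => t _; rewrite (gain_ctrans _ _ _ _ NN'). Qed.

Definition base Q : {ffun 'I_d -> int} := [ffun i => (Q i).1].

(** A face of a cube with lower corner [z] has each coordinate of its own corner equal to that of
    [z] or one more; no other cell is affected by the weights at [z]. *)
Definition near (z : {ffun 'I_d -> int}) : pred (cube d) := fun K => K \in window z 2.

Lemma size_near V z : uniq V -> (size [seq K <- V | near z K] <= 4 ^ d)%N.
Proof.
move=> uV; rewrite -[4%N]/(2 * 2)%N -(size_window z 2); apply: uniq_leq_size.
  exact: filter_uniq.
by move=> K; rewrite mem_filter => /andP[].
Qed.

Lemma present_far z (w w' : Om) t K : (forall Q, base Q != z -> w Q = w' Q) ->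
  ~~ near z K -> present w t K = present w' t K.
Proof.
move=> ww' farK.
have bz Q : face_of K Q -> base Q != z.
  move=> /face_ofP KQ; apply: contraNneq farK => zE; apply/mem_windowP => i.
  have := KQ i; rewrite -zE ffunE.
  by move: ((K i).1) ((K i).2) ((Q i).1) ((Q i).2) => k [] l [] /=; lia.
by apply/asboolP/asboolP => -[Q [KQ Qt]]; exists Q; split => //;
  rewrite ?(ww' _ (bz Q KQ))// -(ww' _ (bz Q KQ)).
Qed.

Definition resample z (p : Om * Om) : Om := mix (grp base z) p.2 p.1.

Let present_resample z p t K : ~~ near z K ->
  present p.1 t K = present (resample z p) t K.
Proof.
apply: present_far => Q Qz; rewrite /resample /mix /grp.
by rewrite (negbTE Qz).
Qed.

(** The factor 3 of [bet_diff_le] times the number of cells near a site: two positions and two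
    shapes per direction. *)
Definition life_cst : R := (3 * 4 ^ d)%:R.

Lemma life_resample_le V z p : uniq V ->
  `|life V p.1 - life V (resample z p)| <= life_cst.
Proof.
move=> uV; rewrite /life -bmfun_intB//; apply: bmfun_int_norm_le; first exact: bmfunB.
move=> t; apply: le_trans (bet_diff_le q (N := near z) _ _) _.
  by move=> K; exact: present_resample.
by rewrite ler_nat leq_mul2l /= size_near.
Qed.

(** [V] and [V2] are sandwiched between lists that can be taken as windows centred at the site,
    whose mean gains do not depend on the site. *)
Lemma life_resample_window V V2 W1 W2 z p : uniq V -> uniq V2 ->
  {subset W1 <= V} -> {subset V <= V2} -> {subset V2 <= W2} ->
  (forall K, near z K -> K \in W1) ->
  `|(life V p.1 - life V (resample z p)) - (life V2 p.1 - life V2 (resample z p))| <=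
  (gain_life (near z) W1 p.1 - gain_life (near z) W2 p.1) +
  (gain_life (near z) W1 (resample z p) - gain_life (near z) W2 (resample z p)).
Proof.
move=> uV uV2 W1V VV2 V2W2 zW1; rewrite /life /gain_life.
rewrite -!bmfun_intB//; try exact: bmfunB.
rewrite -bmfun_intD//; try exact: bmfunB.
have bL : bmfun (fun t : RR => (bet q V p.1 t - bet q V (resample z p) t) -
    (bet q V2 p.1 t - bet q V2 (resample z p) t) : R) by apply/bmfunB/bmfunB => //; exact: bmfunB.
apply: le_trans (bmfun_int_norm _ bL) _; apply: bmfun_int_le.
- exact: bmfun_norm.
- by apply: bmfunD; exact: bmfunB.
move=> t.
have NV K : near z K -> K \in V2 -> K \in V by move=> /zW1 /W1V.
have N1 K : near z K -> K \in V -> K \in W1 by move=> /zW1.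
have N2 K : near z K -> K \in W2 -> K \in V2 by move=> /zW1 /W1V /VV2.
apply: le_trans (bet_diff_window q uV uV2 VV2 NV _) _.
  by move=> K; exact: present_resample.
have h1 u := gain_anti q u t W1V N1; have h2 u := gain_anti q u t V2W2 N2.
have := h1 p.1; have := h1 (resample z p); have := h2 p.1; have := h2 (resample z p).
by rewrite -!(ler_nat R); lra.
Qed.

Definition origin : {ffun 'I_d -> int} := [ffun=> 0].

(** The side [2 * k + 2] leaves [k] layers on each side of the two layers of [near origin]. *)
Definition mean_gain (k : nat) : R :=
  \int[P]_w gain_life (near origin) (window (fun=> - k%:Z) (2 * k + 2)) w.

Hypothesis statP : stationary P.

Lemma measurable_tau (x : 'I_d -> int) : measurable_fun setT (@tau R d x).
Proof. by apply: measurable_into_Omega => Q; exact: (measurable_coord (ctrans x Q)). Qed.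

Lemma int_tau x (f : Om -> R) : bmfun f -> \int[P]_w f (tau x w) = \int[P]_w f w.
Proof.
move=> bf; apply: (int_measure_preserving (measurable_tau x)) => // A mA.
exact: statP.
Qed.

Lemma mean_gain_shift (z : {ffun 'I_d -> int}) (k : nat) :
  \int[P]_w gain_life (near z) (window (fun i => z i - k%:Z) (2 * k + 2)) w = mean_gain k.
Proof.
pose x i := - z i.
rewrite /mean_gain -[RHS](int_tau x); last exact: bmfun_gain_life.
apply: eq_Rintegral => w _.
have -> : window (fun i => z i - k%:Z) (2 * k + 2) =
    [seq ctrans x K | K <- window (fun=> - k%:Z) (2 * k + 2)].
  by rewrite window_ctrans; congr window; apply/funext => i; rewrite /x opprK addrC.
apply: gain_life_ctrans => K; rewrite /near.
have -> : window z 2 = [seq ctrans x K | K <- window origin 2].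
  by rewrite window_ctrans; congr window; apply/funext => i; rewrite /x opprK ffunE add0r.
by rewrite mem_map//; exact: ctrans_inj.
Qed.

Lemma window_sub (a a' : 'I_d -> int) L L' : (forall i, a' i <= a i) ->
  (forall i, a i + L%:Z <= a' i + L'%:Z) -> {subset window a L <= window a' L'}.
Proof.
move=> h1 h2 K /mem_windowP h; apply/mem_windowP => i.
by have := h1 i; have := h2 i; have := h i; lia.
Qed.

Lemma mean_gain_ge0 k : 0 <= mean_gain k.
Proof. by apply: Rintegral_ge0 => w _; apply: Rintegral_ge0 => t _; exact: ler0n. Qed.

(** [k] is chosen with [mean_gain k] within [e] of the infimum, so no value is lower by more than
    [e]. *)
Lemma mean_gain_cauchy (e : R) : 0 < e ->
  exists k, forall k', (k <= k')%N -> mean_gain k - mean_gain k' <= e.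
Proof.
move=> e0; pose S := range mean_gain.
have hS : has_inf S.
  split; first by exists (mean_gain 0), 0%N.
  by exists 0 => _ [k _ <-]; exact: mean_gain_ge0.
have [_ [k _ <-] hk] := inf_adherent e0 hS.
exists k => k' _; have : inf S <= mean_gain k' by apply: ge_inf; [case: hS|exists k'].
by rewrite lerBlDl => h; apply: le_trans (ltW hk) _; rewrite lerD2r.
Qed.

Hypothesis prodP : product_measure P.
Notation PP := (P \x P)%E.

(** The difference of increments is at most [2 * life_cst] and at most the sum of the gain drops at
    two configurations of law [P]; its square is bounded by the product, hence the factor 4. *)
Lemma resample_good V V2 (z : {ffun 'I_d -> int}) k k2 : uniq V -> uniq V2 ->
  {subset window (fun i => (z i - k%:Z)%R) (2 * k + 2) <= V} -> {subset V <= V2} ->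
  {subset V2 <= window (fun i => (z i - k2%:Z)%R) (2 * k2 + 2)} ->
  \int[PP]_p ((life V p.1 - life V (resample z p)) - (life V2 p.1 - life V2 (resample z p))) ^+ 2
  <= 4 * life_cst * (mean_gain k - mean_gain k2).
Proof.
move=> uV uV2 W1V VV2 V2W2.
set W1 := window _ _ in W1V; set W2 := window _ _ in V2W2.
have zW1 K : near z K -> K \in W1 by apply: window_sub => i; lia.
have c0 : 0 <= life_cst by exact: ler0n.
pose G u := gain_life (near z) W1 u - gain_life (near z) W2 u.
have bG : bmfun G by apply: bmfunB; exact: bmfun_gain_life.
have b1 (f : Om -> R) : bmfun f -> bmfun (fun p : Om * Om => f p.1).
  by move=> bf; apply: (bmfun_comp bf); exact: measurable_fst.
have b2 (f : Om -> R) : bmfun f -> bmfun (fun p : Om * Om => f (resample z p)).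
  by move=> bf; apply: (bmfun_comp bf); exact: measurable_mix.
have bl W : bmfun (fun p : Om * Om => life W p.1 - life W (resample z p)).
  by apply: bmfunB; [apply: b1|apply: b2]; exact: bmfun_life.
have GE : \int[P]_w G w = mean_gain k - mean_gain k2.
  by rewrite bmfun_intB ?mean_gain_shift//; exact: bmfun_gain_life.
have -> : 4 * life_cst * (mean_gain k - mean_gain k2) =
    \int[PP]_p (2 * life_cst * (G p.1 + G (resample z p))).
  rewrite bmfun_intZl; last by apply: bmfunD; [exact: b1|exact: b2].
  rewrite bmfun_intD; [|exact: b1|exact: b2].
  rewrite (int_fst P bG) (int_mix prodP (grp base z) bG) GE.
  by move: (mean_gain k - mean_gain k2) life_cst => a b; ring.
apply: bmfun_int_le.
- by apply: bmfunX; exact: bmfunB.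
- by apply: bmfunM; [exact: bmfun_cst|apply: bmfunD; [exact: b1|exact: b2]].
move=> p; rewrite -real_normK ?num_real// expr2.
set D := `|_|.
have D1 : D <= G p.1 + G (resample z p).
  exact: (life_resample_window p uV uV2 W1V VV2 V2W2 zW1).
have D2 : D <= 2 * life_cst.
  apply: le_trans (ler_normB _ _) _.
  by rewrite mulr_natl mulr2n lerD// life_resample_le.
by apply: ler_pM => //; exact: normr_ge0.
Qed.

End Lifetime.

(** * Decomposition of the window into blocks *)

Lemma depends_on_sub (R : realType) d (S S' : pred (cube d)) (f : Omega R d -> R) :
  (forall Q, S Q -> S' Q) -> depends_on S f -> depends_on S' f.
Proof. by move=> SS' df a b ab; apply: df => Q /SS'; exact: ab. Qed.

Section Blocks.
Context {R : realType} {d : nat}.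
Notation Om := (Omega R d).
Variables (q n m k p : nat).
Hypotheses (pm : (p * m <= 2 * n)%N) (km : (2 * k + 2 < m)%N).
Notation I := {ffun 'I_d -> 'I_p}.
Implicit Types (i : I) (z : {ffun 'I_d -> int}) (Q K : cube d).

Definition corner i (j : 'I_d) : int := - n%:Z + (m * i j)%N%:Z.

(** The lowest layer is omitted: a cube with a face there may have its corner one step lower, in the
    neighbouring block. Without it, all weights involved sit at sites of [in_block]. *)
Definition block i : seq (cube d) := window (fun j => corner i j + 1) m.-1.

Definition in_block i z : bool :=
  [forall j, (corner i j <= z j) && (z j < corner i j + m%:Z)].

Let corner_bound i j : - n%:Z <= corner i j /\ corner i j + m%:Z <= n%:Z.
Proof.
have : (m * (i j).+1 <= m * p)%N by rewrite leq_mul2l ltn_ord orbT.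
have := pm; rewrite /corner mulnS [(m * p)%N]mulnC.
by move: (m * i j)%N (p * m)%N => x y; lia.
Qed.

Lemma in_block_inj i i' z : in_block i z -> in_block i' z -> i = i'.
Proof.
move=> /forallP h /forallP h'; apply/ffunP => j; apply: val_inj => /=.
have /andP[] := h j; have /andP[] := h' j; rewrite /corner => a1 a2 b1 b2.
have m0 : (0 < m)%N by lia.
have e1 : (m * i j < m * (i' j).+1)%N by rewrite mulnS; move: (m * i j)%N (m * i' j)%N a1 a2 b1 b2; lia.
have e2 : (m * i' j < m * (i j).+1)%N by rewrite mulnS; move: (m * i j)%N (m * i' j)%N a1 a2 b1 b2; lia.
rewrite !ltn_mul2l m0 !ltnS /= in e1 e2.
by apply/eqP; rewrite eqn_leq e1 e2.
Qed.

Lemma face_of_base K Q j : face_of K Q -> (K j).1 - 1 <= base Q j /\ base Q j <= (K j).1.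
Proof.
move=> /face_ofP/(_ j); rewrite ffunE.
by move: ((K j).1) ((K j).2) ((Q j).1) ((Q j).2) => x [] y [] /=; lia.
Qed.

Lemma block_depends i : depends_on (fun Q => in_block i (base Q)) (life (R := R) q (block i)).
Proof.
apply: depends_on_sub (@life_depends R d q (block i)) => Q /hasP[K /mem_windowP Kb KQ].
apply/forallP => j; have := face_of_base j KQ; have := Kb j.
by move: (corner i j) ((K j).1) (base Q j) => c x y; lia.
Qed.

Lemma block_sub i : {subset block i <= box_window n}.
Proof.
move=> K /mem_windowP Kb; rewrite mem_box_window; apply/in_boxP => j.
have := corner_bound i j; have := Kb j.
by move: (corner i j) ((K j).1) ((K j).2) => c x []; lia.
Qed.

Definition total_life (w : Om) : R := \sum_(i <- enum I) life q (block i) w.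

(** The sites start at [- n - 1], because a cube with a face in the box may have its lower corner
    one step outside. *)
Definition sites : seq {ffun 'I_d -> int} :=
  [seq [ffun j => ((f j : nat)%:Z - n%:Z - 1)%R] | f : {ffun 'I_d -> 'I_(2 * n + 2)}].

Lemma sites_uniq : uniq sites.
Proof.
rewrite map_inj_uniq ?enum_uniq// => f g /ffunP fg; apply/ffunP => j.
by apply: val_inj => /=; have := fg j; rewrite !ffunE; move: (f j) (g j) => [a ?] [b ?] /=; lia.
Qed.

Lemma size_sites : size sites = ((2 * n + 2) ^ d)%N.
Proof. by rewrite size_map -cardE card_ffun !card_ord. Qed.

Lemma mem_sites z : (forall j, - n%:Z - 1 <= z j /\ z j <= n%:Z) -> z \in sites.
Proof.
move=> h; apply/mapP.
have lt j : (absz (z j + n%:Z + 1)%R < 2 * n + 2)%N by have := h j; move: (z j) => y; lia.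
exists [ffun j => Ordinal (lt j)]; first by rewrite mem_enum.
by apply/ffunP => j; rewrite !ffunE /=; have := h j; move: (z j) => y; lia.
Qed.

Definition difference (w : Om) : R := life q (box_window n) w - total_life w.

Lemma difference_depends : depends_on (grps base sites) difference.
Proof.
have h V : {subset V <= box_window n} -> depends_on (grps base sites) (life (R := R) q V).
  move=> Vn; apply: depends_on_sub (@life_depends R d q V) => Q /hasP[K /Vn].
  rewrite mem_box_window => /in_boxP Kn KQ; apply: mem_sites => j.
  have := face_of_base j KQ; have := Kn j.
  by move: ((K j).1) ((K j).2) (base Q j) => x [] y; lia.
move=> a b ab; rewrite /difference (h _ _ a b ab)//; congr (_ - _).
by apply: eq_bigr => i _; apply: h => //; exact: block_sub.
Qed.

(** The bounds say that the window of radius [k] around [z] lies inside one block. *)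
Definition good z : bool := [exists i : I, [forall j,
  (corner i j + k%:Z + 1 <= z j) && (z j <= corner i j + m%:Z - k%:Z - 2)]].

(** Each block has [m - (2 * k + 2)] good values per direction, and distinct blocks share no
    site. *)
Lemma count_good : ((p * (m - (2 * k + 2))) ^ d <= count good sites)%N.
Proof.
set r := (m - (2 * k + 2))%N.
pose point (g : {ffun 'I_d -> 'I_p * 'I_r}) : {ffun 'I_d -> int} :=
  [ffun j => - n%:Z + (m * (g j).1)%N%:Z + k%:Z + 1 + ((g j).2 : nat)%:Z].
pose idx (g : {ffun 'I_d -> 'I_p * 'I_r}) : I := [ffun j => (g j).1].
have pointE g j : point g j = corner (idx g) j + k%:Z + 1 + ((g j).2 : nat)%:Z.
  by rewrite /corner !ffunE.
have gr (g : {ffun 'I_d -> 'I_p * 'I_r}) j : (((g j).2 : nat) + (2 * k + 2) < m)%N.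
    have := ltn_ord (g j).2; move: (nat_of_ord _) => y; rewrite /r; lia.
have point_in g : in_block (idx g) (point g).
  apply/forallP => j; rewrite pointE; have := gr g j.
  by move: (corner _ _) (nat_of_ord (g j).2) => c y; lia.
have -> : ((p * r) ^ d)%N = size [seq point g | g : {ffun 'I_d -> 'I_p * 'I_r}].
  by rewrite size_map -cardE card_ffun card_prod !card_ord.
rewrite -size_filter; apply: uniq_leq_size.
  rewrite map_inj_uniq ?enum_uniq// => f g fg.
  have ifg : idx f = idx g by apply: (in_block_inj (point_in f)); rewrite fg point_in.
  apply/ffunP => j; have e1 : (f j).1 = (g j).1 by move/ffunP/(_ j) : ifg; rewrite !ffunE.
  have := pointE f j; rewrite fg pointE ifg => e2.
  rewrite [LHS]surjective_pairing [RHS]surjective_pairing e1; congr pair.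
  apply: val_inj => /=.
  by move: e2; move: (corner _ _) (nat_of_ord (f j).2) (nat_of_ord (g j).2) => c x y; lia.
move=> _ /mapP[g _ ->]; rewrite mem_filter; apply/andP; split.
  apply/existsP; exists (idx g); apply/forallP => j; rewrite pointE; have := gr g j.
  by move: (corner _ _) (nat_of_ord (g j).2) => c y; lia.
apply: mem_sites => j; rewrite pointE; have := gr g j; have := corner_bound (idx g) j.
by move: (corner _ _) (nat_of_ord (g j).2) => c y; lia.
Qed.

Lemma life_resample_out i z p' : ~~ in_block i z ->
  life q (block i) p'.1 - life q (block i) (resample (R := R) z p') = 0.
Proof.
move=> iz; apply/eqP; rewrite subr_eq0; apply/eqP; apply: block_depends => Q iQ.
rewrite /resample /mix /grp; case: eqP => // zQ.
by move: iQ; rewrite zQ (negbTE iz).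
Qed.

Lemma total_life_resample z p' : total_life p'.1 - total_life (resample z p') =
  if [pick i | in_block i z] is Some i
  then life q (block i) p'.1 - life q (block i) (resample z p') else 0.
Proof.
rewrite /total_life -sumrB; case: pickP => [i iz|none]; last first.
  by rewrite big1// => i _; rewrite life_resample_out// none.
rewrite (bigD1_seq i) ?mem_enum ?enum_uniq//= big1 ?addr0// => i' i'i.
rewrite life_resample_out//; apply: contra i'i => i'z.
by rewrite (in_block_inj i'z iz).
Qed.

Variable P : probability Om R.
Hypotheses (prodP : product_measure P) (statP : stationary P).
Notation PP := (P \x P)%E.

Lemma bmfun_difference : bmfun difference.
Proof.
by apply: bmfunB; [exact: (bmfun_life q P)|apply: bmfun_sum => i; exact: (bmfun_life q P)].
Qed.

(** A site lies in at most one block, so only two increments occur, each at most [life_cst]. *)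
Lemma resample_sqr_bad z : resample_sqr P base difference z <= (2 * @life_cst R d) ^+ 2.
Proof.
have bD := bmfun_difference.
apply: bmfun_int_le_cst.
  apply: bmfunX; apply: bmfunB; first by apply: (bmfun_comp bD); exact: measurable_fst.
  by apply: (bmfun_comp bD); exact: measurable_mix.
move=> p'; rewrite -real_normK ?num_real// lerXn2r ?nnegrE ?mulr_ge0 ?ler0n//.
rewrite -/(resample z p') (_ : _ - _ = (life q (box_window n) p'.1 -
    life q (box_window n) (resample z p')) - (total_life p'.1 - total_life (resample z p'))).
  apply: le_trans (ler_normB _ _) _; rewrite mulr_natl mulr2n lerD//.
    by apply: life_resample_le; exact: box_window_uniq.
  rewrite total_life_resample; case: pickP => [i _|_]; last by rewrite normr0 ler0n.
  by apply: life_resample_le; exact: window_uniq.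
rewrite /difference; move: (life _ _ _) (life _ _ _) (total_life _) (total_life _) => a b c e.
by ring.
Qed.

(** At a good site the block sum changes through one block only, so the comparison is between that
    block and the whole box; the radius [2 * n + 1] reaches across the box from any site. *)
Lemma resample_sqr_good z : z \in sites -> good z -> resample_sqr P base difference z <=
  4 * @life_cst R d * (mean_gain q P k - mean_gain q P (2 * n + 1)).
Proof.
move=> /mapP[f _ zE] /existsP[i /forallP iz].
have zb j : - n%:Z - 1 <= z j /\ z j <= n%:Z.
  by rewrite zE ffunE; have := ltn_ord (f j); move: (nat_of_ord _) => x; lia.
have inz : in_block i z.
  apply/forallP => j; have := iz j; move: (corner _ _) (z j) => c x; lia.
apply: le_trans (resample_good q statP prodP (V := block i) (V2 := box_window n) (z := z) _ _ _ _ _).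
- rewrite le_eqVlt; apply/orP; left; apply/eqP/eq_Rintegral => p' _.
  rewrite -/(resample z p').
  have := total_life_resample z p'; case: pickP => [i' i'z|/(_ i)]; last by rewrite inz.
  rewrite (in_block_inj i'z inz) => <-; rewrite /difference.
  by move: (life _ _ _) (life _ _ _) (total_life _) (total_life _) => a b c e; ring.
- exact: window_uniq.
- exact: box_window_uniq.
- apply: window_sub => j; have := iz j; move: (corner _ _) (z j) => c x; lia.
- exact: block_sub.
- move=> K; rewrite mem_box_window => /in_boxP Kn; apply/mem_windowP => j.
  have := Kn j; have := zb j; move: (z j) ((K j).1) ((K j).2) => x y []; lia.
Qed.

Lemma variance_difference (e : R) : 0 <= e ->
  mean_gain q P k - mean_gain q P (2 * n + 1) <= e -> 
  \int[P]_w difference w ^+ 2 - (\int[P]_w difference w) ^+ 2 <=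
  2^-1 * (((2 * n + 2) ^ d)%:R * (4 * @life_cst R d * e) +
    (((2 * n + 2) ^ d)%:R - ((p * (m - (2 * k + 2))) ^ d)%:R) * (2 * @life_cst R d) ^+ 2).
Proof.
move=> e0 he; have c0 : 0 <= @life_cst R d by exact: ler0n.
apply: le_trans (efron_stein prodP bmfun_difference sites_uniq difference_depends) _.
rewrite ler_pM2l ?invr_gt0//.
apply: (@le_trans _ _ (\sum_(z <- sites) (4 * @life_cst R d * e +
    (~~ good z : nat)%:R * (2 * @life_cst R d) ^+ 2))).
  rewrite big_seq [leRHS]big_seq; apply: ler_sum => z zs.
  have [gz|gz] := boolP (good z).
    rewrite mul0r addr0; apply: le_trans (resample_sqr_good zs gz) _.
    by rewrite ler_wpM2l// mulr_ge0.
  rewrite mul1r; apply: le_trans (resample_sqr_bad z) _.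
  by rewrite lerDr !mulr_ge0.
rewrite big_split/= big_const_seq count_predT size_sites iter_addr_0 -mulr_suml.
apply: lerD; first by rewrite [leRHS]mulr_natl.
rewrite ler_wpM2r ?sqr_ge0//.
rewrite -natr_sum lerBrDr -natrD ler_nat -size_sites.
rewrite (_ : (\sum_(z <- sites) ~~ good z)%N = count (predC good) sites); last first.
  by rewrite -sum1_count [RHS]big_mkcond; apply: eq_bigr => z _ /=; case: (good z).
by rewrite -(count_predC good sites) addnC leq_add2r count_good.
Qed.

End Blocks.

(** * The central limit theorem *)

Section Limits.
Context {R : realType}.

Lemma cvg_ratio_sub (a : nat) : (fun m : nat => (m - a)%:R / m%:R : R) @ \oo --> (1 : R).
Proof.
apply/cvgrPdist_le => e e0; near=> m.
have ma : (a < m)%N by near: m; exact: nbhs_infty_gt.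
have me : a%:R / e <= m%:R by near: m; exact: nbhs_infty_ger.
have m0 : (0 : R) < m%:R by rewrite ltr0n; apply: leq_trans ma.
rewrite natrB ?(ltnW ma)// (_ : 1 - _ = a%:R / m%:R); last by field; rewrite gt_eqF.
rewrite ger0_norm ?divr_ge0// ler_pdivrMr//.
by move: me; rewrite ler_pdivrMr// mulrC.
Unshelve. all: by end_near. Qed.

Lemma cvg_ratio_div (m : nat) : (0 < m)%N ->
  (fun n : nat => ((2 * n) %/ m)%:R / (2 * n)%:R : R) @ \oo --> (m%:R^-1 : R).
Proof.
move=> m0; apply/cvgrPdist_le => e e0; near=> n.
have n0 : (0 < n)%N by near: n; exact: nbhs_infty_gt.
have ne : e^-1 <= n%:R by near: n; exact: nbhs_infty_ger.
have M0 : (0 : R) < m%:R by rewrite ltr0n.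
have N0 : (0 : R) < (2 * n)%:R by rewrite ltr0n muln_gt0.
have := divn_eq (2 * n) m; have := ltn_pmod (2 * n) m0.
move: ((2 * n) %/ m)%N ((2 * n) %% m)%N => p r rm e1.
have e2 : (2 * n)%:R = p%:R * m%:R + r%:R :> R by rewrite e1 natrD natrM.
have -> : m%:R^-1 - p%:R / (2 * n)%:R = r%:R / m%:R / (2 * n)%:R :> R.
  move: e2 N0 M0; move: (2 * n)%:R (m%:R) (p%:R) (r%:R) => a b c s -> a0 b0.
  by field; rewrite !gt_eqF.
rewrite ger0_norm ?divr_ge0// ler_pdivrMr//.
apply: (@le_trans _ _ 1).
  by rewrite ler_pdivrMr// mul1r ler_nat ltnW.
have : 1 <= e * n%:R by move: ne; rewrite -[e^-1]mul1r ler_pdivrMr// mulrC.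
by rewrite natrM; have := ltW e0; have := ler0n R n; nra.
Unshelve. all: by end_near. Qed.

Lemma cvg_ratio_add : (fun n : nat => (2 * n + 2)%:R / (2 * n)%:R : R) @ \oo --> (1 : R).
Proof.
apply/cvgrPdist_le => e e0; near=> n.
have n0 : (0 < n)%N by near: n; exact: nbhs_infty_gt.
have ne : e^-1 <= n%:R by near: n; exact: nbhs_infty_ger.
have N0 : (0 : R) < n%:R by rewrite ltr0n.
have -> : 1 - (2 * n + 2)%:R / (2 * n)%:R = - n%:R^-1 :> R.
  by rewrite natrD natrM; field; rewrite gt_eqF.
by rewrite normrN ger0_norm ?invr_ge0 ?ler0n// invf_ple.
Unshelve. all: by end_near. Qed.

Lemma cvgX (u : nat -> R) (l : R) k : u @ \oo --> l -> (fun n => u n ^+ k) @ \oo --> l ^+ k.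
Proof.
move=> ul; elim: k => [|k IH]; first by under eq_fun do rewrite expr0; exact: cvg_cst.
by under eq_fun do rewrite exprS; rewrite exprS; exact: cvgM. Qed.

End Limits.

(** * Normalized fluctuations and their block approximations *)

Section Assembly.
Context {R : realType} {d : nat}.
Notation Om := (Omega R d).
Variables (q : nat) (P : probability Om R).
Hypotheses (d_gt0 : (0 < d)%N) (prodP : product_measure P) (statP : stationary P).

Notation vol := (@volLambda R d).
Let sv n := Num.sqrt (vol n).

Definition fluctuation (n : nat) (w : Om) : R :=
  (Lqn q n w - expect P (Lqn q n)) / Num.sqrt (vol n).

Lemma bmfun_Lqn n : bmfun (Lqn (R := R) (d := d) q n).
Proof.
have -> : Lqn (R := R) (d := d) q n = life q (box_window n).
  by apply/funext => w; exact: LqnE.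
exact: (bmfun_life q P).
Qed.

Lemma bmfun_fluctuation n : bmfun (fluctuation n).
Proof.
by apply: bmfunM; [apply: bmfunB; [exact: bmfun_Lqn|exact: bmfun_cst]|exact: bmfun_cst].
Qed.

Lemma vol_ge n : (2 * n)%:R <= vol n.
Proof.
rewrite /volLambda ler_nat; case: n => [//|n].
by rewrite -[X in (X <= _)%N]expn1 leq_pexp2l// muln_gt0.
Qed.

Lemma vol_gt0 n : (0 < n)%N -> 0 < vol n.
Proof. by move=> n0; apply: lt_le_trans (vol_ge n); rewrite ltr0n muln_gt0. Qed.

Let sv_gt0 n : (0 < n)%N -> 0 < sv n.
Proof. by move=> n0; rewrite sqrtr_gt0 vol_gt0. Qed.

Let sv_sqr n : sv n ^+ 2 = vol n.
Proof. by rewrite sqr_sqrtr// /volLambda. Qed.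

Lemma inv_sqrt_vol_cvg0 : (fun n => (Num.sqrt (vol n))^-1) @ \oo --> (0 : R).
Proof.
apply/cvgrPdist_le => e e0; near=> n.
have n0 : (0 < n)%N by near: n; exact: nbhs_infty_gt.
have ne : (e ^+ 2)^-1 <= n%:R by near: n; exact: nbhs_infty_ger.
rewrite sub0r normrN ger0_norm ?invr_ge0 ?sqrtr_ge0//.
rewrite invf_ple ?posrE ?sv_gt0//.
rewrite -(ler_pXn2r (n := 2))// ?nnegrE ?sqrtr_ge0 ?invr_ge0 ?(ltW e0)// sv_sqr exprVn.
apply: le_trans ne _; apply: le_trans _ (vol_ge n).
by rewrite ler_nat leq_pmull.
Unshelve. all: by end_near. Qed.

(** * Block sums for a fixed block side *)

Section FixedBlocks.
Variables (m k : nat).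
Hypothesis km : (2 * k + 2 < m)%N.
Let p n := ((2 * n) %/ m)%N.
Let pm n : (p n * m <= 2 * n)%N. Proof. exact: leq_divM. Qed.
Let m_gt0 : (0 < m)%N. Proof. by apply: leq_trans km. Qed.

(** Reference block: every block is a translate of it, so by stationarity the block terms have the
    law of [X0] divided by [sv n]. *)
Let V0 : seq (cube d) := window (fun=> 0) m.-1.
Let mean0 : R := \int[P]_w life q V0 w.
Let X0 (w : Om) : R := life q V0 w - mean0.
Let var0 : R := \int[P]_w X0 w ^+ 2.

Let bmfun_X0 : bmfun X0.
Proof. by apply: bmfunB; [exact: (bmfun_life q P)|exact: bmfun_cst]. Qed.

Let X0_mean : \int[P]_w X0 w = 0.
Proof.
rewrite bmfun_intB; [|exact: (bmfun_life q P)|exact: bmfun_cst].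
by rewrite integral_cst_prob subrr.
Qed.

Let var0_ge0 : 0 <= var0.
Proof. by apply: Rintegral_ge0 => w _; exact: sqr_ge0. Qed.

Definition block_term n (i : {ffun 'I_d -> 'I_(p n)}) (w : Om) : R :=
  (life q (block n m i) w - mean0) / sv n.

Definition block_sum n (w : Om) : R := \sum_(i <- enum {ffun 'I_d -> 'I_(p n)}) block_term i w.

Let block_life n (i : {ffun 'I_d -> 'I_(p n)}) (w : Om) :
  life q (block n m i) w = life q V0 (tau (fun j => - (corner n m i j + 1)) w).
Proof.
set x := fun _ => _; have -> : block n m i = [seq ctrans x K | K <- V0].
  by rewrite window_ctrans; congr window; apply/funext => j; rewrite sub0r opprK.
exact: life_ctrans.
Qed.

Let block_termE n (i : {ffun 'I_d -> 'I_(p n)}) (w : Om) :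
  block_term i w = X0 (tau (fun j => - (corner n m i j + 1)) w) / sv n.
Proof. by rewrite /block_term block_life. Qed.

Let bmfun_block_term n (i : {ffun 'I_d -> 'I_(p n)}) : bmfun (block_term i).
Proof.
by apply: bmfunM; [apply: bmfunB; [exact: (bmfun_life q P)|exact: bmfun_cst]|exact: bmfun_cst].
Qed.

Let block_term_depends n (i : {ffun 'I_d -> 'I_(p n)}) :
  depends_on (fun Q => in_block n m i (base Q)) (block_term i).
Proof.
by move=> a b ab; rewrite /block_term (block_depends q (pm n) km (i := i) ab).
Qed.

Let block_disjoint n (i i' : {ffun 'I_d -> 'I_(p n)}) (Q : cube d) :
  in_block n m i (base Q) -> in_block n m i' (base Q) -> i = i'.
Proof. exact: (in_block_inj (pm n) km). Qed.

Let block_term_mean n (i : {ffun 'I_d -> 'I_(p n)}) : \int[P]_w block_term i w = 0.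
Proof.
under eq_Rintegral do rewrite block_termE.
rewrite (int_tau statP _ (f := fun w => X0 w / sv n)); last first.
  by apply: bmfunM => //; exact: bmfun_cst.
by under eq_Rintegral do rewrite mulrC; rewrite bmfun_intZl// X0_mean mulr0.
Qed.

Let block_term_var n (i : {ffun 'I_d -> 'I_(p n)}) :
  \int[P]_w block_term i w ^+ 2 = var0 / vol n.
Proof.
under eq_Rintegral do rewrite block_termE.
rewrite (int_tau statP _ (f := fun w => (X0 w / sv n) ^+ 2)); last first.
  by apply: bmfunX; apply: bmfunM => //; exact: bmfun_cst.
under eq_Rintegral do rewrite expr_div_n sv_sqr mulrC.
by rewrite bmfun_intZl; [exact: mulrC|exact: bmfunX].
Qed.

Let bmfun_block_sum n : bmfun (block_sum n).
Proof. by apply: bmfun_sum => i; exact: bmfun_block_term. Qed.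

Let ratio n : R := ((p n) ^ d)%:R / vol n.

Let ratio_cvg : ratio @ \oo --> (m%:R^-1 ^+ d : R).
Proof.
rewrite (_ : ratio = fun n => ((p n)%:R / (2 * n)%:R) ^+ d).
  by apply: cvgX; exact: cvg_ratio_div.
by apply/funext => n; rewrite /ratio /volLambda !natrX expr_div_n.
Qed.

Let size_blocks n : size (enum {ffun 'I_d -> 'I_(p n)}) = (p n ^ d)%N.
Proof. by rewrite -cardE card_ffun !card_ord. Qed.

Let block_sum_var n : \int[P]_w block_sum n w ^+ 2 = ratio n * var0.
Proof.
rewrite (variance_sum prodP (@bmfun_block_term n) (@block_term_depends n)
  (@block_disjoint n) (enum_uniq _) (@block_term_mean n)).
under eq_bigr do rewrite block_term_var.
rewrite big_const_seq count_predT size_blocks iter_addr_0 -mulr_natl /ratio.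
by rewrite mulrA mulrAC.
Qed.

(** Its square is the variance of one block divided by the volume [m ^ d]. *)
Let sigma : R := Num.sqrt var0 * Num.sqrt (m%:R^-1 ^+ d).

Let sigma_ge0 : 0 <= sigma. Proof. by rewrite mulr_ge0 ?sqrtr_ge0. Qed.

Let block_sum_var_cvg : (fun n => \int[P]_w block_sum n w ^+ 2) @ \oo --> sigma ^+ 2.
Proof.
under eq_fun do rewrite block_sum_var.
rewrite /sigma exprMn !sqr_sqrtr ?exprn_ge0 ?invr_ge0// mulrC.
by apply: cvgM; [exact: ratio_cvg|exact: cvg_cst].
Qed.

(** At most [vol n] blocks each cost a multiple of [(sv n) ^- 3], so the total error is of order
    [(sv n)^-1]; the Gaussian scale depends on [n] through [ratio n] and converges to [sigma]. *)
Let block_sum_clt g : smooth3 g ->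
  (fun n => \int[P]_w g (block_sum n w)) @ \oo --> gsmooth sigma g 0.
Proof.
move=> sg; have cg := smooth3_continuous sg; have bg := smooth3_bounded sg.
have [K K0 gT] := smooth3_close P sg.
have [L L0 gL] := smooth3_lipschitz sg.
have [_ [B X0B]] := bmfun_X0.
have B0 : 0 <= B by apply: le_trans (X0B point).
have m30 := @gauss_m3_ge0 R.
pose scale n := Num.sqrt var0 * Num.sqrt (ratio n).
have scale_cvg : scale @ \oo --> sigma.
  apply: cvgM; first exact: cvg_cst.
  by apply: continuous_cvg => //; exact: sqrt_continuous.
have bound n : (0 < n)%N -> `|\int[P]_w g (block_sum n w) - gsmooth (scale n) g 0| <=
    K * B ^+ 3 * (sv n)^-1.
  move=> n0; have s0 := sv_gt0 n0; have v0 := vol_gt0 n0.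
  have close i z : `|\int[P]_w g (z + block_term (n := n) i w) -
      gsmooth (Num.sqrt var0 / sv n) g z| <= K * (B / sv n) ^+ 3.
    apply: gT => //.
    - by rewrite divr_ge0 ?sqrtr_ge0.
    - by rewrite block_term_var expr_div_n sqr_sqrtr// sv_sqr.
    - move=> w; rewrite block_termE normrM normfV (gtr0_norm s0).
      by rewrite ler_pM2r ?invr_gt0.
  have := lindeberg prodP (@bmfun_block_term n) (@block_term_depends n)
    (@block_disjoint n) cg bg _ close 0 (enum_uniq _).
  rewrite divr_ge0 ?sqrtr_ge0// => /(_ isT {ffun 'I_d -> 'I_(p n)}); rewrite size_blocks.
  have -> : Num.sqrt var0 / sv n * Num.sqrt ((p n ^ d)%:R) = scale n.
    rewrite /scale /ratio sqrtrM ?ler0n// sqrtrV ?ler0n// -/(sv n).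
    by rewrite -mulrA [_^-1 * _]mulrC.
  under eq_Rintegral do rewrite add0r.
  move=> /le_trans; apply.
  have -> : (p n ^ d)%:R * (K * (B / sv n) ^+ 3) = (K * B ^+ 3 * (sv n)^-1) * ratio n.
    by rewrite /ratio -sv_sqr; field; rewrite gt_eqF.
  rewrite ler_piMr ?mulr_ge0 ?exprn_ge0 ?invr_ge0 ?sqrtr_ge0//.
  rewrite ler_pdivrMr// mul1r /volLambda ler_nat leq_exp2r//.
  exact: leq_div.
have scale_close : (fun n => gsmooth (scale n) g 0) @ \oo --> gsmooth sigma g 0.
  apply/cvgrPdist_le => e e0.
  have L1 : 0 < (L + 1) * (1 + gauss_m3) by rewrite mulr_gt0//; lra.
  have e1 : 0 < e / ((L + 1) * (1 + gauss_m3)) by rewrite divr_gt0.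
  move/cvgrPdist_le/(_ _ e1) : scale_cvg; apply: filterS => n h.
  apply: le_trans (gsmooth_lipschitz _ _ _ cg bg L0 gL) _.
  apply: (@le_trans _ _ ((L + 1) * (1 + gauss_m3) * `|sigma - scale n|)).
    rewrite mulrAC ler_wpM2r// ler_wpM2r//; lra.
  by rewrite mulrC -ler_pdivlMr.
have err : (fun n => K * B ^+ 3 * (sv n)^-1) @ \oo --> (0 : R).
  rewrite -(mulr0 (K * B ^+ 3)); apply: cvgM; [exact: cvg_cst|exact: inv_sqrt_vol_cvg0].
apply/cvgrPdist_le => e e0.
have e2 : 0 < e / 2 by rewrite divr_gt0.
move/cvgrPdist_le/(_ _ e2) : err => err.
move/cvgrPdist_le/(_ _ e2) : scale_close => scl.
near=> n.
have n0 : (0 < n)%N by near: n; exact: nbhs_infty_gt.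
have h1 : `|0 - K * B ^+ 3 * (sv n)^-1| <= e / 2 by near: n; exact: err.
have h2 : `|gsmooth sigma g 0 - gsmooth (scale n) g 0| <= e / 2 by near: n; exact: scl.
rewrite (_ : _ - _ = (gsmooth sigma g 0 - gsmooth (scale n) g 0) -
  (\int[P]_w g (block_sum n w) - gsmooth (scale n) g 0)); last ring.
apply: le_trans (ler_normB _ _) _; rewrite [leRHS]splitr lerD//.
apply: le_trans (bound n n0) _.
by move: h1; rewrite sub0r normrN; apply: le_trans; exact: ler_norm.
Unshelve. all: by end_near. Qed.

Let c := @life_cst R d.

(** Both sequences are centred, so their mean-square distance is the variance of [difference] over
    the volume. *)
Let variance_bound (e1 : R) n : 0 <= e1 -> (0 < n)%N ->
  mean_gain q P k - mean_gain q P (2 * n + 1) <= e1 ->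
  \int[P]_w (fluctuation n w - block_sum n w) ^+ 2 <=
  2^-1 * ((((2 * n + 2)%:R / (2 * n)%:R) ^+ d) * (4 * c * e1) +
    ((((2 * n + 2)%:R / (2 * n)%:R) ^+ d) -
     ((p n)%:R / (2 * n)%:R * (m - (2 * k + 2))%:R) ^+ d) * (2 * c) ^+ 2).
Proof.
move=> e10 n0 he; have s0 := sv_gt0 n0; have v0 := vol_gt0 n0.
pose D := difference (R := R) (d := d) q n m (p n).
have bD : bmfun D by exact: (bmfun_difference q n m (p n) P).
have := variance_difference (pm n) km prodP statP e10 he; rewrite -/D => hD.
have mD : \int[P]_w D w = expect P (Lqn q n) - (p n ^ d)%:R * mean0.
  rewrite /D /difference bmfun_intB; last 2 first.
  - exact: (bmfun_life q P).
  - by apply: bmfun_sum => i; exact: (bmfun_life q P).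
  congr (_ - _).
    by apply: eq_Rintegral => w _; rewrite LqnE.
  rewrite /total_life bmfun_int_sum; last by move=> i; exact: (bmfun_life q P).
  under eq_bigr => i _.
    under eq_Rintegral do rewrite block_life.
    rewrite (int_tau statP); last exact: (bmfun_life q P).
    over.
  by rewrite big_const_seq count_predT size_blocks iter_addr_0 mulr_natl.
have WY w : fluctuation n w - block_sum n w = (sv n)^-1 * (D w - \int[P]_w D w).
  rewrite mD /fluctuation /block_sum /block_term -mulr_suml sumrB.
  rewrite big_const_seq count_predT size_blocks iter_addr_0 -mulr_natl.
  rewrite LqnE -/(sv n) /D /difference /total_life.
  by move: (life _ _ _) (expect _ _) (\sum_(i <- _) _) mean0 => a1 a2 a3 a4; ring.
have -> : \int[P]_w (fluctuation n w - block_sum n w) ^+ 2 =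
    (vol n)^-1 * (\int[P]_w D w ^+ 2 - (\int[P]_w D w) ^+ 2).
  under eq_Rintegral do rewrite WY exprMn exprVn sv_sqr.
  rewrite bmfun_intZl; last by apply: bmfunX; apply: bmfunB => //; exact: bmfun_cst.
  congr (_ * _); set a := \int[P]_w D w.
  under eq_Rintegral do rewrite sqrrB -mulr_natl mulrA mulrAC.
  have bmD : bmfun (fun w => 2 * a * D w) by apply: bmfunM => //; exact: bmfun_cst.
  rewrite bmfun_intD; [|by apply: bmfunB => //; exact: bmfunX|exact: bmfun_cst].
  rewrite bmfun_intB//; last exact: bmfunX.
  by rewrite bmfun_intZl// integral_cst_prob -/a; ring.
rewrite mulrC ler_pdivrMr//; apply: le_trans hD _.
rewrite -[leRHS]mulrA ler_pM2l ?invr_gt0// /volLambda.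
have N0 : (0 : R) < (2 * n)%:R by rewrite ltr0n muln_gt0.
have NX : (2 * n)%:R ^+ d != 0 :> R by rewrite expf_neq0// gt_eqF.
rewrite le_eqVlt; apply/orP; left; apply/eqP.
rewrite !natrX natrM !exprMn !exprVn.
move: ((2 * n)%:R ^+ d) NX ((2 * n + 2)%:R ^+ d) ((p n)%:R ^+ d) ((m - (2 * k + 2))%:R ^+ d) => N NX A1 A2 A3.
by rewrite /c; move: (@life_cst R d) => b; field.
Qed.

(** With [l] the limit density of guaranteed good sites, the bound of [variance_bound] tends to
    [2 * (c * e1) + 2 * (c ^+ 2 * (1 - l))], at most [e / 2], and so is eventually below [e]. *)
Lemma approx_by_blocks (e e1 : R) : 0 < e -> 0 <= e1 -> c * e1 <= e / 8 ->
  c ^+ 2 * (1 - ((m - (2 * k + 2))%:R / m%:R) ^+ d) <= e / 8 ->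
  (forall k', (k <= k')%N -> mean_gain q P k - mean_gain q P k' <= e1) ->
  approx_by P fluctuation e sigma block_sum.
Proof.
move=> e0 e10 h1 h2 hk; split => //.
pose A n : R := ((2 * n + 2)%:R / (2 * n)%:R) ^+ d.
pose A' n : R := ((p n)%:R / (2 * n)%:R * (m - (2 * k + 2))%:R) ^+ d.
have cA : A @ \oo --> (1 : R).
  by rewrite -[X in _ --> X](expr1n _ d); apply: cvgX; exact: cvg_ratio_add.
have cA' : A' @ \oo --> (((m - (2 * k + 2))%:R / m%:R) ^+ d : R).
  rewrite [_ / m%:R]mulrC; apply: cvgX; apply: cvgM; last exact: cvg_cst.
  exact: cvg_ratio_div.
set l := _ ^+ d in h2 cA'.
have cB : (fun n => 2^-1 * (A n * (4 * c * e1) + (A n - A' n) * (2 * c) ^+ 2)) @ \oo -->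
    2^-1 * (1 * (4 * c * e1) + (1 - l) * (2 * c) ^+ 2).
  apply: cvgM; first exact: cvg_cst.
  apply: cvgD; apply: cvgM; try exact: cvg_cst; first exact: cA.
  exact: cvgB.
have lim_lt : 2^-1 * (1 * (4 * c * e1) + (1 - l) * (2 * c) ^+ 2) < e.
  have -> : 2^-1 * (1 * (4 * c * e1) + (1 - l) * (2 * c) ^+ 2) =
    2 * (c * e1) + 2 * (c ^+ 2 * (1 - l)) by field.
  move: h1 h2; move: (c * e1) (c ^+ 2 * (1 - l)) => a b; lra.
have [] : \forall n \near \oo, 2^-1 * (A n * (4 * c * e1) + (A n - A' n) * (2 * c) ^+ 2) <= e.
  by move/cvgr_le : cB; apply.
move=> N _ hN; near=> n.
have n0 : (0 < n)%N by near: n; exact: nbhs_infty_gt.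
apply: le_trans (variance_bound e10 n0 _) _.
  by apply: hk; apply: leq_trans (_ : k <= n)%N _; [near: n; exact: nbhs_infty_ge|lia].
by apply: hN => /=; near: n; exact: nbhs_infty_ge.
Unshelve. all: by end_near. Qed.

End FixedBlocks.

(** The order of choices matters: the radius [k] comes from [mean_gain], and then the side [m] is
    taken so large that sites within about [k] of a block boundary have small density. *)
Lemma fluctuation_approx (e : R) : 0 < e ->
  exists sigma Y, approx_by P fluctuation e sigma Y.
Proof.
move=> e0; have c0 : 0 <= @life_cst R d by exact: ler0n.
pose e1 : R := e / (8 * (@life_cst R d + 1)).
have e10 : 0 < e1 by rewrite divr_gt0// mulr_gt0// ltr_wpDl.
have [k hk] := mean_gain_cauchy q P e10.
pose e2 : R := e / (8 * (@life_cst R d ^+ 2 + 1)).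
have e20 : 0 < e2 by rewrite divr_gt0// mulr_gt0// ltr_wpDl// sqr_ge0.
have : (fun m : nat => ((m - (2 * k + 2))%:R / m%:R) ^+ d : R) @ \oo --> (1 : R).
  by rewrite -[X in _ --> X](expr1n _ d); apply: cvgX; exact: cvg_ratio_sub.
move=> /cvgrPdist_le/(_ _ e20)[M _ hM].
pose m := (M + (2 * k + 3))%N.
have km : (2 * k + 2 < m)%N by rewrite /m; lia.
have := hM m; rewrite /= leq_addr => /(_ isT) hm.
have h1 : @life_cst R d * e1 <= e / 8.
  rewrite /e1; move: (@life_cst R d) c0 => b b0.
  have -> : b * (e / (8 * (b + 1))) = e / 8 * (b / (b + 1)) by field; lra.
  by rewrite ler_piMr ?divr_ge0 ?(ltW e0)// ler_pdivrMr; lra.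
have h2 : @life_cst R d ^+ 2 * (1 - ((m - (2 * k + 2))%:R / m%:R) ^+ d) <= e / 8.
  have b0 := sqr_ge0 (@life_cst R d).
  apply: le_trans (ler_wpM2l b0 (le_trans (ler_norm _) hm)) _.
  rewrite /e2; move: (@life_cst R d ^+ 2) b0 => b b0.
  have -> : b * (e / (8 * (b + 1))) = e / 8 * (b / (b + 1)) by field; lra.
  by rewrite ler_piMr ?divr_ge0 ?(ltW e0)// ler_pdivrMr; lra.
by exists (Num.sqrt (\int[P]_w (life q (window (fun=> 0) m.-1) w -
    \int[P]_w life q (window (fun=> 0) m.-1) w) ^+ 2) * Num.sqrt (m%:R^-1 ^+ d)), (block_sum m);
  exact: (approx_by_blocks km e0 (ltW e10) h1 h2 hk).
Qed.

End Assembly.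

Theorem theorem2p13 (R : realType) (d q : nat) (P : probability (Omega R d) R) :
  (q < d)%N ->
  unit_valued P -> product_measure P -> stationary P -> ergodic P ->
  exists tau2 : R, 0 <= tau2 /\
    (fun n : nat => expect P (fun w => (Lqn q n w - expect P (Lqn q n)) ^+ 2)
                    / @volLambda R d n) @ \oo --> tau2 /\
    cvg_law_normal P
      (fun n w => (Lqn q n w - expect P (Lqn q n)) / Num.sqrt (@volLambda R d n)) tau2.
Proof.
move=> qd _ prodP statP _.
have d0 : (0 < d)%N by exact: leq_ltn_trans qd.
have [tau2 [t0 var law]] := clt_of_approx (bmfun_fluctuation q P) (fluctuation_approx q d0 prodP statP).
exists tau2; split => //; split.
  apply: cvg_trans var; apply: near_eq_cvg; near=> n.
  have v0 : 0 <= @volLambda R d n by exact: ler0n.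
  under eq_Rintegral do rewrite /fluctuation expr_div_n sqr_sqrtr// mulrC.
  rewrite bmfun_intZl; first exact: mulrC.
  by apply: bmfunX; apply: bmfunB; [exact: bmfun_Lqn|exact: bmfun_cst].
move=> f cf bf.
have -> : gauss_expect tau2 f = gsmooth (Num.sqrt tau2) f 0.
  by rewrite gauss_expectE//; apply: eq_Rintegral => x _; rewrite add0r.
exact: law.
Unshelve. all: by end_near. Qed.
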